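(* Let $n\ge 2$ and let $f:[0,\infty)\to[0,\infty)$ be a continuous function such that $f\not\equiv 0$, $f(0)=0$, and $t\mapsto f(t)/t$ is an increasing function for $t>0$. Let $D$ be a bounded domain in $\mathbb{C}^n$ with $0\in\partial D$ which near $0$ is given by $\operatorname{Re}(z_1)+O(|\operatorname{Im}(z_1)|)<f(\|z'\|)$; that is, there are a neighborhood $U$ of $0$, a constant $C>0$ and a function $h:U\to\mathbb{R}$ with $|h(z)|\le C|\operatorname{Im}(z_1)|$ for $z\in U$, such that $$D\cap U=\{z\in U : \operatorname{Re}(z_1)+h(z)<f(\|z'\|)\}.$$ Then there exists a constant $c>1$ such that for all sufficiently small $\delta>0$ and all $X\in\mathbb{C}^n$, $$c^{-1}B(\delta;X)\le S_D(q_\delta;X)\le A_D(q_\delta;X)\le c\,B(\delta;X),$$ where $q_\delta:=(-\delta,0')$ and $$B(\delta;X):=\frac{f^{-1}(\delta)}{\delta}|X_1|+\|X\|.$$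
   Context: Points of $\mathbb{C}^n$ are written $z=(z_1,z')$ with $z'=(z_2,\dots,z_n)\in\mathbb{C}^{n-1}$; $0'$ is the origin of $\mathbb{C}^{n-1}$; $\|\cdot\|$ is the Euclidean norm. For $\delta>0$, $f^{-1}(\delta)$ is the unique $t>0$ with $f(t)=\delta$ (it exists and is unique under the stated hypotheses on $f$). For a domain $D\subset\mathbb{C}^n$, $z\in D$, $X\in\mathbb{C}^n$: The Sibony metric is $S_D(z;X):=\sup_v[\mathcal{L}_v(z;X)]^{1/2}$, where $\mathcal{L}_v(z;X)=\sum_{j,k=1}^n\frac{\partial^2 v}{\partial z_j\partial\bar z_k}(z)X_j\overline{X_k}$ is the Levi form of $v$, and the supremum is over all functions $v:D\to[0,1)$ such that $v(z)=0$, $\log v$ is plurisubharmonic on $D$, and $v$ is of class $\mathcal{C}^2$ near $z$. The pluricomplex Green function with pole at $z$ is $g_D(z,w):=\sup\{u(w)\}$, the supremum being over all plurisubharmonic functions $u$ on $D$ with $u<0$ and $u<\log\|\cdot-z\|+C$ on $D$ for some constant $C$ (depending on $u$). The Azukawa metric is $A_D(z;X):=\limsup_{\lambda\to 0}\dfrac{\exp g_D(z,z+\lambda X)}{|\lambda|}$, with $\lambda\in\mathbb{C}\setminus\{0\}$. *)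

(* Defs.v *)
From HB Require Import structures.
From mathcomp Require Import all_boot all_order all_algebra.
From mathcomp Require Import complex.
From mathcomp Require Import all_classical all_reals all_analysis.

Set Implicit Arguments.
Unset Strict Implicit.
Unset Printing Implicit Defensive.

Import Order.TTheory GRing.Theory Num.Theory.
Import numFieldNormedType.Exports.
Import ComplexField.Normc.

Local Open Scope classical_set_scope.
Local Open Scope ring_scope.
Local Open Scope complex_scope.

(* R[i] seen as the carrier of a numFieldType: this is what makes the norm
   topology of R[i], and the product topology of C^n, available. *)
Notation Cplx R :=
  (Num.NumField.sort (ComplexField.complex_complex__canonical__Num_NumField R)).

(* C^n; functions on a domain of C^n are represented by total functions on C^n,
   and only their values on the domain matter below. *)
Notation Cn R n := 'rV[Cplx R]_n.

Section Definitions.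
Variable R : realType.

(* `|z| on 'rV is the sup norm, hence a separate Euclidean norm. *)
Definition enorm (n : nat) (z : Cn R n) : R :=
  Num.sqrt (\sum_j normc (z ord0 j) ^+ 2).

Definition boundary (n : nat) (A : set (Cn R n)) : set (Cn R n) :=
  closure A `\` interior A.

Definition is_domain (n : nat) (D : set (Cn R n)) : Prop :=
  [/\ open D, connected D & D !=set0].

(* Psh functions take values in [-oo, +oo[; the function constantly -oo is
   allowed. The sub-mean value inequality is required on every closed disc
   {a + l b : |l| <= 1} contained in D. *)
Definition psh (n : nat) (D : set (Cn R n)) (u : Cn R n -> \bar R) : Prop :=
  [/\ (forall z, D z -> (u z < +oo)%E),
      (forall z, D z -> forall a : R, (u z < a%:E)%E ->
         \forall w \near z, (u w < a%:E)%E) &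
      (forall a b : Cn R n,
         (forall l : Cplx R, `|l| <= 1 -> D (a + l *: b)) ->
         (u a <= ((2 * pi)^-1)%:E *
            \int[lebesgue_measure]_(t in [set` `[0%R, (2 * pi)%R]])
               u (a + (cos t +i* sin t) *: b)%R)%E)].

(* The real-linear coordinate directions of C^n: b = false gives x_j and
   b = true gives y_j, where z_j = x_j + i y_j. *)
Definition rdir (n : nat) (j : 'I_n) (b : bool) : Cn R n :=
  (if b then 'i else 1) *: delta_mx ord0 j.

Definition on_line (n : nat) (v : Cn R n -> R) (w e : Cn R n) : R -> R :=
  fun t : R => v (w + t%:C *: e).

Definition pderiv (n : nat) (e : Cn R n) (v : Cn R n -> R) : Cn R n -> R :=
  fun w => derive1 (on_line v w e) 0.

(* Class C^k, in the real sense, on an open set U. *)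
Fixpoint is_Ck (n k : nat) (U : set (Cn R n)) (v : Cn R n -> R) : Prop :=
  (forall w, U w -> {for w, continuous v}) /\
  (if k is k'.+1 then
     forall (j : 'I_n) (b : bool),
       (forall w, U w -> derivable (on_line v w (rdir j b)) 0 1) /\
       is_Ck k' U (pderiv (rdir j b) v)
   else True).

Definition C2_near (n : nat) (v : Cn R n -> R) (z : Cn R n) : Prop :=
  exists U : set (Cn R n), [/\ open U, U z & is_Ck 2 U v].

(* d^2 v / dz_j d\bar z_k, i.e. the expansion of
   (1/4) (d/dx_j - i d/dy_j) (d/dx_k + i d/dy_k) v. *)
Definition d2_z_zbar (n : nat) (v : Cn R n -> R) (j k : 'I_n) (w : Cn R n)
    : Cplx R :=
  let d a b := pderiv (rdir j a) (pderiv (rdir k b) v) w in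
  (4^-1 * (d false false + d true true)) +i*
  (4^-1 * (d false true - d true false)).

(* For v of class C^2 the coefficients are Hermitian and the sum is real; Re
   only transports it from R[i] to R. *)
Definition levi (n : nat) (v : Cn R n -> R) (z X : Cn R n) : R :=
  complex.Re (\sum_j \sum_k d2_z_zbar v j k z * X ord0 j * (X ord0 k)^*).

(* log v is lne (v _)%:E, with lne 0 = -oo. *)
Definition sibony_class (n : nat) (D : set (Cn R n)) (z : Cn R n)
    : set (Cn R n -> R) :=
  [set v | [/\ (forall w, D w -> 0 <= v w < 1),
               v z = 0,
               psh D (fun w => lne (v w)%:E) &
               C2_near v z]].

Definition sibony (n : nat) (D : set (Cn R n)) (z X : Cn R n) : \bar R :=
  ereal_sup [set (Num.sqrt (levi v z X))%:E | v in sibony_class D z].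

(* The bound u < log ||. - z|| + C is imposed off the pole, where log is
   finite; for psh u it forces u z = -oo. *)
Definition green_class (n : nat) (D : set (Cn R n)) (z : Cn R n)
    : set (Cn R n -> \bar R) :=
  [set u | [/\ psh D u,
               (forall w, D w -> (u w < 0)%E) &
               exists C : R, forall w, D w -> w != z ->
                 (u w < (ln (enorm (w - z)) + C)%:E)%E]].

Definition green (n : nat) (D : set (Cn R n)) (z w : Cn R n) : \bar R :=
  ereal_sup [set u w | u in green_class D z].

Definition azukawa (n : nat) (D : set (Cn R n)) (z X : Cn R n) : \bar R :=
  limf_esup (fun l : Cplx R =>
    (expeR (green D z (z + l *: X)) * ((normc l)^-1)%:E)%E) (0 : Cplx R)^'.

(* The unique t > 0 with f t = d when there is one, and 0 if there is none. *)
Definition finv (f : R -> R) (d : R) : R :=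
  xget 0 [set t | 0 < t /\ f t = d].

(* z' = (z_2, ..., z_n), coordinate z_1 being the one of index ord0. *)
Definition tail (n : nat) (z : Cn R n.+1) : Cn R n := col' ord0 z.

Definition q (n : nat) (d : R) : Cn R n.+1 :=
  (- d)%:C *: delta_mx ord0 ord0.

Definition B (n : nat) (f : R -> R) (d : R) (X : Cn R n.+1) : R :=
  finv f d / d * normc (X ord0 ord0) + enorm X.

End Definitions.

(* Main.v *)
(** Put t = f^{-1}(delta) and q = q_delta.

    Upper bound for A_D: if e_2 is the second unit vector and b = s e_2 with s a
    large multiple of B(delta; X), the convexity-type hypothesis on f puts the
    discs { q + l (X + e^{ia} b) : |l| <= r_0 / (4 s) } inside D for every a. A
    Schwarz lemma bounds each competitor of the Green function by ln (|l| / rho)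
    on each of them, rho = r_0 / (4 s), and the mean value inequality over the
    circle of the q + l (X + e^{ia} b) transfers this bound to q + l X.

    Middle inequality: if v is a competitor for S_D then (ln v) / 2 is one, up to
    an additive constant, for the Green function.

    Lower bound for S_D: within 2 tau of q, tau a small multiple of t, every point
    of D has |z_1 - delta| bounded below by a multiple of delta, so there the
    function v_1 = (sig |z_1 + delta| / |z_1 - delta|)^2 + |z - q|^2, sig a small
    multiple of t, is a ratio of Hermitian squares with at most the size of tau^2;
    its Levi form at q is comparable to B(delta; X)^2. It is extended to D by the
    maximum with v_2 = 2 |z - q|^(2 + 2 eta) / tau^(2 eta), eta of order
    1 / ln (1 / tau): v_2 > v_1 for |z - q| >= tau, v_2 < v_1 near q, and v_2 is
    bounded on D uniformly in tau. Both branches are bounded below along small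
    circles by functions k ln |polynomial|^2, so ln v has the mean value
    inequality up to O(s^3) on circles of radius s, which is enough. *)

Require Import Defs.
From HB Require Import structures.
From mathcomp Require Import all_boot all_order all_algebra.
From mathcomp Require Import complex.
From mathcomp Require Import all_classical all_reals all_analysis.
From mathcomp Require Import measurable_realfun ring lra.
Set Implicit Arguments.
Unset Strict Implicit.
Unset Printing Implicit Defensive.
Import Order.TTheory GRing.Theory Num.Theory.
Import numFieldNormedType.Exports.
Import ComplexField.Normc.
Local Open Scope classical_set_scope.
Local Open Scope ring_scope.
Local Open Scope complex_scope.

(** * The Euclidean norm of C^n *)

(** The obstacle is uniformity: [q] is at distance at most delta from the boundary, yet no constant
    may depend on delta. For the upper bound, D contains up to a fixed radius r_0 a cone with vertex
    [q], of aperture delta / t in the z_1 direction. A direction X may leave this cone, and since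
    subadditivity of the Azukawa metric is not at hand, X cannot be split into a normal and a
    tangential part; averaging over the rotated tangential vectors e^{ia} b does that job. For the
    lower bound, the hyperplane z_1 = delta is known to avoid D only near [q], so v_1 is a local
    object. A continuation c |z - q|^2 of order exactly 2 fails: lying below v_1 near [q] forces c
    <= 1, since v_1 = |z - q|^2 in tangential directions, while dominating tau^2 + |z - q|^2 farther
    out forces c > 1. The exponent 2 + 2 eta reconciles both, and eta shrinks with tau because (d_0
    / tau)^(2 eta) has to stay bounded. Gluing is local, whereas [psh] speaks of whole discs. Errors
    of order s^3 are harmless in passing from one to the other: adding a small multiple of |l|^2
    gains order s^2. *)

Section ComplexModulus.
Variable R : realType.

Lemma normc_ge0 (z : Cplx R) : 0 <= normc z.
Proof. by case: z => a b; exact: sqrtr_ge0. Qed.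

Lemma norm_normcE (z : Cplx R) : `|z| = (normc z)%:C :> Cplx R.
Proof. by case: z. Qed.

Lemma normcX (z : Cplx R) n : normc (z ^+ n) = normc z ^+ n.
Proof. by elim: n => [|n IH]; rewrite ?expr0 ?normc1// !exprS normcM IH. Qed.

Lemma normc_real (x : R) : normc x%:C = `|x|.
Proof. by rewrite /= expr0n addr0 sqrtr_sqr. Qed.

Lemma normc_conj (z : Cplx R) : normc z^*%C = normc z.
Proof. by case: z => a b /=; rewrite sqrrN. Qed.

Lemma normc_opp (z : Cplx R) : normc (- z) = normc z.
Proof. by case: z => a b /=; rewrite !sqrrN. Qed.

Lemma Re_le_normc (z : Cplx R) : `|complex.Re z| <= normc z.
Proof. by case: z => a b /=; rewrite -sqrtr_sqr ler_wsqrtr// lerDl sqr_ge0. Qed.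

Lemma Im_le_normc (z : Cplx R) : `|complex.Im z| <= normc z.
Proof. by case: z => a b /=; rewrite -sqrtr_sqr ler_wsqrtr// lerDr sqr_ge0. Qed.

Lemma ler_normcD (z w : Cplx R) : normc (z + w) <= normc z + normc w.
Proof. exact: (@le_normcD R z w). Qed.

Lemma ler_normcB (z w : Cplx R) : normc (z - w) <= normc z + normc w.
Proof. by rewrite -(normc_opp w); exact: ler_normcD. Qed.

Lemma normc_sqr (z : Cplx R) : normc z ^+ 2 = complex.Re z ^+ 2 + complex.Im z ^+ 2.
Proof. by case: z => a b /=; rewrite sqr_sqrtr// addr_ge0 ?sqr_ge0. Qed.

Lemma normc_eq0 (z : Cplx R) : (normc z == 0) = (z == 0).
Proof. by apply/eqP/eqP => [/eq0_normc|->//]; rewrite ?normc0. Qed.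

Lemma ler_normc_sum (I : Type) (r : seq I) (F : I -> Cplx R) :
  normc (\sum_(i <- r) F i) <= \sum_(i <- r) normc (F i).
Proof.
elim: r => [|i r IH]; first by rewrite !big_nil normc0.
by rewrite !big_cons; apply: le_trans (ler_normcD _ _) _; rewrite lerD2l.
Qed.

(** In the order of [R[i]] positive elements are real; this trades the complex radii of balls for
    real ones. *)
Lemma ltcR0 (e : Cplx R) : 0 < e -> exists2 r : R, 0 < r & e = r%:C.
Proof.
case: e => a b; rewrite ltcE/= => /andP[/eqP b0 a0].
by exists a => //; rewrite b0.
Qed.

Lemma nbhs_cplxP (z : Cplx R) (A : set (Cplx R)) :
  nbhs z A <-> exists2 e : R, 0 < e & forall w, normc (w - z) < e -> A w.
Proof.
split.
  move=> /nbhs_ballP[e /= /ltcR0[r r0 ->] zA]; exists r => // w wz.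
  by apply: zA; rewrite /ball/= norm_normcE ltcR -normc_opp opprB.
move=> [r r0 zA]; apply/nbhs_ballP; exists r%:C => /=; first by rewrite ltcR.
by move=> w; rewrite /ball/= norm_normcE ltcR -normc_opp opprB; exact: zA.
Qed.

End ComplexModulus.

Section EuclideanNorm.
Variables (R : realType).

Lemma sum_cauchy_schwarz (I : finType) (a b : I -> R) :
  (\sum_i a i * b i) ^+ 2 <= (\sum_i a i ^+ 2) * (\sum_i b i ^+ 2).
Proof.
set S := \sum_i a i ^+ 2; set T := \sum_i b i ^+ 2; set P := \sum_i a i * b i.
have S0 : 0 <= S by apply: sumr_ge0 => i _; rewrite sqr_ge0.
have := S0; rewrite le_eqVlt => /predU1P[S00|Sp].
  have a0 i : a i = 0.
    apply/eqP; rewrite -sqrf_eq0.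
    have /psumr_eq0P := esym S00 => /(_ (fun i _ => sqr_ge0 (a i))) /(_ i isT) ->//.
  rewrite /P big1; first by rewrite expr0n/= -S00 mul0r.
  by move=> i _; rewrite a0 mul0r.
have : 0 <= \sum_i (S * b i - P * a i) ^+ 2 by apply: sumr_ge0 => i _; rewrite sqr_ge0.
have -> : \sum_i (S * b i - P * a i) ^+ 2 = S * (S * T - P ^+ 2).
  transitivity (\sum_i (S ^+ 2 * b i ^+ 2 + (P ^+ 2 * a i ^+ 2 - 2 * S * P * (a i * b i)))).
    by apply: eq_bigr => i _; ring.
  rewrite big_split/= sumrB -!mulr_sumr -/S -/T -/P; ring.
by rewrite pmulr_rge0// subr_ge0.
Qed.

Variable n : nat.
Implicit Types z w : Cn R n.

Lemma enorm_ge0 z : 0 <= enorm z.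
Proof. exact: sqrtr_ge0. Qed.

Lemma enorm_sqr z : enorm z ^+ 2 = \sum_j normc (z ord0 j) ^+ 2.
Proof. by rewrite sqr_sqrtr// sumr_ge0// => i _; rewrite sqr_ge0. Qed.

Lemma normc_le_enorm z j : normc (z ord0 j) <= enorm z.
Proof.
rewrite -(ger0_norm (normc_ge0 (z ord0 j))) -sqrtr_sqr ler_wsqrtr//.
by rewrite (bigD1 j)//= lerDl sumr_ge0// => i _; rewrite sqr_ge0.
Qed.

Lemma enormZ (l : Cplx R) z : enorm (l *: z) = normc l * enorm z.
Proof.
rewrite -[in RHS](ger0_norm (normc_ge0 l)) -sqrtr_sqr -sqrtrM ?sqr_ge0// mulr_sumr.
by congr Num.sqrt; apply: eq_bigr => i _; rewrite mxE normcM exprMn.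
Qed.

Lemma enormN z : enorm (- z) = enorm z.
Proof. by congr Num.sqrt; apply: eq_bigr => i _; rewrite mxE normc_opp. Qed.

Lemma enorm_eq0 z : (enorm z == 0) = (z == 0).
Proof.
apply/eqP/eqP => [z0|->]; last first.
  by rewrite /enorm big1 ?sqrtr0// => i _; rewrite mxE normc0 expr0n.
apply/rowP => j; rewrite mxE; apply/eqP; rewrite -normc_eq0.
by rewrite eq_le normc_ge0 andbT -[leRHS]z0 normc_le_enorm.
Qed.

(** Linear in the second slot: for fixed [z] it is holomorphic in [w], which is what turns
    Cauchy-Schwarz into a minorant of [enorm] by the modulus of a polynomial. *)
Definition hdot z w : Cplx R := \sum_j (z ord0 j)^*%C * w ord0 j.

Lemma hdot_le z w : normc (hdot z w) <= enorm z * enorm w.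
Proof.
apply: (le_trans (ler_normc_sum _ _)).
rewrite -(ler_pXn2r (_ : 0 < 2)%N)// ?nnegrE ?mulr_ge0 ?enorm_ge0 ?sumr_ge0//; last first.
  by move=> i _; exact: normc_ge0.
rewrite exprMn !enorm_sqr.
apply: le_trans (sum_cauchy_schwarz _ _).
rewrite le_eqVlt; apply/orP; left; apply/eqP; congr (_ ^+ 2).
by apply: eq_bigr => i _; rewrite normcM normc_conj.
Qed.

Lemma hdotD z w w' : hdot z (w + w') = hdot z w + hdot z w'.
Proof. by rewrite -big_split; apply: eq_bigr => i _; rewrite mxE mulrDr. Qed.

Lemma hdotZ z (l : Cplx R) w : hdot z (l *: w) = l * hdot z w.
Proof. by rewrite mulr_sumr; apply: eq_bigr => i _; rewrite mxE mulrCA. Qed.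

Lemma hdotzz z : hdot z z = (enorm z ^+ 2)%:C.
Proof.
rewrite enorm_sqr rmorph_sum; apply: eq_bigr => i _.
by case: (z _ _) => a b; rewrite normc_sqr; apply/eqP; rewrite eq_complex/=; apply/andP; split; apply/eqP; ring.
Qed.

Lemma ler_enormD z w : enorm (z + w) <= enorm z + enorm w.
Proof.
rewrite -(ler_pXn2r (_ : 0 < 2)%N)// ?nnegrE ?addr_ge0 ?enorm_ge0//.
have -> : enorm (z + w) ^+ 2 = enorm z ^+ 2 + enorm w ^+ 2 + 2 * complex.Re (hdot z w).
  rewrite !enorm_sqr -big_split raddf_sum mulr_sumr -big_split/=.
  apply: eq_bigr => i _; rewrite mxE; case: (z _ _) (w _ _) => a b [c d].
  rewrite !normc_sqr/=; ring.
have := hdot_le z w; have := Re_le_normc (hdot z w); have := ler_norm (complex.Re (hdot z w)).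
rewrite sqrrD; lra.
Qed.

Lemma ler_enormB z w : enorm (z - w) <= enorm z + enorm w.
Proof. by rewrite -(enormN w); exact: ler_enormD. Qed.

Lemma enorm_le_bound z (e : R) : 0 <= e -> (forall j, normc (z ord0 j) <= e) ->
  enorm z <= n.+1%:R * e.
Proof.
move=> e0 ze; rewrite -(ler_pXn2r (_ : 0 < 2)%N)// ?nnegrE ?enorm_ge0 ?mulr_ge0//.
rewrite enorm_sqr exprMn.
apply: (@le_trans _ _ (\sum_(j < n) e ^+ 2)).
  by apply: ler_sum => j _; rewrite lerXn2r ?nnegrE ?normc_ge0.
rewrite sumr_const card_ord -[leLHS]mulr_natl ler_wpM2r ?sqr_ge0//.
by rewrite -natrX ler_nat (@leq_trans n.+1)// leq_pmulr.
Qed.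

Lemma nbhs_CnP z (A : set (Cn R n)) :
  nbhs z A <-> exists2 e : R, 0 < e & forall w, enorm (w - z) < e -> A w.
Proof.
split.
  move=> /nbhs_ballP[e /= /ltcR0[r r0 ->] zA]; exists r => // w wz.
  apply: zA; split; [by rewrite ltcR|move=> i j].
  rewrite /ball/= norm_normcE ltcR -normc_opp opprB (ord1 i).
  by apply: le_lt_trans wz; have := normc_le_enorm (w - z) j; rewrite !mxE.
move=> [r r0 zA]; apply/nbhs_ballP.
(* The factor in [enorm_le_bound] is [n.+1]; dividing by [n.+2] leaves room for a strict
   inequality. *)
have r1 : 0 < r / n.+2%:R by rewrite divr_gt0.
exists (r / n.+2%:R)%:C => /=; first by rewrite ltcR.
move=> w zw; apply: zA.
apply: (@le_lt_trans _ _ (n.+1%:R * (r / n.+2%:R))).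
  apply: enorm_le_bound; first exact: ltW.
  move=> j; have := zw.2 ord0 j; rewrite /ball/= norm_normcE ltcR -normc_opp opprB !mxE.
  exact: ltW.
by rewrite mulrCA gtr_pMr// ltr_pdivrMr// mul1r ltr_nat.
Qed.

End EuclideanNorm.

(** * Means over circles *)

Section CircleMean.
Variable R : realType.
Implicit Types (u v : R -> R) (a b c t x : R).
Local Notation mu := (@lebesgue_measure R).

(** Real-valued counterpart of the mean in [psh]; [cmeanE] identifies the two for continuous
    integrands. *)
Definition cmean u : R :=
  (2 * pi)^-1 * \int[mu]_(t in [set` `[0%R, (2 * pi)%R]]) u t.

Lemma twopi_gt0 : 0 < 2 * pi :> R.
Proof. by rewrite mulr_gt0 ?pi_gt0. Qed.

Lemma continuous_integrable u (a b : R) : continuous u ->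
  mu.-integrable [set` `[a, b]] (EFin \o u).
Proof.
move=> cu; apply: continuous_compact_integrable; first exact: segment_compact.
exact: continuous_subspaceT.
Qed.


Lemma cmeanE u : continuous u ->
  (((2 * pi)^-1)%:E * \int[mu]_(t in [set` `[0%R, (2 * pi)%R]]) (u t)%:E)%E
  = (cmean u)%:E.
Proof.
move=> cu; rewrite /cmean /Rintegral EFinM fineK//.
by apply: integrable_fin_num => //; exact: continuous_integrable.
Qed.

Lemma cmean_cst c : cmean (fun=> c) = c.
Proof.
rewrite /cmean Rintegral_cst//= lebesgue_measure_itv/= lte_fin twopi_gt0/=.
by rewrite subr0 mulrCA mulVf ?mulr1// gt_eqF ?twopi_gt0.
Qed.

Lemma cmeanD u v : continuous u -> continuous v ->
  cmean (fun t => u t + v t) = cmean u + cmean v.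
Proof.
move=> cu cv; rewrite /cmean RintegralD; first by rewrite mulrDr.
- exact: measurable_itv.
- exact: continuous_integrable.
- exact: continuous_integrable.
Qed.

Lemma cmeanZ c u : continuous u -> cmean (fun t => c * u t) = c * cmean u.
Proof.
move=> cu; rewrite /cmean RintegralZl; first by rewrite mulrCA.
- exact: measurable_itv.
- exact: continuous_integrable.
Qed.

Lemma le_cmean u v : continuous u -> continuous v ->
  (forall t, u t <= v t) -> cmean u <= cmean v.
Proof.
move=> cu cv uv; rewrite /cmean ler_pM2l ?invr_gt0 ?twopi_gt0//.
by apply: le_Rintegral => //; exact: continuous_integrable.
Qed.

Lemma eq_cmean u v : u =1 v -> cmean u = cmean v.
Proof. by move=> uv; congr cmean; apply/funext. Qed.

Lemma continuous_shift_fun u b : continuous u -> continuous (fun t : R => u (t + b)).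
Proof.
move=> cu x; apply: (@continuous_comp _ _ _ (fun x : R => x + b) u); last exact: cu.
by apply: cvgD; [exact: cvg_id|exact: cvg_cst].
Qed.

Lemma is_derive_transl (f : R -> R) df b x :
  is_derive (x + b) 1 f df -> is_derive x 1 (fun y : R => f (y + b)) df.
Proof.
move=> fd; rewrite -[df]mulr1.
apply: (@is_derive1_comp _ f (fun y : R => y + b)).
by apply: is_derive_eq; rewrite addr0.
Qed.

(** Differentiate in the shift: with [P] a primitive of [u], the integral of the shifted function is
    P (2 pi + a) - P a, whose derivative in a vanishes by periodicity. *)
Lemma cmean_shift_ge0 u a : continuous u -> (forall t, u (t + 2 * pi) = u t) ->
  0 <= a -> cmean (fun t => u (t + a)) = cmean u.
Proof.
move=> cu pu a0; have p0 := twopi_gt0.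
(* The base point -1 makes [P] differentiable, hence continuous, at 0 as well. *)
pose P (x : R) : R := \int[mu]_(t in [set` `[-1, x]]) u t.
have dP (x : R) : -1 < x -> is_derive x 1 P (u x).
  move=> x1.
  have [] := @continuous_FTC1_closed R u (-1) x (x + 1) _ _ x1 (cu x).
  - by rewrite ltrDl.
  - exact: continuous_integrable.
  by rewrite derive1E => d1 e1; apply: DeriveDef.
have H (b : R) : 0 <= b -> \int[mu]_(t in [set` `[0%R, (2 * pi)%R]]) u (t + b) = P (2 * pi + b) - P b.
  move=> b0.
  have dF (x : R) : 0 <= x -> is_derive x 1 (fun x : R => P (x + b)) (u (x + b)).
    move=> x0.
    have /dP ? : -1 < x + b by rewrite (lt_le_trans (_ : -1 < 0))// addr_ge0.
    exact: is_derive_transl.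
  have cF (x : R) : 0 <= x -> {for x, continuous (fun x : R => P (x + b))}.
    move=> /dF[] d _; apply: differentiable_continuous.
    exact/derivable1_diffP.
  have cub : continuous (fun x : R => u (x + b)).
    exact: continuous_shift_fun.
  have := @continuous_FTC2 R (fun x : R => u (x + b)) (fun x : R => P (x + b)) 0 (2 * pi) p0.
  rewrite -EFinB add0r => E; apply: EFin_inj; rewrite -E.
  - rewrite /Rintegral fineK//; apply: integrable_fin_num => //.
    exact: continuous_integrable.
  - exact: continuous_subspaceT.
  - split.
    + by move=> x /[!in_itv]/= /andP[/ltW/dF[]].
    + by apply: cvg_at_right_filter; exact: cF.
    + by apply: cvg_at_left_filter; apply: cF; exact: ltW.
  - by move=> x /[!in_itv]/= /andP[/ltW/dF[_ +] _]; rewrite derive1E.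
rewrite /cmean; congr (_ * _); rewrite H//.
transitivity (\int[mu]_(t in [set` `[0%R, (2 * pi)%R]]) u (t + 0)); last first.
  by apply: eq_Rintegral => x _; rewrite addr0.
rewrite H//.
have dQ (x : R) : 0 <= x -> is_derive x 1 (fun x : R => P (2 * pi + x) - P x) 0.
  move=> x0.
  have /dP ? : -1 < x by rewrite (lt_le_trans (_ : -1 < 0)).
  have /dP ? : -1 < 2 * pi + x by rewrite (lt_le_trans (_ : -1 < 0))// addr_ge0// ltW.
  have -> : (fun x : R => P (2 * pi + x) - P x) = (fun x : R => P (x + 2 * pi) - P x).
    by apply/funext => y; rewrite [2 * pi + y]addrC.
  have -> : 0 = u (x + 2 * pi) - u x by rewrite pu subrr.
  apply: is_deriveB => //; apply: is_derive_transl.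
  by rewrite [x + _]addrC.
have [x /[!in_itv]/= /andP[/ltW/dQ]// _ _| |c _] :=
  @MVT_segment R (fun x : R => P (2 * pi + x) - P x) (fun=> 0) 0 a a0.
  apply/subspace_continuousP => x /=; rewrite in_itv/= => /andP[/dQ[d _] _].
  apply: cvg_within_filter; apply: differentiable_continuous.
  exact/derivable1_diffP.
by rewrite mul0r !addr0 => /eqP; rewrite subr_eq0 => /eqP.
Qed.

Lemma cmean_shift u a : continuous u -> (forall t, u (t + 2 * pi) = u t) ->
  cmean (fun t => u (t + a)) = cmean u.
Proof.
move=> cu pu; have [a0|/ltW a0] := leP 0 a; first exact: cmean_shift_ge0.
rewrite -(@cmean_shift_ge0 (fun t => u (t + a)) (- a)) ?oppr_ge0//.
- by apply: eq_cmean => t; rewrite addrNK.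
- exact: continuous_shift_fun.
- by move=> t; rewrite addrAC pu.
Qed.

Lemma cmean_antiperiodic u a : continuous u -> (forall t, u (t + 2 * pi) = u t) ->
  (forall t, u (t + a) = - u t) -> cmean u = 0.
Proof.
move=> cu pu au; have := cmean_shift a cu pu.
rewrite (@eq_cmean _ (fun t => (-1) * u t)); last by move=> t; rewrite au mulN1r.
rewrite cmeanZ// => h; lra.
Qed.

Lemma continuous_sum_fun u v : continuous u -> continuous v ->
  continuous (fun t => u t + v t).
Proof. by move=> cu cv t; apply: cvgD; [exact: cu|exact: cv]. Qed.

Lemma continuous_scale_fun c u : continuous u -> continuous (fun t => c * u t).
Proof. by move=> cu t; apply: cvgM; [exact: cvg_cst|exact: cu]. Qed.

Lemma continuous_dil_fun (c : R) u : continuous u -> continuous (fun t => u (c * t)).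
Proof.
move=> cu t; apply: (@continuous_comp _ _ _ (fun x : R => c * x) u); last exact: cu.
by apply: cvgM; [exact: cvg_cst|exact: cvg_id].
Qed.

(** No primitive is computed: frequency 1 changes sign under a shift by pi, frequency 2 under a
    shift by pi / 2, and means are invariant under shifts. *)
Lemma cmean_trig (a1 b1 a2 b2 : R) :
  cmean (fun t => a1 * cos t + b1 * sin t + (a2 * cos (2 * t) + b2 * sin (2 * t))) = 0.
Proof.
have cc := @continuous_cos R; have cs := @continuous_sin R.
have p2 : 2 * pi = pi *+ 2 :> R by rewrite mulr_natl.
have z0 : (fun u => continuous u /\ cmean u = 0) (fun t => a1 * cos t + b1 * sin t).
  split; first by apply: continuous_sum_fun; exact: continuous_scale_fun.
  apply: (@cmean_antiperiodic _ pi).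
  - by apply: continuous_sum_fun; exact: continuous_scale_fun.
  - by move=> t; rewrite p2 cosD2pi sinD2pi.
  - by move=> t; rewrite cosDpi sinDpi; ring.
have z1 : (fun u => continuous u /\ cmean u = 0) (fun t => a2 * cos (2 * t) + b2 * sin (2 * t)).
  have ? : continuous (fun t => a2 * cos (2 * t) + b2 * sin (2 * t)).
    by apply: continuous_sum_fun; apply: continuous_scale_fun; exact: continuous_dil_fun.
  split=> //; apply: (@cmean_antiperiodic _ (pi / 2)) => // t.
  - have -> : 2 * (t + 2 * pi) = 2 * t + pi *+ 2 + pi *+ 2 :> R by rewrite !mulr2n; ring.
    by rewrite !cosD2pi !sinD2pi.
  - have -> : 2 * (t + pi / 2) = 2 * t + pi :> R by field.
    by rewrite cosDpi sinDpi; ring.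
by rewrite cmeanD ?z0.2 ?z1.2 ?addr0; [|exact: z0.1|exact: z1.1].
Qed.

End CircleMean.

(** * Means of ln |1 + al z + be z^2|^2 over small circles *)

Section MeanLog.
Variable R : realType.
Implicit Types (x y z s A : R).

Definition circ (t : R) : Cplx R := cos t +i* sin t.

(** The remainder [g] lies between 0 and y^3 by monotonicity: g' = z^2 / (1 + z) >= 0, and g - z^3
    has derivative z^2 / (1 + z) - 3 z^2 <= 0 since 3 (1 + z) >= 1 for z >= -1/2. *)
Lemma ln_quad (y : R) : `|y| <= 2^-1 -> `|ln (1 + y) - y + y ^+ 2 / 2| <= `|y| ^+ 3.
Proof.
move=> yh; have /andP[y1 y2] : - 2^-1 <= y <= 2^-1 by rewrite -ler_norml.
pose g (z : R) : R := ln (1 + z) - z + z ^+ 2 / 2.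
pose h (z : R) : R := g z - z ^+ 3.
have dln (z : R) : -1 < z -> is_derive z 1 (fun z : R => ln (1 + z)) ((1 + z)^-1).
  move=> z1; have z0 : 0 < 1 + z by rewrite -ltrBlDl sub0r.
  have -> : (fun z : R => ln (1 + z)) = (fun z : R => ln (z + 1)).
    by apply/funext => w; rewrite addrC.
  by apply: (@is_derive_transl R (@ln R) _ 1); rewrite addrC; exact: is_derive1_ln.
have dg (z : R) : -1 < z -> is_derive z 1 g (z ^+ 2 / (1 + z)).
  move=> z1; have z0 : 1 + z != 0 by rewrite gt_eqF// -ltrBlDl sub0r.
  have -> : z ^+ 2 / (1 + z) = (1 + z)^-1 - 1 + z by field.
  apply: is_deriveD; first by apply: is_deriveB; exact: dln.
  have -> : (fun z : R => z ^+ 2 / 2) = ((@id R) ^+ 2 * cst (2^-1 : R)) :> (R -> R) by [].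
  by apply: is_derive_eq; rewrite /GRing.scale/=; field.
have dh (z : R) : -1 < z -> is_derive z 1 h (z ^+ 2 / (1 + z) - 3 * z ^+ 2).
  move=> z1; apply: is_deriveB; first exact: dg.
  have -> : (fun z : R => z ^+ 3) = ((@id R) ^+ 3) :> (R -> R) by [].
  by apply: is_derive_eq; rewrite /GRing.scale/=; ring.
have cont (f : R -> R) (df : R -> R) : (forall z : R, -1 < z -> is_derive z 1 f (df z)) ->
    forall a b : R, -1 < a -> {within `[a, b], continuous f}.
  move=> fd a b a1; apply/subspace_continuousP => x /=.
  rewrite in_itv/= => /andP[ax _]; apply: cvg_within_filter.
  have [d _] := fd _ (lt_le_trans a1 ax).
  by apply: differentiable_continuous; exact/derivable1_diffP.
have hm (a b : R) : - 2^-1 <= a -> a <= b -> g a <= g b /\ h b <= h a.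
  move=> ah ab; have a1 : -1 < a by lra.
  have ai (c : R) : c \in `]a, b[%R -> a < c by rewrite in_itv/= => /andP[].
  split.
    have [c ci gE] := MVT_segment ab (fun x xi => dg x (lt_trans a1 (ai _ xi))) (cont _ _ dg a b a1).
    rewrite -subr_ge0 gE; apply: mulr_ge0; last by rewrite subr_ge0.
    have := ci; rewrite in_itv/= => /andP[ac _].
    by rewrite divr_ge0 ?sqr_ge0//; lra.
  have [c ci gE] := MVT_segment ab (fun x xi => dh x (lt_trans a1 (ai _ xi))) (cont _ _ dh a b a1).
  rewrite -subr_le0 gE; apply: mulr_le0_ge0; last by rewrite subr_ge0.
  have := ci; rewrite in_itv/= => /andP[ac _].
  have c0 : 0 < 1 + c by lra.
  rewrite subr_le0 ler_pdivrMr// -mulrA.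
  have -> : 3 * (c ^+ 2 * (1 + c)) = c ^+ 2 * (3 * (1 + c)) by ring.
  by rewrite ler_peMr ?sqr_ge0//; lra.
have g0 : g 0 = 0 by rewrite /g addr0 ln1 expr0n/= mul0r subrr addr0.
have h0 : h 0 = 0 by rewrite /h g0 expr0n subr0.
rewrite -/(g y).
have [y0|/ltW y0] := leP 0 y.
  have [] := hm 0 y _ y0; first by lra.
  rewrite g0 h0 /h => gy hy; rewrite !ger0_norm//; lra.
have [] := hm y 0 y1 y0.
rewrite g0 h0 /h => gy hy; rewrite !ler0_norm//.
have -> : (- y) ^+ 3 = - y ^+ 3 by ring.
lra.
Qed.

Lemma circ_norm t : normc (circ t) = 1.
Proof. by rewrite /circ/= cos2Dsin2 sqrtr1. Qed.

Lemma circD t u : circ (t + u) = circ t * circ u.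
Proof. by rewrite /circ cosD sinD; apply/eqP; rewrite eq_complex/= [sin t * _ + _]addrC !eqxx. Qed.

(* ln |1 + al z + be z^2|^2 is harmonic and vanishes at z = 0, so expanding the
   logarithm to second order leaves a trigonometric polynomial of mean zero. *)
Lemma mean_ln A s (al be : Cplx R) : 0 <= A -> 0 < s -> s <= 1 -> 16 * A * s <= 1 ->
  normc al <= A -> normc be <= A ->
  `|cmean (fun t => ln (normc (1 + al * (s%:C * circ t) + be * (s%:C * circ t) ^+ 2) ^+ 2))|
    <= (240 * A ^+ 3 + 3 * A ^+ 2) * s ^+ 3.
Proof.
case: al => a b; case: be => c d A0 s0 s1 As hal hbe.
(* [X] and [Y] are the real and imaginary parts of w = al z + be z^2 with z = s e^{it}. *)
pose X t := s * (a * cos t - b * sin t) + s ^+ 2 * (c * cos (2 * t) - d * sin (2 * t)).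
pose Y t := s * (a * sin t + b * cos t) + s ^+ 2 * (c * sin (2 * t) + d * cos (2 * t)).
have E t : normc (1 + (a +i* b) * (s%:C * circ t) + (c +i* d) * (s%:C * circ t) ^+ 2) ^+ 2
    = (1 + X t) ^+ 2 + (Y t) ^+ 2.
  rewrite normc_sqr /X /Y /circ /=.
  have -> : cos (2 * t) = cos t ^+ 2 - sin t ^+ 2 by rewrite mulr_natl mulr2n cosD; ring.
  have -> : sin (2 * t) = 2 * cos t * sin t by rewrite mulr_natl mulr2n sinD; ring.
  ring.
rewrite (@eq_cmean _ _ (fun t => ln ((1 + X t) ^+ 2 + Y t ^+ 2))); last first.
  by move=> t; rewrite E.
pose al : Cplx R := a +i* b; pose be : Cplx R := c +i* d.
rewrite -/al in hal; rewrite -/be in hbe.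
pose z t : Cplx R := s%:C * circ t.
have zn t : normc (z t) = s by rewrite normcM circ_norm mulr1 normc_real gtr0_norm.
have cos2 t : cos (2 * t) = cos t ^+ 2 - sin t ^+ 2 by rewrite mulr_natl mulr2n cosD; ring.
have sin2 t : sin (2 * t) = 2 * cos t * sin t by rewrite mulr_natl mulr2n sinD; ring.
have r8 : 0 <= 2 * A * s <= 8^-1 by rewrite !mulr_ge0 ?(ltW s0)//=; lra.
move: r8; set r := 2 * A * s => /andP[r0 r8].
have XY t : X t ^+ 2 + Y t ^+ 2 <= r ^+ 2.
  have -> : X t ^+ 2 + Y t ^+ 2 = normc (al * z t + be * z t ^+ 2) ^+ 2.
    by rewrite normc_sqr /X /Y /al /be /z /circ /= cos2 sin2; ring.
  apply: lerXn2r; rewrite ?nnegrE ?normc_ge0//.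
  apply: (le_trans (ler_normcD _ _)); rewrite (normcM al) (normcM be) normcX zn expr2.
  have h1 : normc al * s <= A * s by rewrite ler_pM2r.
  have h2 : normc be * (s * s) <= A * s.
    have ss : s * s <= s by rewrite ger_pMr.
    by apply: ler_pM => //; [exact: normc_ge0|apply: mulr_ge0; exact: ltW].
  by rewrite /r; lra.
(* The terms of degree 3 and 4 in Re w^2, which go into the error. *)
pose W t := complex.Re (2%:R * (al * be) * z t ^+ 3 + be ^+ 2 * z t ^+ 4).
have Wb t : `|W t| <= 3 * A ^+ 2 * s ^+ 3.
  apply: (le_trans (Re_le_normc _)); apply: (le_trans (ler_normcD _ _)).
  have n2 : normc (2%:R : Cplx R) = 2 by rewrite -(rmorph_nat (real_complex R)) normc_real normr_nat.
  rewrite (normcM (_ * _)) (normcM (be ^+ 2)) (normcM 2%:R) (normcM al) !normcX !zn n2.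
  have na0 := normc_ge0 al; have nb0 := normc_ge0 be.
  have h1 : normc al * normc be <= A * A by exact: ler_pM.
  have h2 : normc be ^+ 2 <= A ^+ 2 by rewrite lerXn2r ?nnegrE.
  have s3 : 0 <= s ^+ 3 by rewrite exprn_ge0 ?ltW.
  have h3 : normc be ^+ 2 * s ^+ 4 <= A ^+ 2 * s ^+ 3.
    apply: ler_pM; rewrite ?sqr_ge0 ?exprn_ge0 ?(ltW s0)//.
    by rewrite exprS ler_piMl.
  have h4 : normc al * normc be * s ^+ 3 <= A * A * s ^+ 3 by rewrite ler_wpM2r.
  lra.
(* [T] = 2 Re w - Re (al z)^2 is what remains of y - y^2 / 2, where 1 + y = |1 + w|^2, after
   dropping terms of order s^3. *)
pose T t := (2 * s * a) * cos t + (- 2 * s * b) * sin t +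
   ((2 * s ^+ 2 * c - s ^+ 2 * (a ^+ 2 - b ^+ 2)) * cos (2 * t)
   + (2 * a * b * s ^+ 2 - 2 * s ^+ 2 * d) * sin (2 * t)).
pose y t := 2 * X t + (X t ^+ 2 + Y t ^+ 2).
have TE t : y t - y t ^+ 2 / 2 - T t =
   - W t - 2 * X t * (X t ^+ 2 + Y t ^+ 2) - (X t ^+ 2 + Y t ^+ 2) ^+ 2 / 2.
  rewrite /y /T.
  have : Y t ^+ 2 - X t ^+ 2 + s ^+ 2 * ((a ^+ 2 - b ^+ 2) * cos (2 * t) - 2 * a * b * sin (2 * t)) = - W t.
    by rewrite /W /X /Y /al /be /z /circ /= cos2 sin2; ring.
  rewrite /X; lra.
have X0 t : `|X t| <= r.
  rewrite -ler_sqr ?nnegrE// real_normK ?num_real//; apply: le_trans (XY t).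
  by rewrite lerDl sqr_ge0.
have n0 t : 0 <= X t ^+ 2 + Y t ^+ 2 by rewrite addr_ge0 ?sqr_ge0.
have yb t : `|y t| <= 3 * r.
  apply: (le_trans (ler_normD _ _)); rewrite normrM normr_nat (ger0_norm (n0 t)).
  have := X0 t; have := XY t; have : r ^+ 2 <= r by rewrite expr2 ler_piMr//; lra.
  lra.
(* With r = 2 A s, the cubic remainder of the logarithm gives (3 r)^3 = 216 A^3 s^3, the product 2 X
   |w|^2 gives 2 r^3 = 16 A^3 s^3, and |w|^4 / 2 gives r^3 = 8 A^3 s^3, in total 240; the term 3 A^2
   comes from [W]. *)
set K := (240 * _ + _) * _.
have B t : `|ln ((1 + X t) ^+ 2 + Y t ^+ 2) - T t| <= K.
  have -> : (1 + X t) ^+ 2 + Y t ^+ 2 = 1 + y t by rewrite /y; ring.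
  have -> : ln (1 + y t) - T t = (ln (1 + y t) - y t + y t ^+ 2 / 2)
     + (y t - y t ^+ 2 / 2 - T t) by ring.
  rewrite TE; apply: (le_trans (ler_normD _ _)).
  have h1 : `|ln (1 + y t) - y t + y t ^+ 2 / 2| <= (3 * r) ^+ 3.
    apply: le_trans (ln_quad _) _; first by apply: le_trans (yb t) _; lra.
    by rewrite lerXn2r ?nnegrE//; lra.
  have h2 : `|2 * X t * (X t ^+ 2 + Y t ^+ 2)| <= 2 * r * r ^+ 2.
    rewrite 2!normrM normr_nat (ger0_norm (n0 t)); by apply: ler_pM; [rewrite mulr_ge0|exact: n0|rewrite ler_pM2l|exact: XY].
  have h3 : `|(X t ^+ 2 + Y t ^+ 2) ^+ 2 / 2| <= r ^+ 3.
    rewrite ger0_norm; last by rewrite divr_ge0 ?sqr_ge0.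
    have : (X t ^+ 2 + Y t ^+ 2) ^+ 2 <= (r ^+ 2) ^+ 2 by rewrite lerXn2r ?nnegrE ?sqr_ge0.
    have r3 : 0 <= r ^+ 3 by rewrite exprn_ge0.
    have : (r ^+ 2) ^+ 2 <= r ^+ 3.
      by rewrite -exprM -[(2 * 2)%N]/4%N exprS; apply: ler_piMl => //; lra.
    lra.
  have h4 : `|- W t - 2 * X t * (X t ^+ 2 + Y t ^+ 2) - (X t ^+ 2 + Y t ^+ 2) ^+ 2 / 2|
     <= 3 * A ^+ 2 * s ^+ 3 + 2 * r * r ^+ 2 + r ^+ 3.
    apply: (le_trans (ler_normB _ _)); apply: lerD h3.
    apply: (le_trans (ler_normB _ _)); apply: lerD h2.
    by rewrite normrN.
  apply: (le_trans (lerD h1 h4)); rewrite /K /r.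
  have -> : (2 * A * s) ^+ 3 = 8 * (A ^+ 3 * s ^+ 3) by ring.
  have -> : (3 * (2 * A * s)) ^+ 3 = 216 * (A ^+ 3 * s ^+ 3) by ring.
  have -> : 2 * (2 * A * s) * (2 * A * s) ^+ 2 = 16 * (A ^+ 3 * s ^+ 3) by ring.
  lra.
have cc := @continuous_cos R; have cs := @continuous_sin R.
have cc2 := @continuous_dil_fun R 2 _ cc; have cs2 := @continuous_dil_fun R 2 _ cs.
have cX : continuous X by move=> t; apply: cvgD; (apply: cvgM; first exact: cvg_cst);
  apply: cvgB; (apply: cvgM; first exact: cvg_cst); [exact: cc|exact: cs|exact: cc2|exact: cs2].
have cY : continuous Y by move=> t; apply: cvgD; (apply: cvgM; first exact: cvg_cst);
  apply: cvgD; (apply: cvgM; first exact: cvg_cst); [exact: cs|exact: cc|exact: cs2|exact: cc2].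
have cT : continuous T.
  by do 2?apply: continuous_sum_fun; exact: continuous_scale_fun.
have cL : continuous (fun t => ln ((1 + X t) ^+ 2 + Y t ^+ 2)).
  move=> t; apply: (@continuous_comp _ _ _ (fun t => (1 + X t) ^+ 2 + Y t ^+ 2) (@ln R)).
    apply: cvgD; last by apply: cvgM; exact: cY.
    by apply: cvgM; apply: cvgD; (exact: cvg_cst || exact: cX).
  apply: continuous_ln.
  have -> : (1 + X t) ^+ 2 + Y t ^+ 2 = 1 + y t by rewrite /y; ring.
  by have := yb t; rewrite ler_norml => /andP[+ _]; lra.
have T0 : cmean T = 0 by exact: cmean_trig.
have K0 : 0 <= K by apply: le_trans (B 0).
rewrite ler_norml; apply/andP; split.
  rewrite -[leLHS]add0r -T0 -(cmean_cst (- K)) -cmeanD//; last exact: cst_continuous.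
  apply: le_cmean => //; first by apply: continuous_sum_fun => //; exact: cst_continuous.
  by move=> t; have := B t; rewrite ler_norml => /andP[+ _]; lra.
rewrite -[leRHS]add0r -T0 -(cmean_cst K) -cmeanD//; last exact: cst_continuous.
apply: le_cmean => //; first by apply: continuous_sum_fun => //; exact: cst_continuous.
by move=> t; have := B t; rewrite ler_norml => /andP[_]; lra.
Qed.

End MeanLog.

(** * Fubini's theorem for means over two circles *)

Section Plane.
Variable R : realType.
Local Notation mu := (@lebesgue_measure R).

(** Measurability is for the product sigma-algebra: the preimage of an open half-line is the
    countable union of the rational rectangles contained in it, [G n] being the one coded by [n]. *)
Lemma continuous_measurable_fun2 (F : R * R -> R) : continuous F ->
  measurable_fun setT (F : measurableTypeR R * measurableTypeR R -> R).
Proof.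
move=> cF; apply: (measurability _ (RGenOInfty.measurableE R)).
move=> _ [_ [a ->] <-]; rewrite setTI.
pose rect (p : rat * rat * (rat * rat)) : set (R * R) :=
  [set` `]ratr p.1.1, ratr p.1.2[%R] `*` [set` `]ratr p.2.1, ratr p.2.2[%R].
pose G n : set (R * R) := match unpickle n with
  | Some p => if `[< rect p `<=` F @^-1` [set` `]a, +oo[%R] >] then rect p else set0
  | None => set0 end.
rewrite (_ : _ @^-1` _ = \bigcup_n G n); last first.
  apply/seteqP; split => [[x y] /=|z [n _]]; last first.
    by rewrite /G; case: unpickle => // p; case: asboolP => // + rz; exact.
  rewrite in_itv/= andbT => aF.
  have : nbhs (x, y) [set z | a < F z].
    exact: (cvgr_gt _ (cF (x, y)) _ aF).
  move=> -[[A B] /= [nA nB] AB].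
  have sel (P : set R) (w : R) : nbhs w P -> exists p : rat * rat,
      w \in `]ratr p.1, ratr p.2[%R /\ [set` `]ratr p.1, ratr p.2[%R] `<=` P.
    move=> /nbhs_ballP[e /= e0 eP].
    have wl : w - e < w by rewrite ltrBlDr ltrDl.
    have wr : w < w + e by rewrite ltrDl.
    have [r1] := rat_in_itvoo wl; rewrite in_itv/= => /andP[r1a r1b].
    have [r2] := rat_in_itvoo wr; rewrite in_itv/= => /andP[r2a r2b].
    exists (r1, r2); split; first by rewrite in_itv/= r1b r2a.
    move=> z /=; rewrite in_itv/= => /andP[z1 z2]; apply: eP.
    by rewrite /ball/= ltr_distlC; apply/andP; split; lra.
  have [p [px pA]] := sel _ _ nA.
  have [p' [py pB]] := sel _ _ nB.
  have sub : rect (p, p') `<=` F @^-1` [set` `]a, +oo[%R].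
    move=> [u v] [/= /pA Au /pB Bv].
    by rewrite in_itv/= andbT; apply: (AB (u, v)); split.
  exists (pickle (p, p')); first exact: I.
  rewrite /G pickleK (asboolT sub).
  by split; [exact: px|exact: py].
apply: bigcupT_measurable => n; rewrite /G; case: unpickle => // p.
case: asboolP => // _; apply: measurableX; exact: measurable_itv.
Qed.

Implicit Types F : R -> R -> R.

Lemma continuous2_l F x : continuous (fun p : R * R => F p.1 p.2) -> continuous (F x).
Proof.
move=> cF y; apply: (@continuous_comp _ _ _ (fun y : R => (x, y)) (fun p => F p.1 p.2)).
  by apply: (@cvg_pair _ _ _ _ (nbhs x) (nbhs y) _ _ _ (fun=> x) id); [exact: cvg_cst|exact: cvg_id].
exact: cF.
Qed.

Lemma continuous2_r F y : continuous (fun p : R * R => F p.1 p.2) -> continuous (F ^~ y).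
Proof.
move=> cF x; apply: (@continuous_comp _ _ _ (fun x : R => (x, y)) (fun p => F p.1 p.2)).
  by apply: (@cvg_pair _ _ _ _ (nbhs x) (nbhs y) _ _ _ id (fun=> y)); [exact: cvg_id|exact: cvg_cst].
exact: cF.
Qed.

(** Continuity under the integral sign; the dominating function is a constant, given by compactness
    of [x0 - 1, x0 + 1] x [0, 2 pi]. *)
Lemma cmean_continuous F : continuous (fun p : R * R => F p.1 p.2) ->
  continuous (fun x => cmean (F x)).
Proof.
move=> cF x0.
have [K FK] : exists K, forall x y, x \in `]x0 - 1, x0 + 1[ ->
    y \in `[0, 2 * pi] -> `|F x y| <= K.
  pose A := [set` `[x0 - 1, x0 + 1]%R] `*` [set` `[0, 2 * pi]%R] : set (R * R).
  have A0 : A !=set0.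
    exists (x0, 0); split => /=; rewrite in_itv/= ?lexx ?(ltW (twopi_gt0 R))//.
    by apply/andP; split; lra.
  have cA : compact A by apply: compact_setX; exact: segment_compact.
  have cn : {within A, continuous (fun p => `|F p.1 p.2|)}.
    apply: continuous_subspaceT => p.
    by apply: (@continuous_comp _ _ _ (fun p => F p.1 p.2) (@Num.norm R R)); [exact: cF|exact: norm_continuous].
  have [c _ cm] := compact_EVT_max A0 cA cn.
  exists `|F c.1 c.2| => x y; rewrite in_itv/= => /andP[/ltW x1 /ltW x2] yI.
  by apply: (cm (x, y)); rewrite inE; split => //=; rewrite in_itv/= x1.
rewrite /cmean; apply: cvgM; first exact: cvg_cst.
have := @continuity_under_integral R _ _ mu F [set` `[0, 2 * pi]%R] (measurable_itv _)
  (x0 - 1) (x0 + 1) _ _ (fun=> K).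
apply.
- by move=> x _; apply: continuous_integrable; exact: continuous2_l.
- by apply: aeW => y _ x _; exact: continuous2_r.
- by apply: continuous_integrable; exact: cst_continuous.
- by move=> x xI; apply: aeW => y yI; exact: FK.
- by rewrite inE/= in_itv/=; lra.
Qed.

Lemma integral_cmean (u : R -> R) : continuous u ->
  (\int[mu]_(t in [set` `[0%R, (2 * pi)%R]]) (u t)%:E = (2 * pi * cmean u)%:E)%E.
Proof.
move=> cu; rewrite EFinM -cmeanE// muleA -EFinM mulfV ?mul1e//.
by rewrite gt_eqF ?twopi_gt0.
Qed.

(** Tonelli's theorem for [F] extended by 0 outside the square; [E] converts its iterated integrals
    into means. *)
Lemma cmean_fubini_ge0 F : continuous (fun p : R * R => F p.1 p.2) ->
  (forall x y, 0 <= F x y) ->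
  cmean (fun x => cmean (F x)) = cmean (fun y => cmean (F ^~ y)).
Proof.
move=> cF F0.
have cF' : continuous (fun p : R * R => F p.2 p.1).
  move=> p; apply: (@continuous_comp _ _ _ (fun p : R * R => (p.2, p.1)) (fun p => F p.1 p.2)).
    by apply: (@cvg_pair _ _ _ _ (nbhs p.2) (nbhs p.1)); [exact: cvg_snd|exact: cvg_fst].
  exact: cF.
pose I2 := [set` `[0%R, (2 * pi)%R]] : set R.
have mI2 : measurable I2 by exact: measurable_itv.
pose f := (fun p : R * R => (F p.1 p.2)%:E) \_ (I2 `*` I2).
have f0 p : (0 <= f p)%E.
  by rewrite /f patchE; case: ifPn => // _; rewrite lee_fin.
have mf : measurable_fun [set: measurableTypeR R * measurableTypeR R] (f : _ -> \bar R).
  have mD : measurable (I2 `*` I2 : set (measurableTypeR R * measurableTypeR R)) by exact: measurableX.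
  apply/(measurable_restrictT _ mD).
  by apply/measurable_EFinP; apply: measurable_funTS; exact: continuous_measurable_fun2.
have E (G : R -> R -> R) (g : R -> R -> \bar R) : continuous (fun p : R * R => G p.1 p.2) ->
    (forall x y, g x y = ((fun p => (G p.1 p.2)%:E) \_ (I2 `*` I2)) (x, y)) ->
    (\int[mu]_x \int[mu]_y g x y = (2 * pi * (2 * pi * cmean (fun x => cmean (G x))))%:E)%E.
  move=> cG gE.
  transitivity (\int[mu]_x ((fun x => (2 * pi * cmean (G x))%:E) \_ I2) x)%E.
    apply: eq_integral => x _; rewrite patchE; case: ifPn => xI.
      rewrite -integral_cmean; last exact: continuous2_l.
      rewrite [RHS]integral_mkcond; apply: eq_integral => y _.
      rewrite gE !patchE; congr (if _ then _ else _).
      by apply/idP/idP; rewrite !inE; [case|move=> yI; split => //; rewrite inE in xI].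
    rewrite -[RHS](integral0 mu setT); apply: eq_integral => y _.
    rewrite gE patchE ifF//; apply/negbTE; apply: contra xI; rewrite !inE.
    by case.
  rewrite -integral_mkcond integral_cmean; last first.
    by apply: continuous_scale_fun; exact: cmean_continuous.
  by rewrite cmeanZ//; exact: cmean_continuous.
have := @sfinite_Fubini _ _ _ _ _ mu mu f f0 mf.
rewrite (E F (fun x y => f (x, y)) cF (fun _ _ => erefl)).
rewrite (E (fun y x => F x y) (fun y x => f (x, y)) cF'); last first.
  move=> x y; rewrite /f !patchE; congr (if _ then _ else _).
  by apply/idP/idP; rewrite !inE => -[].
have p0 : 2 * pi != 0 :> R by rewrite gt_eqF ?twopi_gt0.
by case=> /(mulfI p0)/(mulfI p0).
Qed.

Lemma continuous_max0 (T : topologicalType) (u : T -> R) : continuous u -> continuous (fun t => Num.max (u t) 0).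
Proof.
move=> cu t; apply: (@continuous_comp _ _ _ u (fun x => Num.max x 0)); first exact: cu.
by apply: continuous_max; [exact: cvg_id|exact: cvg_cst].
Qed.

Lemma cmean_fubini F : continuous (fun p : R * R => F p.1 p.2) ->
  cmean (fun x => cmean (F x)) = cmean (fun y => cmean (F ^~ y)).
Proof.
move=> cF.
pose F1 (x y : R) : R := Num.max (F x y) 0; pose F2 (x y : R) : R := Num.max (- F x y) 0.
have cF1 : continuous (fun p : R * R => F1 p.1 p.2) by exact: continuous_max0.
have cF2 : continuous (fun p : R * R => F2 p.1 p.2).
  by apply: continuous_max0 => p; apply: cvgN; exact: cF.
have cswap (G : R -> R -> R) : continuous (fun p : R * R => G p.1 p.2) -> continuous (fun p : R * R => G p.2 p.1).
  move=> cG p; apply: (@continuous_comp _ _ _ (fun p : R * R => (p.2, p.1)) (fun p => G p.1 p.2)).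
    by apply: (@cvg_pair _ _ _ _ (nbhs p.2) (nbhs p.1)); [exact: cvg_snd|exact: cvg_fst].
  exact: cG.
have FE (x y : R) : F x y = F1 x y + (-1) * F2 x y.
  rewrite /F1 /F2 mulN1r; case: (lerP 0 (F x y)) => h.
    by rewrite max_r ?oppr_le0// subr0.
  by rewrite max_l ?oppr_ge0 ?(ltW h)// opprK add0r.
have D (G H : R -> R -> R) : continuous (fun p : R * R => G p.1 p.2) -> continuous (fun p : R * R => H p.1 p.2) ->
    cmean (fun x => cmean (fun y => G x y + (-1) * H x y)) =
    cmean (fun x => cmean (G x)) + (-1) * cmean (fun x => cmean (H x)).
  move=> cG cH.
  rewrite -cmeanZ; last exact: cmean_continuous.
  rewrite -cmeanD; [|exact: cmean_continuous|by apply: continuous_scale_fun; exact: cmean_continuous].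
  apply: eq_cmean => x; rewrite cmeanD.
  - by rewrite cmeanZ//; exact: continuous2_l.
  - exact: continuous2_l.
  - by apply: continuous_scale_fun; exact: continuous2_l.
transitivity (cmean (fun x => cmean (fun y => F1 x y + (-1) * F2 x y))).
  by apply: eq_cmean => x; apply: eq_cmean.
transitivity (cmean (fun y => cmean (fun x => F1 x y + (-1) * F2 x y))); last first.
  by apply: eq_cmean => x; apply: eq_cmean.
rewrite (D F1 F2)// (D (fun y x => F1 x y) (fun y x => F2 x y)); [|exact: cswap|exact: cswap].
rewrite (cmean_fubini_ge0 cF1) ?(cmean_fubini_ge0 cF2)//.
- by move=> x y; rewrite /F2 le_max lexx orbT.
- by move=> x y; rewrite /F1 le_max lexx orbT.
Qed.
End Plane.

(** * Rotation averages, and from local to global mean inequalities *)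

Section CplxContinuity.
Variable R : realType.

Lemma continuous_cplx (T : topologicalType) (a b : T -> R) (x : T) :
  {for x, continuous a} -> {for x, continuous b} ->
  {for x, continuous (fun t => (a t +i* b t : Cplx R))}.
Proof.
move=> ca cb A /nbhs_cplxP[e e0 eA].
have e2 : 0 < e / 2 by rewrite divr_gt0.
have na : \forall t \near x, `|a t - a x| < e / 2.
  move/cvgrPdist_lt : ca => /(_ _ e2); apply: filterS => t /=.
  by rewrite distrC.
have nb : \forall t \near x, `|b t - b x| < e / 2.
  move/cvgrPdist_lt : cb => /(_ _ e2); apply: filterS => t /=.
  by rewrite distrC.
suff : \forall t \near x, A (a t +i* b t : Cplx R) by [].
near=> t; apply: eA.
have -> : (a t +i* b t : Cplx R) - (a x +i* b x) = (a t - a x) +i* (b t - b x) by [].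
have h1 : `|a t - a x| < e / 2 by near: t.
have h2 : `|b t - b x| < e / 2 by near: t.
rewrite -(ltr_pXn2r (_ : 0 < 2)%N)// ?nnegrE ?normc_ge0 ?(ltW e0)// normc_sqr/=.
rewrite -[(a t - _) ^+ 2]real_normK ?num_real// -[(b t - _) ^+ 2]real_normK ?num_real//.
have := normr_ge0 (a t - a x); have := normr_ge0 (b t - b x).
nra.
Unshelve. all: by end_near. Qed.

Lemma continuous_of_le (phi : Cplx R -> R) :
  (forall z w, `|phi w - phi z| <= normc (w - z)) -> continuous phi.
Proof.
move=> H z A /nbhs_ballP[e /= e0 eA].
apply/nbhs_cplxP; exists e => // w wz; apply: eA.
by rewrite /ball/= distrC; exact: le_lt_trans wz.
Qed.

Lemma continuous_normc : continuous (@normc R : Cplx R -> R).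
Proof.
apply: continuous_of_le => z w.
have h1 := ler_normcD (z - w) w; have h2 := ler_normcD (w - z) z.
rewrite !subrK -(normc_opp (z - w)) opprB in h1 h2.
by rewrite ler_norml; apply/andP; split; lra.
Qed.

Lemma continuous_circ : continuous (@circ R).
Proof. by move=> t; apply: continuous_cplx; [exact: continuous_cos|exact: continuous_sin]. Qed.

Lemma continuous_realc : continuous (fun r : R => (r%:C : Cplx R)).
Proof. by move=> t; apply: continuous_cplx; [exact: cvg_id|exact: cvg_cst]. Qed.

Lemma circ_period t : circ (t + 2 * pi) = circ t :> Cplx R.
Proof. by rewrite /circ mulr_natl cosD2pi sinD2pi. Qed.

Lemma polar (w : Cplx R) : exists a, w = (normc w)%:C * circ a.
Proof.
have [->|w0] := eqVneq w 0; first by exists 0; rewrite normc0 mul0r.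
have n0 : normc w != 0 by rewrite normc_eq0.
pose v : Cplx R := (normc w)^-1%:C * w.
have wE : w = (normc w)%:C * v by rewrite mulrA -rmorphM/= mulfV// mul1r.
have : normc v = 1 by rewrite normcM normc_real ger0_norm ?invr_ge0 ?normc_ge0// mulVf.
case: v wE => a b wE v1.
have ab : a ^+ 2 + b ^+ 2 = 1 by rewrite -[RHS](expr1n _ 2) -v1 normc_sqr.
have a1 : -1 <= a <= 1.
  by rewrite -ler_norml -(ler_pXn2r (_ : 0 < 2)%N)// ?nnegrE// real_normK ?num_real// expr1n -ab lerDl sqr_ge0.
have b2 : Num.sqrt (1 - a ^+ 2) = `|b| by rewrite -ab addrC addKr sqrtr_sqr.
have [b0|/ltW b0] := leP 0 b.
  exists (acos a); rewrite {1}wE; congr (_ * _); rewrite /circ acosK ?in_itv//.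
  by rewrite sin_acos// b2 ger0_norm.
exists (- acos a); rewrite {1}wE; congr (_ * _); rewrite /circ cosN sinN acosK ?in_itv//.
by rewrite sin_acos// b2 ler0_norm// opprK.
Qed.

Lemma continuous_rot (u : Cplx R -> R) (w : Cplx R) : continuous u ->
  continuous (fun t => u (w * circ t)).
Proof.
move=> cu t; apply: (@continuous_comp R (Cplx R) R (fun t => w * circ t) u); last exact: cu.
by apply: cvgM; [exact: cvg_cst|exact: continuous_circ].
Qed.

(** Multiplying by the argument of [w] shifts the parameter of the circle. Hence the rotation
    averages of [u] are radial. *)
Lemma cmean_rot (u : Cplx R -> R) (w : Cplx R) : continuous u ->
  cmean (fun t => u (w * circ t)) = cmean (fun t => u ((normc w)%:C * circ t)).
Proof.
move=> cu; have [a wE] := polar w; rewrite {1}wE.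
rewrite -[RHS](@cmean_shift _ _ a).
- by apply: eq_cmean => t; rewrite addrC circD mulrA.
- exact: continuous_rot.
- by move=> t; rewrite circ_period.
Qed.

(** The strict subharmonicity of |.|^2 in exact form; the gain s^2 is what absorbs errors of order
    s^3. *)
Lemma cmean_normc_sqr (r s : R) :
  cmean (fun t => normc (r%:C + s%:C * circ t) ^+ 2) = r ^+ 2 + s ^+ 2.
Proof.
transitivity (cmean (fun t => (r ^+ 2 + s ^+ 2) +
   ((2 * r * s) * cos t + 0 * sin t + (0 * cos (2 * t) + 0 * sin (2 * t))))).
  apply: eq_cmean => t; rewrite normc_sqr /circ/=.
  have -> : (s * cos t - 0 * sin t) = s * cos t by ring.
  have -> : 0 + (s * sin t + 0 * cos t) = s * sin t by ring.
  have -> : (r + s * cos t) ^+ 2 + (s * sin t) ^+ 2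
    = r ^+ 2 + s ^+ 2 * (cos t ^+ 2 + sin t ^+ 2) + 2 * r * s * cos t by ring.
  by rewrite cos2Dsin2; ring.
rewrite cmeanD ?cmean_trig ?addr0 ?cmean_cst//; first exact: cst_continuous.
have cc := @continuous_cos R; have cs := @continuous_sin R.
by do 2?apply: continuous_sum_fun; apply: continuous_scale_fun => //; exact: continuous_dil_fun.
Qed.

Lemma continuous_add_rot (u : Cplx R -> R) (z w : Cplx R) : continuous u ->
  continuous (fun t => u (z + w * circ t)).
Proof.
move=> cu; apply: (@continuous_rot (fun l => u (z + l))) => l.
apply: (@continuous_comp (Cplx R) (Cplx R) R (fun l => z + l) u); last exact: cu.
move=> A /nbhs_cplxP[e e0 eA]; apply/nbhs_cplxP; exists e => // v vl.
by apply: eA; rewrite opprD addrACA subrr add0r.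
Qed.

(* By Fubini the rotation averages U r of u inherit the local inequality. If
   U r + e r^2 had its maximum over [0, 1] at some r < 1, the mean of e |.|^2
   over a small circle of radius s would gain e s^2 there, beating M s^3. *)
Lemma local_submean (u : Cplx R -> R) (M s0 : R) : continuous u -> 0 < s0 ->
  (forall z s, 0 < s -> s <= s0 -> normc z + s <= 1 ->
    u z <= cmean (fun t => u (z + s%:C * circ t)) + M * s ^+ 3) ->
  u 0 <= cmean (fun t => u (circ t)).
Proof.
move=> cu s00 loc.
pose U (r : R) := cmean (fun t => u (r%:C * circ t)).
have cF (G : R * R -> Cplx R) : continuous G -> continuous (fun p => u (G p)).
  by move=> cG p; apply: (@continuous_comp (R * R)%type (Cplx R) R G u); [exact: cG|exact: cu].
have c1 : continuous (fun p : R * R => circ p.1 : Cplx R).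
  by move=> p; apply: (@continuous_comp (R * R)%type R (Cplx R) fst (@circ R)); [exact: cvg_fst|exact: continuous_circ].
have c2 : continuous (fun p : R * R => circ p.2 : Cplx R).
  by move=> p; apply: (@continuous_comp (R * R)%type R (Cplx R) snd (@circ R)); [exact: cvg_snd|exact: continuous_circ].
have cr1 : continuous (fun p : R * R => (p.1)%:C : Cplx R).
  by move=> p; apply: (@continuous_comp (R * R)%type R (Cplx R) fst (fun r : R => (r%:C : Cplx R))); [exact: cvg_fst|exact: continuous_realc].
have cU : continuous U.
  apply: (@cmean_continuous R (fun r t => u (r%:C * circ t))).
  by apply: cF => p; apply: cvgM; [exact: cr1|exact: c2].
have rad (r s : R) : 0 <= r -> 0 < s -> s <= s0 -> r + s <= 1 ->
    U r <= cmean (fun t => U (normc (r%:C + s%:C * circ t))) + M * s ^+ 3.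
  move=> r0 sp ss rs.
  have cG : continuous (fun p : R * R => u ((r%:C + s%:C * circ p.1) * circ p.2)).
    apply: cF => p; apply: cvgM; last exact: c2.
    by apply: cvgD; [exact: cvg_cst|apply: cvgM; [exact: cvg_cst|exact: c1]].
  have -> : cmean (fun t => U (normc (r%:C + s%:C * circ t)))
      = cmean (fun v => cmean (fun t => u ((r%:C + s%:C * circ t) * circ v))).
    transitivity (cmean (fun t => cmean (fun v => u ((r%:C + s%:C * circ t) * circ v)))).
      by apply: eq_cmean => t; rewrite (cmean_rot (r%:C + s%:C * circ t) cu).
    exact: (@cmean_fubini R (fun t v => u ((r%:C + s%:C * circ t) * circ v)) cG).
  rewrite -[M * _]cmean_cst -cmeanD; last 2 first.
  - apply: (@cmean_continuous R (fun v t => u ((r%:C + s%:C * circ t) * circ v))).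
    apply: cF => p; apply: cvgM; last exact: c1.
    by apply: cvgD; [exact: cvg_cst|apply: cvgM; [exact: cvg_cst|exact: c2]].
  - exact: cst_continuous.
  apply: le_cmean.
  - exact: continuous_rot.
  - apply: continuous_sum_fun; last exact: cst_continuous.
    apply: (@cmean_continuous R (fun v t => u ((r%:C + s%:C * circ t) * circ v))).
    apply: cF => p; apply: cvgM; last exact: c1.
    by apply: cvgD; [exact: cvg_cst|apply: cvgM; [exact: cvg_cst|exact: c2]].
  move=> v; apply: (le_trans (loc _ s sp ss _)).
    by rewrite normcM circ_norm mulr1 normc_real ger0_norm.
  rewrite lerD2r -(@cmean_shift _ _ v).
  - rewrite le_eqVlt; apply/orP; left; apply/eqP; apply: eq_cmean => t.
    by rewrite circD mulrDl mulrA.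
  - exact: continuous_add_rot.
  - by move=> t; rewrite circ_period.
have U0 : U 0 = u 0.
  by rewrite /U -[RHS](cmean_cst (u 0)); apply: eq_cmean => t; rewrite mul0r.
have U1 : U 1 = cmean (fun t => u (circ t)).
  by apply: eq_cmean => t; rewrite mul1r.
rewrite -U0 -U1; apply/ler_addgt0Pr => e e0.
pose w (r : R) := U r + e * r ^+ 2.
have cw : continuous w.
  move=> r; apply: cvgD; first exact: cU.
  by apply: cvgM; [exact: cvg_cst|apply: cvgM; exact: cvg_id].
have [r0] := EVT_max ler01 (continuous_subspaceT cw : {within `[0, 1], continuous w}).
rewrite in_itv/= => /andP[r00 r01] wmax.
have [r1|r1] := leP 1 r0.
  have r1E : r0 = 1 by apply/eqP; rewrite eq_le r01.
  have := wmax 0; rewrite in_itv/= lexx ler01 => /(_ isT).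
  by rewrite /w r1E expr0n/= expr1n mulr0 addr0 mulr1.
exfalso.
(* The last bound gives M s < e, so that the gain e s^2 exceeds the error M s^3; the second keeps
   the small circle in the unit disc. *)
pose s := Num.min (Num.min s0 (1 - r0)) (e / (2 * (`|M| + 1))).
have M1 : 0 < 2 * (`|M| + 1) by have := normr_ge0 M; lra.
have s1 : 0 < s by rewrite !lt_min s00 subr_gt0 r1 divr_gt0.
have : s <= s by []. 
rewrite {2}/s !le_min => /andP[/andP[ss0 sr] se].
have sr1 : r0 + s <= 1 by lra.
have Ms : M * s < e.
  have : `|M| * s < e.
    move: se; rewrite ler_pdivlMr// => se.
    have : 0 <= `|M| * s by rewrite mulr_ge0 ?(ltW s1).
    nra.
  apply: le_lt_trans; rewrite ler_pM2r//; exact: ler_norm.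
have := rad r0 s r00 s1 ss0 sr1.
have cn : continuous (fun t => normc (r0%:C + s%:C * circ t)).
  exact: (@continuous_add_rot (@normc R) r0%:C s%:C continuous_normc).
have cn2 : continuous (fun t => normc (r0%:C + s%:C * circ t) ^+ 2).
  by move=> t; apply: cvgM; exact: cn.
have : cmean (fun t => U (normc (r0%:C + s%:C * circ t))) <=
    cmean (fun t => w r0 + (- e) * normc (r0%:C + s%:C * circ t) ^+ 2).
  apply: le_cmean.
  - by move=> t; apply: (@continuous_comp _ _ _ (fun t => normc (r0%:C + s%:C * circ t)) U); [exact: cn|exact: cU].
  - apply: continuous_sum_fun; first exact: cst_continuous.
    exact: continuous_scale_fun.
  move=> t; rewrite mulNr lerBrDr; apply: wmax.
  rewrite in_itv; apply/andP; split; first exact: normc_ge0.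
  apply: le_trans sr1.
  apply: (le_trans (ler_normcD _ _)).
  by rewrite normcM circ_norm mulr1 !normc_real ger0_norm// ger0_norm ?(ltW s1).
rewrite cmeanD; [|exact: cst_continuous|exact: continuous_scale_fun].
rewrite cmean_cst (cmeanZ _ cn2) cmean_normc_sqr.
rewrite /w => h1 h2.
have s2 : 0 < s ^+ 2 by rewrite exprn_gt0.
have : M * s ^+ 3 < e * s ^+ 2.
  by rewrite exprS mulrA ltr_pM2r.
lra.
Qed.

End CplxContinuity.

(** * Plurisubharmonicity from a local inequality *)

Section LogMean.
Variable R : realType.
Local Notation mu := (@lebesgue_measure R).

(* The logarithm truncated from below at ln e, so that it is continuous. *)
Definition lntr (e x : R) : R := ln (Num.max x e).

Lemma lntr_ge e x : 0 < e -> ln e <= lntr e x.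
Proof. by move=> e0; rewrite ler_ln ?posrE ?lt_max ?e0 ?orbT// le_max lexx orbT. Qed.

Lemma lntr_ge_ln e x : 0 < e -> 0 < x -> ln x <= lntr e x.
Proof. by move=> e0 x0; rewrite ler_ln ?posrE ?lt_max ?x0// le_max lexx. Qed.

Lemma continuous_lntr e : 0 < e -> continuous (lntr e).
Proof.
move=> e0 x; apply: (@continuous_comp _ _ _ (fun x => Num.max x e) (@ln R)).
  by apply: continuous_max; [exact: cvg_id|exact: cvg_cst].
by apply: continuous_ln; rewrite lt_max e0 orbT.
Qed.

(** Monotone convergence along the truncations of ln at the levels -n. The signs are reversed so
    that the integrands are nonnegative, which uses w < 1. *)
Lemma lne_mean_le (w : R -> R) (c : R) : continuous w -> (forall t, 0 <= w t < 1) ->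
  (forall n : nat, c <= cmean (fun t => lntr (expR (- n%:R)) (w t))) ->
  (c%:E <= ((2 * pi)^-1)%:E * \int[mu]_(t in [set` `[0%R, (2 * pi)%R]]) lne (w t)%:E)%E.
Proof.
move=> cw w01 cle; have p0 := twopi_gt0 R.
pose h n t : R := - lntr (expR (- n%:R)) (w t).
have ch n : continuous (h n).
  move=> t; apply: cvgN; apply: (@continuous_comp _ _ _ w (lntr (expR (- n%:R)))); first exact: cw.
  by apply: continuous_lntr; exact: expR_gt0.
pose g n t : \bar R := (h n t)%:E.
have mg n : measurable_fun [set` `[0%R, (2 * pi)%R]] (g n).
  apply/measurable_EFinP; apply: measurable_funTS.
  exact: continuous_measurable_fun.
have g0 n t : [set` `[0%R, (2 * pi)%R]] t -> (0 <= g n t)%E.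
  move=> _; rewrite lee_fin oppr_ge0 ln_le0// ge_max (ltW (andP (w01 t)).2)/=.
  by rewrite -expR0 ler_expR oppr_le0.
have ndg t : [set` `[0%R, (2 * pi)%R]] t -> {homo g^~ t : n m / (n <= m)%N >-> (n <= m)%E}.
  move=> _ n m nm; rewrite lee_fin lerN2 ler_ln ?posrE ?lt_max ?expR_gt0 ?orbT//.
  by rewrite ge_max !le_max lexx/= ler_expR lerN2 ler_nat nm orbT.
have lim t : limn (g^~ t) = (- lne (w t)%:E)%E.
  apply/cvg_lim => //.
  have /andP[] := w01 t; rewrite le_eqVlt => /predU1P[w0|w0] _.
    rewrite -w0 /= lexx/=; apply/cvgeyPge => A.
    near=> n; rewrite lee_fin /h /lntr -w0 max_r ?expR_ge0// expRK opprK.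
    near: n; exact: nbhs_infty_ger.
  apply: cvg_near_cst; near=> n.
  rewrite lne_EFin// /g /h /lntr max_l// -[leRHS]lnK// ler_expR lerNl.
  near: n; exact: nbhs_infty_ger.
have := @monotone_convergence _ _ _ mu _ (measurable_itv _) g mg g0 ndg.
have -> : (\int[mu]_(x in [set` `[0%R, (2 * pi)%R]]) limn (g^~ x) =
    - \int[mu]_(x in [set` `[0%R, (2 * pi)%R]]) lne (w x)%:E)%E.
  under eq_integral => t _ do rewrite lim.
  have := @integral_ge0N _ _ _ mu [set` `[0%R, (2 * pi)%R]] (fun t => - lne (w t)%:E)%E.
  under eq_integral do rewrite oppeK.
  move=> ->; first by rewrite oppeK.
  by move=> t _; rewrite oppe_ge0 lne_le0 lee_fin ltW// (andP (w01 t)).2.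
move=> I.
have : (limn (fun n => \int[mu]_(x in [set` `[0%R, (2 * pi)%R]]) g n x) <= (- (2 * pi * c))%:E)%E.
  apply: lime_le.
    apply: ereal_nondecreasing_is_cvgn => n m nm; apply: ge0_le_integral => //.
    - by move=> t; exact: g0.
    - exact: mg.
    - exact: mg.
    - by move=> t It; exact: (ndg t It n m nm).
  apply: nearW => n; rewrite /g integral_cmean; last exact: ch.
  rewrite lee_fin -mulrN ler_pM2l//.
  rewrite (_ : cmean (h n) = - cmean (fun t => lntr (expR (- n%:R)) (w t))) ?lerN2//.
  rewrite -(mulN1r (cmean _)) -cmeanZ; first by apply: eq_cmean => t; rewrite mulN1r.
  move=> t; apply: (@continuous_comp _ _ _ w (lntr (expR (- n%:R)))); first exact: cw.
  by apply: continuous_lntr; exact: expR_gt0.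
rewrite -I EFinN leeN2 => J.
rewrite -(@lee_pmul2l _ (2 * pi)%:E) ?lte_fin//.
by rewrite muleA -(EFinM (2 * pi) (2 * pi)^-1) mulfV ?gt_eqF// mul1e -EFinM.
Unshelve. all: by end_near. Qed.

End LogMean.

Section PshLocal.
Variables (R : realType) (n : nat).
Implicit Types (z a b : Cn R n) (D : set (Cn R n)).

Lemma lipschitz_continuous_Cn (T : Type) (phi : Cplx R -> Cn R n) (K : R) :
  (forall l l', enorm (phi l' - phi l) <= K * normc (l' - l)) -> continuous phi.
Proof.
move=> H l A /nbhs_CnP[e e0 eA]; apply/nbhs_cplxP.
have K0 : 0 < `|K| + 1 by rewrite ltr_wpDl.
exists (e / (`|K| + 1)); first by rewrite divr_gt0.
move=> l' ll'; apply: eA; apply: le_lt_trans (H _ _) _.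
move: ll'; rewrite ltr_pdivlMr// => ll'.
apply: le_lt_trans ll'; rewrite mulrC ler_wpM2l ?normc_ge0//.
by apply: le_trans (ler_norm _) _; rewrite lerDl.
Qed.

Lemma continuous_line a b : continuous (fun l : Cplx R => a + l *: b).
Proof.
apply: (@lipschitz_continuous_Cn unit _ (enorm b)) => l l'.
by rewrite opprD addrACA subrr add0r -scalerBl enormZ mulrC.
Qed.

(* The retraction of C onto the closed unit disc makes the functions below
   continuous on the whole plane. *)
Definition cproj (l : Cplx R) : Cplx R := ((Num.max (normc l) 1)^-1)%:C * l.

Lemma cproj_le1 l : normc (cproj l) <= 1.
Proof.
have m0 : 0 < Num.max (normc l) 1 by rewrite lt_max ltr01 orbT.
rewrite normcM normc_real ger0_norm ?invr_ge0 ?(ltW m0)// mulrC ler_pdivrMr//.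
by rewrite mul1r le_max lexx.
Qed.

Lemma cproj_id l : normc l <= 1 -> cproj l = l.
Proof. by move=> l1; rewrite /cproj max_r// invr1 mul1r. Qed.

Lemma cplx_continuousM (T : topologicalType) (f g : T -> Cplx R) :
  continuous f -> continuous g -> continuous (fun t => f t * g t).
Proof. by move=> cf cg t; apply: cvgM; [exact: cf|exact: cg]. Qed.

Lemma continuous_cproj : continuous cproj.
Proof.
have cm : continuous (fun r : R => Num.max r 1).
  by move=> r; apply: continuous_max; [exact: cvg_id|exact: cvg_cst].
have c0 : continuous (fun l : Cplx R => (Num.max (normc l) 1)^-1).
  move=> l; apply: (@continuous_comp (Cplx R) R R (@normc R) (fun r => (Num.max r 1)^-1)).
    exact: continuous_normc.
  apply: cvgV; first by rewrite gt_eqF// lt_max ltr01 orbT.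
  exact: cm.
have c1 : continuous (fun l : Cplx R => (((Num.max (normc l) 1)^-1)%:C : Cplx R)).
  move=> l; apply: (@continuous_comp (Cplx R) R (Cplx R) _ (fun r : R => (r%:C : Cplx R))).
    exact: c0.
  exact: continuous_realc.
exact: (@cplx_continuousM (Cplx R) (fun l => ((Num.max (normc l) 1)^-1)%:C) idfun c1 (fun l => @cvg_id _ (nbhs l))).
Qed.

Lemma lne_ltE (x r : R) : (lne x%:E < r%:E)%E = (x < expR r).
Proof.
have [x0|x0] := leP x 0.
  by rewrite le0_lneNy ?lee_fin// ltNyr (le_lt_trans x0)// expR_gt0.
by rewrite lne_EFin// lte_fin -[in LHS]ltr_expR lnK.
Qed.

Lemma ler_norm_disc (l : Cplx R) : (`|l| <= 1) = (normc l <= 1).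
Proof. by rewrite norm_normcE; rewrite (lecR (normc l) 1). Qed.

(** The truncation makes the logarithm continuous on discs, so that [local_submean] applies; the
    level is sent to 0 afterwards by [lne_mean_le]. This order allows [M] and [s0] to depend on the
    level and on the disc. At a centre where v vanishes the left-hand side is -oo. *)
Lemma psh_of_local D (v : Cn R n -> R) :
  (forall z, D z -> 0 <= v z < 1) ->
  (forall z, D z -> {for z, continuous v}) ->
  (forall a b, (forall l : Cplx R, normc l <= 1 -> D (a + l *: b)) ->
   forall e : R, 0 < e -> exists M s0 : R, 0 < s0 /\
     forall (l : Cplx R) (s : R), 0 < s -> s <= s0 -> normc l + s <= 1 ->
     lntr e (v (a + l *: b)) <=
     cmean (fun t => lntr e (v (a + (l + s%:C * circ t) *: b))) + M * s ^+ 3) ->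
  psh D (fun w => lne (v w)%:E).
Proof.
move=> v01 cv loc; split.
- move=> z Dz; apply: (@lt_trans _ _ 0%E); last exact: ltry.
  by rewrite lne_lt0 lte_fin (andP (v01 _ Dz)).2.
- move=> z Dz r; rewrite lne_ltE => vr.
  have : nbhs z [set w | v w < expR r] by exact: (cvgr_lt _ (cv z Dz) _ vr).
  move=> /(nbhs_CnP z)[e e0 H].
  suff : nbhs z [set w | (lne (v w)%:E < r%:E)%E] by [].
  by apply/nbhs_CnP; exists e => // w /H; rewrite /= lne_ltE.
- move=> a b disc0.
  have disc l : normc l <= 1 -> D (a + l *: b) by rewrite -ler_norm_disc; exact: disc0.
  have [va0|va0] := leP (v a) 0; first by rewrite le0_lneNy ?lee_fin// leNye.
  pose ut l := v (a + cproj l *: b).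
  have cut : continuous ut.
    move=> l; apply: (@continuous_comp (Cplx R) (Cn R n) R (fun l => a + cproj l *: b) v).
      apply: (@continuous_comp (Cplx R) (Cplx R) (Cn R n) cproj (fun l => a + l *: b)).
        exact: continuous_cproj.
      exact: continuous_line.
    by apply: cv; apply: disc; exact: cproj_le1.
  have utc t : ut (circ t) = v (a + circ t *: b).
    by rewrite /ut cproj_id// circ_norm.
  rewrite lne_EFin//.
  apply: (@lne_mean_le R (fun t => v (a + circ t *: b)) (ln (v a))).
  + rewrite -(funext utc : _ = fun t => v (a + circ t *: b)).
    by move=> t; apply: (@continuous_comp R (Cplx R) R (@circ R) ut); [exact: continuous_circ|exact: cut].
  + by move=> t; apply: v01; apply: disc; rewrite circ_norm.
  move=> k; under eq_cmean do rewrite -utc.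
  have e0 := @expR_gt0 R (- k%:R).
  have [M [s0 [s00 H]]] := loc a b disc _ e0.
  have ua : ut 0 = v a by rewrite /ut cproj_id ?normc0// scale0r addr0.
  apply: (@le_trans _ _ (lntr (expR (- k%:R)) (ut 0))); first by rewrite ua; exact: lntr_ge_ln.
  apply: (@local_submean R (fun l => lntr (expR (- k%:R)) (ut l)) M s0); [|exact: s00|].
    move=> l; apply: (@continuous_comp (Cplx R) R R ut); first exact: cut.
    exact: continuous_lntr.
  move=> l s sp ss ls; rewrite /ut cproj_id; last by lra.
  apply: le_trans (H l s sp ss ls) _; rewrite lerD2r le_eqVlt; apply/orP; left; apply/eqP.
  apply: eq_cmean => t; rewrite cproj_id//.
  apply: (le_trans (ler_normcD _ _)).
  by rewrite normcM circ_norm mulr1 normc_real gtr0_norm.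
Qed.

End PshLocal.

(** * Mean inequalities from polynomial minorants *)

Section Minorant.
Variable R : realType.

(** The polynomial has no zero on the circle, because its nonconstant part is at most 2 A s < 1
    there. *)
Lemma continuous_ln_quad (A s : R) (al be : Cplx R) : 0 <= A -> 0 < s -> s <= 1 ->
  16 * A * s <= 1 -> normc al <= A -> normc be <= A ->
  continuous (fun t => ln (normc (1 + al * (s%:C * circ t) + be * (s%:C * circ t) ^+ 2) ^+ 2)).
Proof.
move=> A0 s0 s1 As hal hbe.
pose G (l : R) : Cplx R := 1 + al * (s%:C * circ l) + be * (s%:C * circ l) ^+ 2.
have cz : continuous (fun t => s%:C * circ t : Cplx R).
  by move=> t; apply: cvgM; [exact: cvg_cst|exact: continuous_circ].
have cG : continuous G.
  move=> t; apply: cvgD; last first.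
    by apply: cvgM; [exact: cvg_cst|apply: cvgM; exact: cz].
  by apply: cvgD; [exact: cvg_cst|apply: cvgM; [exact: cvg_cst|exact: cz]].
have cN : continuous (fun t => normc (G t)).
  move=> t; apply: (@continuous_comp R (Cplx R) R G (@normc R)); first exact: cG.
  exact: continuous_normc.
move=> t; apply: (@continuous_comp R R R (fun t => normc (G t) ^+ 2) (@ln R)).
  by apply: cvgM; exact: cN.
apply: continuous_ln; rewrite exprn_gt0// lt0r normc_ge0 andbT normc_eq0.
apply/eqP => G0.
have zn : normc (s%:C * circ t) = s by rewrite normcM circ_norm mulr1 normc_real gtr0_norm.
have : normc (1 : Cplx R) <= A * s + A * s.
  have -> : 1 = - (al * (s%:C * circ t) + be * (s%:C * circ t) ^+ 2) :> Cplx R.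
    by apply/eqP; rewrite -subr_eq0 opprK addrA; apply/eqP.
  rewrite normc_opp; apply: (le_trans (ler_normcD _ _)).
  rewrite (normcM al) (normcM be) normcX zn; apply: lerD; first by rewrite ler_pM2r.
  apply: ler_pM; rewrite ?normc_ge0 ?sqr_ge0//.
  by rewrite expr2 ler_piMr// ltW.
by rewrite normc1; lra.
Qed.

(** Logarithms of moduli of nonvanishing polynomials are harmonic, so numerator and denominator of
    the minorant both drop out of the mean up to O(s^3); the denominator uses the other side of
    [mean_ln]. *)
Lemma cmean_minorant (A k k' s V : R) (al be ga : Cplx R) (g : R -> R) :
  0 <= A -> 0 <= k -> 0 <= k' -> 0 < s -> s <= 1 -> 16 * A * s <= 1 ->
  normc al <= A -> normc be <= A -> normc ga <= A -> continuous g ->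
  (forall t, V + k * ln (normc (1 + al * (s%:C * circ t) + be * (s%:C * circ t) ^+ 2) ^+ 2)
     - k' * ln (normc (1 + ga * (s%:C * circ t)) ^+ 2) <= g t) ->
  V <= cmean g + (k + k') * (240 * A ^+ 3 + 3 * A ^+ 2) * s ^+ 3.
Proof.
move=> A0 k0 k'0 s0 s1 As hal hbe hga cg H.
have h0 : normc (0 : Cplx R) <= A by rewrite normc0.
have c1 := continuous_ln_quad A0 s0 s1 As hal hbe.
have c2 := continuous_ln_quad A0 s0 s1 As hga h0.
have := mean_ln A0 s0 s1 As hal hbe; have := mean_ln A0 s0 s1 As hga h0.
set f2 := (fun t : R => ln (normc (1 + ga * _ + _) ^+ 2)).
set f1 := (fun t : R => ln (normc (1 + al * _ + _) ^+ 2)).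
rewrite -/f1 in c1; rewrite -/f2 in c2.
set K := _ * s ^+ 3; rewrite !ler_norml => /andP[_ h2] /andP[h1 _].
have : cmean (fun t => V + (k * f1 t + (- k') * f2 t)) <= cmean g.
  apply: le_cmean => //.
    apply: continuous_sum_fun; first exact: cst_continuous.
    by apply: continuous_sum_fun; exact: continuous_scale_fun.
  move=> t; apply: le_trans (H t); rewrite addrA mulNr.
  have -> : f2 t = ln (normc (1 + ga * (s%:C * circ t)) ^+ 2) by rewrite /f2 mul0r addr0.
  exact: lexx.
rewrite cmeanD; [|exact: cst_continuous|by apply: continuous_sum_fun; exact: continuous_scale_fun].
rewrite cmean_cst cmeanD; [|exact: continuous_scale_fun|exact: continuous_scale_fun].
rewrite !cmeanZ// => h3.
have e1 : k * - K <= k * cmean f1 by rewrite ler_wpM2l.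
have e2 : k' * cmean f2 <= k' * K by rewrite ler_wpM2l.
have -> : (k + k') * (240 * A ^+ 3 + 3 * A ^+ 2) * s ^+ 3 = k * K + k' * K.
  by rewrite /K; ring.
lra.
Qed.

End Minorant.

(** * Functions of class C^2 *)

Section Derivatives.
Variable R : realType.

(** The derivative at 0 in little-o form: without a quotient, sums of increments along successive
    directions can be estimated directly. *)
Definition der0 (g : R -> R) (d : R) : Prop := forall e, 0 < e ->
  exists2 r, 0 < r & forall t, `|t| < r -> `|g t - g 0 - d * t| <= e * `|t|.

Lemma der0P (g : R -> R) d : is_derive (0 : R) 1 g d <-> der0 g d.
Proof.
split.
  move=> [dg Dg] e e0.
  have : h^-1 *: (g (h + 0) - g 0) @[h --> 0^'] --> d.
    move: dg; rewrite -Dg /derivable /derive /shift/= => dg.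
    rewrite (_ : (fun h : R => h^-1 *: (g (h + 0) - g 0)) = (fun h : R => h^-1 *: (g (h *: 1 + 0) - g 0))).
      exact: dg.
    by apply/funext => h; rewrite [h *: 1]mulr1.
  move=> /cvgrPdist_le /(_ e e0).
  move=> /nbhs_ballP[r /= r0 H]; exists r => // t tr.
  have [->|t0] := eqVneq t 0; first by rewrite subrr mulr0 subr0 normr0 mulr0.
  have := H t _ t0; rewrite /ball/= sub0r normrN addr0 => /(_ tr).
  rewrite /GRing.scale/=.
  have -> : d - t^-1 * (g t - g 0) = - (g t - g 0 - d * t) / t by field.
  by rewrite normrM normfV normrN ler_pdivrMr ?normr_gt0.
move=> H.
have C : h^-1 *: (g (h *: 1 + 0) - g 0) @[h --> (0:R)^'] --> d.
  apply/cvgrPdist_le => e e0; have [r r0 {}H] := H e e0.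
  apply/nbhs_ballP; exists r => //= t; rewrite /ball/= sub0r normrN => tr t0.
  rewrite addr0 [t *: 1]mulr1 /GRing.scale/=.
  have -> : d - t^-1 * (g t - g 0) = - (g t - g 0 - d * t) / t by field.
  by rewrite normrM normfV normrN ler_pdivrMr ?normr_gt0// H.
apply: DeriveDef; first by apply/cvg_ex; exists d.
by apply/cvg_lim.
Qed.

Lemma is_derive_der0P (g : R -> R) (d s : R) :
  is_derive s 1 g d <-> der0 (fun t => g (s + t)) d.
Proof.
rewrite -der0P; split => H.
  have -> : (fun t => g (s + t)) = (fun t : R => g (t + s)) by apply/funext => t; rewrite addrC.
  by apply: (@is_derive_transl R g d s); rewrite add0r.
have -> : g = (fun t : R => (fun t => g (s + t)) (t + - s)).
  by apply/funext => t/=; rewrite addrC subrK.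
by apply: (@is_derive_transl R (fun t => g (s + t)) d (- s)); rewrite subrr.
Qed.

Lemma mean_value_bound (g dg : R -> R) (d e t : R) :
  (forall s : R, `|s| <= `|t| -> is_derive s 1 g (dg s)) ->
  (forall s : R, `|s| <= `|t| -> `|dg s - d| <= e) ->
  `|g t - g 0 - d * t| <= e * `|t|.
Proof.
move=> dgs dge.
(* Rescaling to [0, 1] treats both signs of t at once. *)
pose h (s : R) : R := g (t * s).
have dh (s : R) : 0 <= s <= 1 -> is_derive s 1 h (t * dg (t * s)).
  move=> /andP[s0 s1].
  have st : `|t * s| <= `|t| by rewrite normrM ler_piMr// ger0_norm.
  have := dgs _ st => dgs'.
  have := @is_derive1_comp R g (fun s : R => t * s) s (dg (t * s)) t dgs'.
  rewrite mulrC; apply.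
  rewrite (_ : (fun s : R => t * s) = cst t * (@id R))//.
  by apply: is_derive_eq; rewrite /GRing.scale/=; ring.
have ch : {within `[0, 1], continuous h}.
  apply/subspace_continuousP => x /=; rewrite in_itv/= => /dh[d' _].
  by apply: cvg_within_filter; apply: differentiable_continuous; exact/derivable1_diffP.
have dh' (s : R) : s \in `]0, 1[%R -> is_derive s 1 h (t * dg (t * s)).
  by rewrite in_itv/= => /andP[s0 s1]; apply: dh; rewrite !ltW.
have [c] := MVT_segment ler01 dh' ch.
rewrite in_itv/= => /andP[c0 c1].
rewrite /h mulr1 mulr0 subr0 mulr1 => ->.
rewrite mulrC -mulrBl normrM ler_wpM2r//; apply: dge.
by rewrite normrM ler_piMr// ger0_norm.
Qed.

(** Second-order Taylor estimate by two applications of [mean_value_bound], which explains e t^2 in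
    place of e t^2 / 2. *)
Lemma double_mean_value (g g1 g2 : R -> R) (c e t : R) : 0 <= e ->
  g 0 = 0 -> g1 0 = 0 ->
  (forall s : R, `|s| <= `|t| -> is_derive s 1 g (g1 s)) ->
  (forall s : R, `|s| <= `|t| -> is_derive s 1 g1 (g2 s)) ->
  (forall s : R, `|s| <= `|t| -> `|g2 s - c| <= e) ->
  `|g t - c / 2 * t ^+ 2| <= e * t ^+ 2.
Proof.
move=> e0 g00 g10 dg dg1 g2c.
have b1 s : `|s| <= `|t| -> `|g1 s - c * s| <= e * `|t|.
  move=> st; apply: (@le_trans _ _ (e * `|s|)); last by rewrite ler_wpM2l.
  have := @mean_value_bound g1 g2 c e s.
  rewrite g10 subr0; apply=> r rs; [apply: dg1|apply: g2c]; exact: le_trans st.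
pose h (s : R) : R := g s - c / 2 * s ^+ 2.
have := @mean_value_bound h (fun s => g1 s - c * s) 0 (e * `|t|) t.
have -> : e * `|t| * `|t| = e * t ^+ 2.
  by rewrite -mulrA -normrM -expr2 ger0_norm ?sqr_ge0.
rewrite /h g00 expr0n/= mulr0 subr0 mul0r !subr0; apply.
  move=> s st; apply: is_deriveB; first exact: dg.
  rewrite (_ : (fun s : R => c / 2 * s ^+ 2) = cst (c / 2) * (@id R) ^+ 2)//.
  by apply: is_derive_eq; rewrite /GRing.scale/=; field.
by move=> s st; rewrite subr0; exact: b1.
Qed.

End Derivatives.

Section PointwiseContinuity.
Variables (R : realType) (T : topologicalType).
Implicit Types (f g : T -> R) (x : T).

Lemma contC_at (c : R) x : {for x, continuous (fun _ : T => c)}.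
Proof. exact: cvg_cst. Qed.

Lemma contD_at f g x : {for x, continuous f} -> {for x, continuous g} ->
  {for x, continuous (fun t => f t + g t)}.
Proof. by move=> cf cg; apply: cvgD. Qed.

Lemma contM_at f g x : {for x, continuous f} -> {for x, continuous g} ->
  {for x, continuous (fun t => f t * g t)}.
Proof. by move=> cf cg; apply: cvgM. Qed.

Lemma contV_at f x : f x != 0 -> {for x, continuous f} ->
  {for x, continuous (fun t => (f t)^-1)}.
Proof. by move=> fx cf; apply: cvgV. Qed.

Lemma cont_sum_at (I : Type) (s : seq I) (F : I -> T -> R) x :
  (forall i, {for x, continuous (F i)}) -> {for x, continuous (fun t => \sum_(i <- s) F i t)}.
Proof.
move=> cF; elim: s => [|i s IH].
  rewrite (_ : (fun t => _) = (fun=> 0)); first exact: contC_at.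
  by apply/funext => t; rewrite big_nil.
rewrite (_ : (fun t => _) = (fun t => F i t + \sum_(j <- s) F j t)); first exact: contD_at.
by apply/funext => t; rewrite big_cons.
Qed.

End PointwiseContinuity.

(** * Derivatives along real lines *)

Section Lines.
Variables (R : realType) (n : nat).
Implicit Types (w z e f X : Cn R n) (v F : Cn R n -> R) (U : set (Cn R n)).

Lemma continuous_CnP F w : {for w, continuous F} <->
  forall eps, 0 < eps -> exists2 r, 0 < r &
    forall z, enorm (z - w) < r -> `|F z - F w| <= eps.
Proof.
split.
  move=> cF eps e0.
  have : nbhs w [set z | `|F w - F z| < eps].
    by have /cvgrPdist_lt/(_ _ e0) := cF.
  move=> /(nbhs_CnP w)[r r0 H]; exists r => // z /H /=.
  by rewrite distrC => /ltW.
move=> H A /nbhs_ballP[e /= e0 eA].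
have [r r0 rF] := H _ (divr_gt0 e0 (ltr0Sn _ 1)).
suff : nbhs w [set z | A (F z)] by [].
apply/nbhs_CnP; exists r => // z /rF zr; apply: eA.
by rewrite /ball/= distrC; apply: le_lt_trans zr _; rewrite ltr_pdivrMr// ltr_pMr// ltr1n.
Qed.

Lemma open_CnP U w : open U -> U w -> exists2 r, 0 < r & forall z, enorm (z - w) < r -> U z.
Proof. by move=> oU Uw; apply/nbhs_CnP; exact: open_nbhs_nbhs. Qed.

Lemma on_line0 v w e : on_line v w e 0 = v w.
Proof. by rewrite /on_line scale0r addr0. Qed.

Lemma on_line_shift v w e (s t : R) :
  on_line v (w + s%:C *: e) e t = on_line v w e (s + t).
Proof. by rewrite /on_line rmorphD scalerDl addrA. Qed.

Lemma is_derive_on_line v w e (s d : R) :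
  der0 (on_line v (w + s%:C *: e) e) d -> is_derive s 1 (on_line v w e) d.
Proof.
move=> H; apply/is_derive_der0P.
have -> : (fun t => on_line v w e (s + t)) = on_line v (w + s%:C *: e) e.
  by apply/funext => t; rewrite on_line_shift.
exact: H.
Qed.

Lemma pderivP v w e : derivable (on_line v w e) 0 1 -> der0 (on_line v w e) (pderiv e v w).
Proof.
move=> d; apply/der0P; apply: DeriveDef; first exact: d.
by rewrite -derive1E.
Qed.

Lemma der0_pderiv v w e d : der0 (on_line v w e) d ->
  derivable (on_line v w e) 0 1 /\ pderiv e v w = d.
Proof. by move=> /der0P[d1 d2]; split; [exact: d1|rewrite /pderiv derive1E]. Qed.

Lemma der0_line_scale v w e d (c : R) : der0 (on_line v w e) d ->
  der0 (on_line v w (c%:C *: e)) (c * d).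
Proof.
move=> H eps e0; have c1 : 0 < `|c| + 1 by rewrite ltr_wpDl.
have [r r0 {}H] := H (eps / (`|c| + 1)) (divr_gt0 e0 c1).
have rc : 0 < r / (`|c| + 1) by rewrite divr_gt0.
exists (r / (`|c| + 1)) => // t; rewrite ltr_pdivlMr// => tr.
have tc : `|c * t| <= `|t| * (`|c| + 1) by rewrite normrM mulrC ler_wpM2l// lerDl.
have := H (c * t) (le_lt_trans tc tr).
have -> : on_line v w e (c * t) = on_line v w (c%:C *: e) t.
  by rewrite /on_line scalerA -rmorphM mulrC.
rewrite !on_line0 => h.
have -> : c * d * t = d * (c * t) by ring.
apply: le_trans h _; rewrite -mulrA ler_wpM2l ?(ltW e0)// mulrC ler_pdivrMr//.
Qed.

(** Move along [f] first, then along [e]. The first leg starts at w and needs only the derivative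
    there; the second starts at a moving point and needs the mean value bound and continuity of
    [De]. Iterated over coordinate directions, this yields all directional derivatives. *)
Lemma der0_line_add U v e f De Df : open U ->
  (forall w, U w -> der0 (on_line v w e) (De w)) ->
  (forall w, U w -> {for w, continuous De}) ->
  (forall w, U w -> der0 (on_line v w f) (Df w)) ->
  forall w, U w -> der0 (on_line v w (f + e)) (Df w + De w).
Proof.
move=> oU de cDe df w Uw eps e0.
have e2 : 0 < eps / 2 by rewrite divr_gt0.
have [r1 r10 h1] := df w Uw _ e2.
have /continuous_CnP/(_ _ e2)[r2 r20 h2] := cDe w Uw.
have [r3 r30 h3] := open_CnP oU Uw.
pose N := enorm f + enorm e + 1.
have N0 : 0 < N by rewrite ltr_wpDl// addr_ge0 ?enorm_ge0.
have m0 : 0 < Num.min r2 r3 by rewrite lt_min r20.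
exists (Num.min r1 (Num.min r2 r3 / N)); first by rewrite lt_min r10 divr_gt0.
move=> t; rewrite lt_min => /andP[t1]; rewrite ltr_pdivlMr// => t2.
have near s : `|s| <= `|t| -> enorm (w + t%:C *: f + s%:C *: e - w) < Num.min r2 r3.
  move=> st; apply: le_lt_trans t2; rewrite addrAC [w + _]addrC addrK.
  apply: (le_trans (ler_enormD _ _)); rewrite !enormZ !normc_real.
  have : `|s| * enorm e <= `|t| * enorm e by rewrite ler_wpM2r ?enorm_ge0.
  have := normr_ge0 t; rewrite /N; lra.
pose g := on_line v (w + t%:C *: f) e.
have := @mean_value_bound R g (fun s => De (w + t%:C *: f + s%:C *: e)) (De w) (eps / 2) t.
have -> : g t = on_line v w (f + e) t by rewrite /g /on_line scalerDr addrA.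
have -> : g 0 = on_line v w f t by rewrite /g on_line0.
move=> h; have {}h := h _ _.
have := h1 t t1; rewrite !on_line0 => h4.
have -> : on_line v w (f + e) t - v w - (Df w + De w) * t =
  (on_line v w (f + e) t - on_line v w f t - De w * t) + (on_line v w f t - v w - Df w * t) by ring.
apply: (le_trans (ler_normD _ _)).
have -> : eps * `|t| = eps / 2 * `|t| + eps / 2 * `|t| by field.
apply: lerD => //; apply: h.
  move=> s st; apply: is_derive_on_line; apply: de; apply: h3.
  by have := near s st; rewrite lt_min => /andP[].
by move=> s st; apply: h2; have := near s st; rewrite lt_min => /andP[].
Qed.

Definition coef (X : Cn R n) (i : 'I_n * bool) : R :=
  if i.2 then complex.Im (X ord0 i.1) else complex.Re (X ord0 i.1).

Lemma rdirZE (c : R) j b k :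
  (c%:C *: rdir R j b : Cn R n) ord0 k = c%:C * (if b then 'i else 1)%C * (k == j)%:R.
Proof. by rewrite /rdir scalerA mxE [delta_mx _ _ _ _]mxE eqxx. Qed.

Lemma coef_sum X : X = \sum_i (coef X i)%:C *: rdir R i.1 i.2.
Proof.
rewrite (_ : \sum_i _ = \sum_(j < n) \sum_(b : bool) (coef X (j, b))%:C *: rdir R j b); last first.
  by rewrite pair_bigA/=; apply: eq_bigr => -[].
apply/rowP => k; rewrite summxE (bigD1 k)//= [X in _ + X]big1 ?addr0; last first.
  move=> j jk; rewrite summxE.
  transitivity (\sum_b (coef X (j, b))%:C * (if b then 'i else 1)%C * (k == j)%:R).
    by apply: eq_bigr => b _; exact: rdirZE.
  by rewrite eq_sym (negbTE jk) big1// => b _; rewrite mulr0.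
rewrite summxE (eq_bigr _ (fun b _ => rdirZE (coef X (k, b)) k b k)).
rewrite big_bool/= eqxx /coef; case: (X ord0 k) => a b /=.
by apply/eqP; rewrite eq_complex/=; apply/andP; split; apply/eqP; ring.
Qed.

Definition dirD v X w : R := \sum_i coef X i * pderiv (rdir R i.1 i.2) v w.

Lemma is_Ck_continuous k U v w : is_Ck k U v -> U w -> {for w, continuous v}.
Proof. by case: k => [|k] [c _]; exact: c. Qed.

Lemma is_CkS k U v j b : is_Ck k.+1 U v ->
  (forall w, U w -> derivable (on_line v w (rdir R j b)) 0 1) /\
  is_Ck k U (pderiv (rdir R j b) v).
Proof. by move=> [_]. Qed.

Lemma der0_dirD U v X : open U -> is_Ck 1 U v ->
  forall w, U w -> der0 (on_line v w X) (dirD v X w).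
Proof.
move=> oU vC; rewrite {1}[X]coef_sum /dirD.
elim: (index_enum _) => [|i s IH] w Uw.
  rewrite !big_nil => eps e0; exists 1 => // t _.
  by rewrite /on_line !scaler0 mul0r !subrr normr0 mulr_ge0 ?(ltW e0).
rewrite !big_cons addrC [X in der0 _ X]addrC.
have [dv cv] := is_CkS i.1 i.2 vC.
apply: (@der0_line_add U v ((coef X i)%:C *: rdir R i.1 i.2) _
   (fun w => coef X i * pderiv (rdir R i.1 i.2) v w)
   (fun w => \sum_(j <- s) coef X j * pderiv (rdir R j.1 j.2) v w)) => //.
- by move=> z Uz; apply: der0_line_scale; apply: pderivP; exact: dv.
- by move=> z Uz; apply: contM_at; [exact: contC_at|exact: (is_Ck_continuous cv)].
Qed.

End Lines.

(** * Second-order expansion and the Levi form *)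

Section Taylor.
Variables (R : realType) (n : nat).
Implicit Types (w z e f X q : Cn R n) (v F : Cn R n -> R) (U : set (Cn R n)).

Lemma der0D (g h : R -> R) (d d' : R) : der0 g d -> der0 h d' ->
  der0 (fun t => g t + h t) (d + d').
Proof. by move=> /der0P G /der0P H; apply/der0P; exact: is_deriveD. Qed.

Lemma der0Z (c : R) (g : R -> R) (d : R) : der0 g d -> der0 (fun t => c * g t) (c * d).
Proof. by move=> /der0P G; apply/der0P; exact: is_deriveZ. Qed.

Lemma der0_sum (I : Type) (s : seq I) (c : I -> R) (g : I -> R -> R) (d : I -> R) :
  (forall i, der0 (g i) (d i)) ->
  der0 (fun t => \sum_(i <- s) c i * g i t) (\sum_(i <- s) c i * d i).
Proof.
move=> H; elim: s => [|i s IH].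
  by move=> e e0; exists 1 => // t _; rewrite !big_nil subrr mul0r subrr normr0 mulr_ge0 ?(ltW e0).
rewrite big_cons.
have -> : (fun t => \sum_(j <- i :: s) c j * g j t) = (fun t => c i * g i t + \sum_(j <- s) c j * g j t).
  by apply/funext => t; rewrite big_cons.
by apply: der0D => //; exact: der0Z.
Qed.

Definition pd (i : 'I_n * bool) v : Cn R n -> R := pderiv (rdir R i.1 i.2) v.

Definition hess v X w : R :=
  \sum_k coef X k * \sum_i coef X i * pd i (pd k v) w.

Lemma der0_dirD2 U v X w : open U -> is_Ck 2 U v -> U w ->
  der0 (on_line (dirD v X) w X) (hess v X w).
Proof.
move=> oU vC Uw; rewrite /on_line /dirD /hess; apply: der0_sum => k.
have [_ ck] := is_CkS k.1 k.2 vC.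
exact: (der0_dirD X oU ck).
Qed.

Lemma hess_continuous U v X w : is_Ck 2 U v -> U w -> {for w, continuous (hess v X)}.
Proof.
move=> vC Uw; apply: cont_sum_at => k; apply: contM_at; first exact: contC_at.
apply: cont_sum_at => i; apply: contM_at; first exact: contC_at.
have [_ ck] := is_CkS k.1 k.2 vC; have [_ ci] := is_CkS i.1 i.2 ck.
exact: (is_Ck_continuous ci).
Qed.

(** Averaging the real Hessian over X and iX keeps only its part of type (1,1); estimates along real
    lines thereby become estimates of the Levi form. *)
Lemma levi_hess v z X : levi v z X = 4^-1 * (hess v X z + hess v ('i%C *: X) z).
Proof.
have [F FE] : exists F : 'I_n -> 'I_n -> bool -> bool -> R,
    forall j k a b, pd (j, a) (pd (k, b) v) z = F j k a b by eexists.
have hE Y : hess v Y z = \sum_k \sum_j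
   (complex.Re (Y ord0 k) * complex.Re (Y ord0 j) * F j k false false
  + complex.Re (Y ord0 k) * complex.Im (Y ord0 j) * F j k true false
  + complex.Im (Y ord0 k) * complex.Re (Y ord0 j) * F j k false true
  + complex.Im (Y ord0 k) * complex.Im (Y ord0 j) * F j k true true).
  rewrite /hess.
  transitivity (\sum_(k < n) \sum_(b : bool) coef Y (k, b) * \sum_i coef Y i * pd i (pd (k, b) v) z).
    by rewrite pair_bigA/=; apply: eq_bigr => -[].
  have iE k b : \sum_i coef Y i * pd i (pd (k, b) v) z =
     \sum_(j < n) (coef Y (j, true) * F j k true b + coef Y (j, false) * F j k false b).
    transitivity (\sum_(j < n) \sum_(a : bool) coef Y (j, a) * F j k a b).
      by rewrite pair_bigA/=; apply: eq_bigr => -[j a] _; rewrite FE.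
    by apply: eq_bigr => j _; rewrite big_bool.
  apply: eq_bigr => k _.
  transitivity (\sum_(b : bool) coef Y (k, b) *
     \sum_(j < n) (coef Y (j, true) * F j k true b + coef Y (j, false) * F j k false b)).
    by apply: eq_bigr => b _; rewrite iE.
  rewrite big_bool /= 2!mulr_sumr -big_split /=; apply: eq_bigr => j _.
  by rewrite /coef/=; ring.
rewrite /levi exchange_big/= raddf_sum !hE -big_split mulr_sumr; apply: eq_bigr => k _.
rewrite raddf_sum -big_split mulr_sumr; apply: eq_bigr => j _ /=.
have d2E : d2_z_zbar v j k z = (4^-1 * (F j k false false + F j k true true)) +i*
    (4^-1 * (F j k false true - F j k true false)) by rewrite -!FE.
rewrite d2E !mxE.
case: (X ord0 k) => a b; case: (X ord0 j) => c d /=.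
by field.
Qed.

Lemma coef_le X i : `|coef X i| <= enorm X.
Proof.
rewrite /coef; case: ifP => _; apply: le_trans (normc_le_enorm X i.1).
  exact: Im_le_normc.
exact: Re_le_normc.
Qed.

Lemma is_Ck_pred k U v : is_Ck k.+1 U v -> is_Ck k U v.
Proof.
elim: k v => [|k IH] v vC; first by split=> [w|//]; exact: (is_Ck_continuous vC).
split=> [w|j b]; first exact: (is_Ck_continuous vC).
by have [d c] := is_CkS j b vC; split; [exact: d|exact: IH].
Qed.

Lemma der0_min (g : R -> R) (d r : R) : der0 g d -> g 0 = 0 -> 0 < r ->
  (forall t, `|t| < r -> 0 <= g t) -> d = 0.
Proof.
move=> H g0 r0 gr; apply/eqP; apply/negPn/negP => d0.
have dp : 0 < `|d| / 2 by rewrite divr_gt0 ?normr_gt0.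
have [r1 r10 h1] := H _ dp.
pose s := Num.min r r1 / 2.
have s0 : 0 < s by rewrite divr_gt0// lt_min r0.
have sl : s < Num.min r r1 by rewrite /s ltr_pdivrMr// ltr_pMr ?lt_min ?r0// ltr1n.
have tn : `|- Num.sg d * s| = s by rewrite normrM normrN normr_sg d0 mul1r gtr0_norm.
move: sl; rewrite lt_min => /andP[sr sr1].
have := gr (- Num.sg d * s); have := h1 (- Num.sg d * s); rewrite tn g0 subr0 => /(_ sr1) + /(_ sr).
have -> : d * (- Num.sg d * s) = - (`|d| * s) by rewrite normrEsg; ring.
rewrite ler_norml => /andP[_].
have : 0 < `|d| * s by rewrite mulr_gt0 ?normr_gt0.
lra.
Qed.

(** There is no linear term because q is a minimum of v. *)
Lemma taylor_line U v q X (c e t : R) : open U -> is_Ck 2 U v -> 0 <= e ->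
  v q = 0 -> (forall w, U w -> 0 <= v w) ->
  (forall s : R, `|s| <= `|t| -> U (q + s%:C *: X)) ->
  (forall s : R, `|s| <= `|t| -> `|hess v X (q + s%:C *: X) - c| <= e) ->
  `|v (q + t%:C *: X) - c / 2 * t ^+ 2| <= e * t ^+ 2.
Proof.
move=> oU vC e0 vq v0 Us hs.
have Uq : U q by have := Us 0; rewrite normr0 normr_ge0 scale0r addr0; exact.
have vC1 : is_Ck 1 U v by exact: is_Ck_pred.
have D1 w : U w -> der0 (on_line v w X) (dirD v X w) by exact: der0_dirD.
have D0 : dirD v X q = 0.
  have [r r0 rU] := open_CnP oU Uq.
  have e1 : 0 < enorm X + 1 by rewrite ltr_wpDl ?enorm_ge0.
  apply: (@der0_min (on_line v q X) _ (r / (enorm X + 1))).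
  - exact: D1.
  - by rewrite on_line0.
  - by rewrite divr_gt0.
  move=> s; rewrite ltr_pdivlMr// => sr; apply: v0; apply: rU.
  rewrite addrAC subrr add0r enormZ normc_real; apply: le_lt_trans sr.
  by rewrite ler_wpM2l// lerDl.
have := @double_mean_value R (on_line v q X) (fun s => dirD v X (q + s%:C *: X))
  (fun s => hess v X (q + s%:C *: X)) c e t e0.
rewrite on_line0 vq scale0r addr0 D0; apply; [by []|by []| | |exact: hs].
- by move=> s st; apply: is_derive_on_line; apply: D1; exact: Us.
- move=> s st.
  have := @is_derive_on_line R n (dirD v X) q X s (hess v X (q + s%:C *: X)); apply.
  by apply: (der0_dirD2 X oU vC); exact: Us.
Qed.

Lemma hess_le v X w : `|hess v X w| <= (\sum_k \sum_i `|pd i (pd k v) w|) * enorm X ^+ 2.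
Proof.
rewrite /hess mulr_suml; apply: (le_trans (ler_norm_sum _ _ _)).
apply: ler_sum => k _; rewrite normrM mulr_suml.
have -> : \sum_i `|pd i (pd k v) w| * enorm X ^+ 2 = enorm X * \sum_i enorm X * `|pd i (pd k v) w|.
  by rewrite mulr_sumr; apply: eq_bigr => i _; ring.
apply: ler_pM => //; first exact: coef_le.
apply: (le_trans (ler_norm_sum _ _ _)); apply: ler_sum => i _.
by rewrite normrM ler_wpM2r//; exact: coef_le.
Qed.

(** Source of the logarithmic pole in [sibony_green]. *)
Lemma C2_quadratic_bound U v q : open U -> is_Ck 2 U v -> U q -> v q = 0 ->
  (forall w, U w -> 0 <= v w) ->
  exists r K : R, [/\ 0 < r, 0 <= K & forall w, enorm (w - q) < r -> U w /\ v w <= K * enorm (w - q) ^+ 2].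
Proof.
move=> oU vC Uq vq v0.
pose P w := \sum_k \sum_i `|pd i (pd k v) w|.
have P0 w : 0 <= P w by apply: sumr_ge0 => k _; apply: sumr_ge0 => i _.
have cP : {for q, continuous P}.
  apply: cont_sum_at => k; apply: cont_sum_at => i.
  have [_ ck] := is_CkS k.1 k.2 vC; have [_ ci] := is_CkS i.1 i.2 ck.
  have c0 : {for q, continuous (pd i (pd k v))} by exact: (is_Ck_continuous ci).
  apply: (@continuous_comp (Cn R n) R R (pd i (pd k v)) (@Num.norm R R)); first exact: c0.
  exact: norm_continuous.
have [r1 r10 h1] := open_CnP oU Uq.
have /continuous_CnP/(_ _ ltr01)[r2 r20 h2] := cP.
exists (Num.min r1 r2), (P q + 1); split; first by rewrite lt_min r10.
  by rewrite addr_ge0.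
move=> w; rewrite lt_min => /andP[w1 w2]; split; first exact: h1.
have near (s : R) : `|s| <= `|1 : R| -> enorm (q + s%:C *: (w - q) - q) <= enorm (w - q).
  move=> s1; rewrite addrAC subrr add0r enormZ normc_real ler_piMl ?enorm_ge0//.
  by rewrite normr1 in s1.
have := @taylor_line U v q (w - q) 0 ((P q + 1) * enorm (w - q) ^+ 2) 1 oU vC _ vq v0 _ _.
have -> : q + 1%:C *: (w - q) = w by rewrite scale1r addrC subrK.
rewrite mul0r mul0r subr0 expr1n mulr1 => H.
apply: (le_trans (ler_norm _)); apply: H.
- by rewrite mulr_ge0 ?sqr_ge0 ?addr_ge0.
- by move=> s s1; apply: h1; apply: le_lt_trans (near s s1) _.
- move=> s s1; rewrite subr0; apply: (le_trans (hess_le _ _ _)).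
  rewrite ler_wpM2r ?sqr_ge0//.
  have := h2 _ (le_lt_trans (near s s1) w2); rewrite ler_norml => /andP[_ h3].
  by rewrite -lerBlDl; exact: h3.
Qed.

(** The only access to the Levi form, used in both directions: to find points where v is large from
    its value, and to bound it below from lower bounds of v. *)
Lemma levi_limit U v q X : open U -> is_Ck 2 U v -> U q -> v q = 0 ->
  (forall w, U w -> 0 <= v w) ->
  forall eps, 0 < eps -> exists2 d, 0 < d & forall t : R, `|t| < d ->
  `|v (q + t%:C *: X) + v (q + t%:C *: ('i%C *: X)) - 2 * levi v q X * t ^+ 2| <= eps * t ^+ 2.
Proof.
move=> oU vC Uq vq v0.
have one (Y : Cn R n) (e : R) : 0 < e -> exists2 d, 0 < d & forall t : R, `|t| < d ->
    `|v (q + t%:C *: Y) - hess v Y q / 2 * t ^+ 2| <= e * t ^+ 2.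
  move=> e0; have [r1 r10 h1] := open_CnP oU Uq.
  have /continuous_CnP/(_ _ e0)[r2 r20 h2] := @hess_continuous U v Y q vC Uq.
  have e1 : 0 < enorm Y + 1 by rewrite ltr_wpDl ?enorm_ge0.
  exists (Num.min r1 r2 / (enorm Y + 1)); first by rewrite divr_gt0// lt_min r10.
  move=> t; rewrite ltr_pdivlMr// => tr.
  have near (s : R) : `|s| <= `|t| -> enorm (q + s%:C *: Y - q) < Num.min r1 r2.
    move=> st; apply: le_lt_trans tr; rewrite addrAC subrr add0r enormZ normc_real.
    by apply: ler_pM => //; [exact: enorm_ge0|rewrite lerDl].
  apply: (@taylor_line U v q Y (hess v Y q) e t oU vC (ltW e0) vq v0) => s st.
    by apply: h1; have := near s st; rewrite lt_min => /andP[].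
  by apply: h2; have := near s st; rewrite lt_min => /andP[].
move=> eps e0; have e2 : 0 < eps / 2 by rewrite divr_gt0.
have [d1 d10 h1] := one X _ e2; have [d2 d20 h2] := one ('i%C *: X) _ e2.
exists (Num.min d1 d2); first by rewrite lt_min d10.
move=> t; rewrite lt_min => /andP[/h1 t1 /h2 t2].
rewrite levi_hess.
have -> : forall a b c d t2 : R, a + b - 2 * (4^-1 * (c + d)) * t2 = (a - c / 2 * t2) + (b - d / 2 * t2).
  by move=> a b c d s; field.
apply: (le_trans (ler_normD _ _)).
have -> : eps * t ^+ 2 = eps / 2 * t ^+ 2 + eps / 2 * t ^+ 2 by field.
exact: lerD.
Qed.

End Taylor.

(** * Stability of class C^k under the operations used *)

Section ClassCk.
Variables (R : realType) (n : nat) (U : set (Cn R n)).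
Hypothesis oU : open U.
Implicit Types (w z e : Cn R n) (u v : Cn R n -> R).

Lemma der0_ext (g h : R -> R) (d r : R) : 0 < r -> (forall t, `|t| < r -> g t = h t) ->
  der0 g d -> der0 h d.
Proof.
move=> r0 gh H e e0; have [r1 r10 h1] := H e e0.
exists (Num.min r r1); first by rewrite lt_min r0.
by move=> t; rewrite lt_min => /andP[tr tr1]; rewrite -!gh ?normr0//; exact: h1.
Qed.

Lemma der0_line_ext u v w e (d : R) : (forall z, U z -> u z = v z) -> U w ->
  der0 (on_line u w e) d -> der0 (on_line v w e) d.
Proof.
move=> uv Uw; have [r r0 rU] := open_CnP oU Uw.
have e1 : 0 < enorm e + 1 by rewrite ltr_wpDl ?enorm_ge0.
apply: (@der0_ext _ _ _ (r / (enorm e + 1))); first by rewrite divr_gt0.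
move=> t; rewrite ltr_pdivlMr// => tr; apply: uv; apply: rU.
rewrite addrAC subrr add0r enormZ normc_real; apply: le_lt_trans tr.
by rewrite ler_wpM2l// lerDl.
Qed.

Lemma cont_ext_at u v w : (forall z, U z -> u z = v z) -> U w ->
  {for w, continuous u} -> {for w, continuous v}.
Proof.
move=> uv Uw /continuous_CnP cu; apply/continuous_CnP => eps /cu[r r0 H].
have [r1 r10 rU] := open_CnP oU Uw.
exists (Num.min r r1); first by rewrite lt_min r0.
move=> z; rewrite lt_min => /andP[zr zr1]; rewrite -!uv//; last exact: rU.
exact: H.
Qed.

Lemma is_Ck_ext k u v : (forall z, U z -> u z = v z) -> is_Ck k U u -> is_Ck k U v.
Proof.
elim: k u v => [|k IH] u v uv uC.
  by split=> [w Uw|//]; apply: (cont_ext_at uv Uw); exact: (is_Ck_continuous uC).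
split=> [w Uw|j b].
  by apply: (cont_ext_at uv Uw); exact: (is_Ck_continuous uC).
have [du cu] := is_CkS j b uC.
have D w : U w -> derivable (on_line v w (rdir R j b)) 0 1 /\
    pderiv (rdir R j b) v w = pderiv (rdir R j b) u w.
  move=> Uw; apply: der0_pderiv; apply: (der0_line_ext uv Uw).
  by apply: pderivP; exact: du.
split=> [w /D[]//|]; apply: IH cu => w /D[_ ->]//.
Qed.

(** Only the values of [pderiv] on the open set U matter, so a closed form [D] of the derivative may
    replace it. *)
Lemma is_Ck_intro k v : (forall w, U w -> {for w, continuous v}) ->
  (forall j b, exists2 D, (forall w, U w -> der0 (on_line v w (rdir R j b)) (D w)) & is_Ck k U D) ->
  is_Ck k.+1 U v.
Proof.
move=> cv H; split=> // j b; have [D dD cD] := H j b.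
split=> [w /dD/der0_pderiv[]//|]; apply: is_Ck_ext cD => w /dD/der0_pderiv[_ ->]//.
Qed.

Lemma is_Ck_cst k (c : R) : is_Ck k U (fun=> c).
Proof.
elim: k c => [|k IH] c; first by split=> // w _; exact: contC_at.
apply: is_Ck_intro => [w _|j b]; first exact: contC_at.
exists (fun=> 0); last exact: IH.
by move=> w _ eps e0; exists 1 => // t _; rewrite /on_line subrr mul0r subrr normr0 mulr_ge0// ltW.
Qed.

Lemma is_Ck_add k u v : is_Ck k U u -> is_Ck k U v -> is_Ck k U (fun w => u w + v w).
Proof.
elim: k u v => [|k IH] u v uC vC.
  by split=> // w Uw; apply: contD_at; [exact: (is_Ck_continuous uC)|exact: (is_Ck_continuous vC)].
apply: is_Ck_intro => [w Uw|j b].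
  by apply: contD_at; [exact: (is_Ck_continuous uC)|exact: (is_Ck_continuous vC)].
have [du cu] := is_CkS j b uC; have [dv cv] := is_CkS j b vC.
exists (fun w => pderiv (rdir R j b) u w + pderiv (rdir R j b) v w); last exact: IH.
by move=> w Uw; apply: der0D; apply: pderivP; [exact: du|exact: dv].
Qed.

Lemma der0M (g h : R -> R) (d d' : R) : der0 g d -> der0 h d' ->
  der0 (fun t => g t * h t) (d * h 0 + g 0 * d').
Proof.
move=> /der0P G /der0P H; apply/der0P; rewrite (_ : (fun t => _) = g * h)//.
by apply: is_derive_eq; rewrite /GRing.scale/= addrC mulrC [X in X + _ = _]mulrC mulrC; ring.
Qed.

(** The derivative is written with products only, so that [is_Ck_mul] applies to it in the induction
    of [is_Ck_inv]. *)
Lemma der0V (g : R -> R) (d : R) : g 0 != 0 -> der0 g d ->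
  der0 (fun t => (g t)^-1) (- 1 * (d * ((g 0)^-1 * (g 0)^-1))).
Proof.
move=> g0 /der0P G; apply/der0P.
have := @realfun.is_deriveV R g 0 d 1 g0 G; rewrite /GRing.scale/=.
rewrite (_ : - (g 0) ^- 2 * d = - 1 * (d * ((g 0)^-1 * (g 0)^-1)))//; first by field.
Qed.

Lemma is_Ck_mul k u v : is_Ck k U u -> is_Ck k U v -> is_Ck k U (fun w => u w * v w).
Proof.
elim: k u v => [|k IH] u v uC vC.
  by split=> // w Uw; apply: contM_at; [exact: (is_Ck_continuous uC)|exact: (is_Ck_continuous vC)].
apply: is_Ck_intro => [w Uw|j b].
  by apply: contM_at; [exact: (is_Ck_continuous uC)|exact: (is_Ck_continuous vC)].
have [du cu] := is_CkS j b uC; have [dv cv] := is_CkS j b vC.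
exists (fun w => pderiv (rdir R j b) u w * v w + u w * pderiv (rdir R j b) v w).
  move=> w Uw; have := @der0M (on_line u w (rdir R j b)) (on_line v w (rdir R j b)) _ _
    (pderivP (du w Uw)) (pderivP (dv w Uw)).
  by rewrite !on_line0.
apply: is_Ck_add; apply: IH => //; exact: is_Ck_pred.
Qed.

Lemma is_Ck_inv k v : (forall w, U w -> v w != 0) -> is_Ck k U v ->
  is_Ck k U (fun w => (v w)^-1).
Proof.
move=> v0; elim: k => [|k IH] vC.
  by split=> // w Uw; apply: contV_at; [exact: v0|exact: (is_Ck_continuous vC)].
apply: is_Ck_intro => [w Uw|j b].
  by apply: contV_at; [exact: v0|exact: (is_Ck_continuous vC)].
have [dv cv] := is_CkS j b vC.
exists (fun w => - 1 * (pderiv (rdir R j b) v w * ((v w)^-1 * (v w)^-1))).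
  move=> w Uw; have := @der0V (on_line v w (rdir R j b)) _ _ (pderivP (dv w Uw)).
  by rewrite !on_line0; apply; exact: v0.
have iC := IH (is_Ck_pred vC).
by apply: is_Ck_mul; [exact: is_Ck_cst|apply: is_Ck_mul => //; exact: is_Ck_mul].
Qed.

Lemma is_Ck_sum k (I : Type) (s : seq I) (F : I -> Cn R n -> R) :
  (forall i, is_Ck k U (F i)) -> is_Ck k U (fun w => \sum_(i <- s) F i w).
Proof.
move=> H; elim: s => [|i s IH].
  by rewrite (_ : (fun w => _) = fun=> 0); [exact: is_Ck_cst|apply/funext => w; rewrite big_nil].
rewrite (_ : (fun w => _) = fun w => F i w + \sum_(j <- s) F j w); first exact: is_Ck_add.
by apply/funext => w; rewrite big_cons.
Qed.

Lemma is_Ck_lin k (phi : Cn R n -> R) (K : R) :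
  (forall z w, `|phi z - phi w| <= K * enorm (z - w)) ->
  (forall w e (t : R), phi (w + t%:C *: e) = phi w + t * phi e) -> is_Ck k U phi.
Proof.
move=> lip lin.
have cphi w : {for w, continuous phi}.
  apply/continuous_CnP => eps e0; have K1 : 0 < `|K| + 1 by rewrite ltr_wpDl.
  exists (eps / (`|K| + 1)); first by rewrite divr_gt0.
  move=> z; rewrite ltr_pdivlMr// => zw; apply: (le_trans (lip _ _)).
  apply: le_trans (ltW zw); rewrite mulrC ler_wpM2l ?enorm_ge0//.
  by apply: le_trans (ler_norm _) _; rewrite lerDl.
case: k => [|k]; first by split.
apply: is_Ck_intro => // j b; exists (fun=> phi (rdir R j b)); last exact: is_Ck_cst.
move=> w _ eps e0; exists 1 => // t _.
rewrite on_line0 /on_line lin.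
have -> : phi w + t * phi (rdir R j b) - phi w - phi (rdir R j b) * t = 0 by ring.
by rewrite normr0 mulr_ge0// ltW.
Qed.

Lemma is_Ck_normc_sqr k j (q : Cn R n) (a : Cplx R) :
  is_Ck k U (fun z => normc ((z - q) ord0 j + a) ^+ 2).
Proof.
have cRe : is_Ck k U (fun z => complex.Re (z ord0 j)).
  apply: (@is_Ck_lin _ _ 1) => [z w|w e t].
    rewrite mul1r; apply: le_trans (normc_le_enorm (z - w) j).
    by apply: le_trans (Re_le_normc _); rewrite !mxE; case: (z _ _) (w _ _) => ? ? [].
  by rewrite !mxE; case: (w _ _) (e _ _) => a1 b1 [a2 b2] /=; ring.
have cIm : is_Ck k U (fun z => complex.Im (z ord0 j)).
  apply: (@is_Ck_lin _ _ 1) => [z w|w e t].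
    rewrite mul1r; apply: le_trans (normc_le_enorm (z - w) j).
    by apply: le_trans (Im_le_normc _); rewrite !mxE; case: (z _ _) (w _ _) => ? ? [].
  by rewrite !mxE; case: (w _ _) (e _ _) => a1 b1 [a2 b2] /=; ring.
pose c := a - q ord0 j.
have c1 : is_Ck k U (fun z => complex.Re (z ord0 j) + complex.Re c) by apply: is_Ck_add => //; exact: is_Ck_cst.
have c2 : is_Ck k U (fun z => complex.Im (z ord0 j) + complex.Im c) by apply: is_Ck_add => //; exact: is_Ck_cst.
apply: (is_Ck_ext _ (is_Ck_add (is_Ck_mul c1 c1) (is_Ck_mul c2 c2))) => z _.
rewrite normc_sqr /c !mxE; clear c1 c2 c; case: (z _ _) (q _ _) a => a1 b1 [a2 b2] [a3 b3] /=; ring.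
Qed.

End ClassCk.

(** * The Green function on discs *)

Section Schwarz.
Variables (R : realType) (n : nat).
Implicit Types (z a b X Y q : Cn R n) (D : set (Cn R n)).
Local Notation mu := (@lebesgue_measure R).

(** Supplies the measurability of u along circles. *)
Lemma psh_circle_lsc D (u : Cn R n -> \bar R) a b : psh D u ->
  (forall t, D (a + circ t *: b)) ->
  lower_semicontinuous (fun t : R => (- u (a + circ t *: b)%R)%E).
Proof.
move=> [_ usc _] Dc x r ur0.
have ur : (u (a + circ x *: b)%R < (- r)%:E)%E by rewrite EFinN lteNr; exact: ur0.
have /(nbhs_CnP (a + circ x *: b))[e e0 H] := usc _ (Dc x) _ ur.
have cc : continuous (fun t => a + circ t *: b).
  move=> t; apply: (@continuous_comp R (Cplx R) (Cn R n) (@circ R) (fun l => a + l *: b)).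
    exact: continuous_circ.
  exact: continuous_line.
exists [set t | enorm (a + circ t *: b - (a + circ x *: b)) < e].
  have : nbhs (a + circ x *: b) [set w | enorm (w - (a + circ x *: b)) < e].
    by apply/nbhs_CnP; exists e.
  by move=> /(cc x).
by move=> t /H ut; rewrite lteNr -(EFinN r).
Qed.

(** As u may take the value -oo, the comparison is made between nonnegative functions: -u is at
    least -F and at least 0, hence at least the positive part of -F. *)
Lemma psh_mean_le D (u : Cn R n -> \bar R) a b (F : R -> R) : psh D u ->
  (forall z, D z -> (u z < 0)%E) ->
  (forall l : Cplx R, normc l <= 1 -> D (a + l *: b)) ->
  continuous F -> (forall t, (u (a + circ t *: b)%R <= (F t)%:E)%E) ->
  (u a <= (cmean F)%:E)%E.
Proof.
move=> pu; have [_ usc sub] := pu; move=> u0 disc cF uF; have p0 := twopi_gt0 R.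
have Dc t : D (a + circ t *: b) by apply: disc; rewrite circ_norm.
have := sub a b; have h : forall l : Cplx R, `|l| <= 1 -> D (a + l *: b).
  by move=> l; rewrite ler_norm_disc; exact: disc.
move=> /(_ h) /le_trans; apply.
pose g t : \bar R := (- u (a + circ t *: b)%R)%E.
have g0 t : (0 <= g t)%E by rewrite oppe_ge0 ltW// u0.
have lg : lower_semicontinuous g := psh_circle_lsc pu Dc.
have mg : measurable_fun setT g := lower_semicontinuous_measurable lg.
have cmF : continuous (fun t => Num.max (- F t) 0).
  by apply: continuous_max0 => t; apply: cvgN; exact: cF.
have I1 : ((2 * pi * - cmean F)%:E <= \int[mu]_(t in [set` `[0%R, (2 * pi)%R]]) g t)%E.
  apply: (@le_trans _ _ (\int[mu]_(t in [set` `[0%R, (2 * pi)%R]]) (Num.max (- F t) 0)%:E)%E).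
    rewrite integral_cmean// lee_fin ler_pM2l//.
    have -> : - cmean F = cmean (fun t => (-1) * F t) by rewrite cmeanZ// mulN1r.
    apply: le_cmean => //; first exact: continuous_scale_fun.
    by move=> t; rewrite mulN1r le_max lexx.
  apply: ge0_le_integral => //.
  - by move=> t _; rewrite lee_fin le_max lexx orbT.
  - by apply/measurable_EFinP; apply: measurable_funTS; exact: continuous_measurable_fun.
  - exact: measurable_funTS.
  - move=> t _; rewrite EFin_max ge_max g0 andbT EFinN leeN2; exact: uF.
have -> : (\int[mu]_(t in [set` `[0%R, (2 * pi)%R]]) u (a + (cos t +i* sin t) *: b)%R =
   - \int[mu]_(t in [set` `[0%R, (2 * pi)%R]]) g t)%E.
  rewrite -integral_ge0N; last by move=> t _; exact: g0.
  by apply: eq_integral => t _; rewrite /g oppeK.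
rewrite -(@lee_pmul2l _ (2 * pi)%:E) ?lte_fin// muleA -(EFinM (2 * pi) (2 * pi)^-1).
rewrite mulfV ?gt_eqF// mul1e leeNl -EFinM -EFinN -mulrN; exact: I1.
Qed.

Lemma cmean_normc_sqrC (z : Cplx R) (s : R) :
  cmean (fun t => normc (z + s%:C * circ t) ^+ 2) = normc z ^+ 2 + s ^+ 2.
Proof.
case: z => x y.
transitivity (cmean (fun t => (x ^+ 2 + y ^+ 2 + s ^+ 2) +
   ((2 * x * s) * cos t + (2 * y * s) * sin t + (0 * cos (2 * t) + 0 * sin (2 * t))))).
  apply: eq_cmean => t; rewrite normc_sqr /circ/=.
  transitivity (x ^+ 2 + y ^+ 2 + s ^+ 2 * (cos t ^+ 2 + sin t ^+ 2)
     + ((2 * x * s) * cos t + (2 * y * s) * sin t)); first by ring.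
  by rewrite cos2Dsin2; ring.
rewrite cmeanD ?cmean_trig ?addr0 ?cmean_cst ?normc_sqr//; first exact: cst_continuous.
have cc := @continuous_cos R; have cs := @continuous_sin R.
by do 2?apply: continuous_sum_fun; apply: continuous_scale_fun => //; exact: continuous_dil_fun.
Qed.

End Schwarz.

Lemma cubic_gt0 (R : realFieldType) (A : R) : 0 < A -> 0 < 240 * A ^+ 3 + 3 * A ^+ 2.
Proof. by move=> A0; apply: addr_gt0; (apply: mulr_gt0; [rewrite ltr0n|exact: exprn_gt0]). Qed.

Lemma cubic_ge0 (R : realFieldType) (A : R) : 0 <= A -> 0 <= 240 * A ^+ 3 + 3 * A ^+ 2.
Proof. by move=> A0; apply: addr_ge0; (apply: mulr_ge0; [rewrite ler0n|exact: exprn_ge0]). Qed.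

(** * A Schwarz lemma for competitors of the Green function *)

Section GreenSchwarz.
Variables (R : realType) (n : nat).
Implicit Types (z a b X Y q : Cn R n) (D : set (Cn R n)).

(** Factor out z: what remains is half the logarithm treated by [mean_ln], with al = 1 / z and be =
    0. *)
Lemma cmean_ln_shift_le (A s : R) (z : Cplx R) : 0 < A -> 0 < s -> s <= 1 -> 16 * A * s <= 1 ->
  A^-1 <= normc z ->
  continuous (fun t => ln (normc (z + s%:C * circ t))) /\
  cmean (fun t => ln (normc (z + s%:C * circ t))) <=
    ln (normc z) + (240 * A ^+ 3 + 3 * A ^+ 2) * s ^+ 3.
Proof.
move=> A0 s0 s1 As Az.
have z0 : 0 < normc z by apply: lt_le_trans Az; rewrite invr_gt0.
have zn0 : z != 0 by rewrite -normc_eq0 gt_eqF.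
have al : normc z^-1 <= A by rewrite normcV -[leRHS]invrK lef_pV2 ?posrE ?invr_gt0.
have be : normc (0 : Cplx R) <= A by rewrite normc0 ltW.
have m := mean_ln (ltW A0) s0 s1 As al be.
have c := continuous_ln_quad (ltW A0) s0 s1 As al be.
pose h (t : R) := ln (normc (1 + z^-1 * (s%:C * circ t) + 0 * (s%:C * circ t) ^+ 2) ^+ 2).
have E : (fun t => ln (normc (z + s%:C * circ t))) = (fun t => ln (normc z) + 2^-1 * h t).
  apply/funext => t; rewrite /h mul0r addr0.
  have -> : z + s%:C * circ t = z * (1 + z^-1 * (s%:C * circ t)).
    by rewrite mulrDr mulr1 mulrA mulfV// mul1r.
  have w0 : 0 < normc (1 + z^-1 * (s%:C * circ t)).
    rewrite lt0r normc_ge0 andbT normc_eq0; apply/eqP => w0.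
    have : normc (1 : Cplx R) <= A * s.
      have -> : 1 = - (z^-1 * (s%:C * circ t)) :> Cplx R.
        by apply/eqP; rewrite -subr_eq0 opprK; apply/eqP.
      rewrite normc_opp (normcM z^-1) normcM circ_norm mulr1 normc_real gtr0_norm//.
      by rewrite ler_pM2r.
    by rewrite normc1; have := mulr_ge0 (ltW A0) (ltW s0); lra.
  by rewrite (normcM z) lnM ?posrE// lnXn// mulr2n; field.
rewrite E; split.
  by apply: continuous_sum_fun; [exact: cst_continuous|apply: continuous_scale_fun; exact: c].
rewrite cmeanD; [|exact: cst_continuous|by apply: continuous_scale_fun; exact: c].
rewrite cmean_cst cmeanZ; last exact: c.
rewrite lerD2l; move: m; rewrite ler_norml => /andP[m1 m2].
by rewrite /h; lra.
Qed.

(* Maximum principle by descent: an upper bound S for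
   u - (1 - eta) ln |l| + eps |l|^2 can be lowered by a fixed amount as long as
   S > 2 eps, since the quadratic term gains eps s^2 in the mean over circles of
   radius s. *)
Lemma green_schwarz D (u : Cn R n -> \bar R) q Y : green_class D q u ->
  0 < enorm Y -> (forall l : Cplx R, normc l <= 1 -> D (q + l *: Y)) ->
  forall l : Cplx R, 0 < normc l -> normc l <= 1 ->
  (u (q + l *: Y)%R <= (ln (normc l))%:E)%E.
Proof.
move=> [pu u0 [C uC]] Y0 disc l0 l00 l01.
pose C' := C + ln (enorm Y).
have near0 (l : Cplx R) : 0 < normc l -> normc l <= 1 ->
    (u (q + l *: Y)%R <= (ln (normc l) + C')%:E)%E.
  move=> lp l1; have := uC (q + l *: Y) (disc l l1).
  have -> : q + l *: Y - q = l *: Y by rewrite addrAC subrr add0r.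
  rewrite enormZ lnM ?posrE// => H.
  have -> : ln (normc l) + C' = ln (normc l) + ln (enorm Y) + C by rewrite /C'; ring.
  apply: ltW; apply: H.
  apply/eqP => /(congr1 (fun z => z - q)).
  rewrite addrAC subrr add0r => /eqP; rewrite -enorm_eq0 enormZ mulf_eq0 !gt_eqF//.
have key (eps eta : R) : 0 < eps -> 0 < eta -> eta < 1 ->
    forall l : Cplx R, 0 < normc l -> normc l <= 1 ->
    (u (q + l *: Y)%R <= (2 * eps + (1 - eta) * ln (normc l) - eps * normc l ^+ 2)%:E)%E.
  move=> e0 h0 h1.
  (* [4^-1] keeps the radii below 1. The exponential makes the logarithmic bound win for |l| <= kap.
     The last bound gives ln |l| >= - eps for |l| >= 1 - kap, where u < 0 then suffices as soon as S
     >= 2 eps. *)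
  pose kap := Num.min 4^-1 (Num.min (expR (- ((`|C'| + eps) / eta))) (1 - expR (- eps))).
  have kap0 : 0 < kap.
    by rewrite !lt_min invr_gt0 ltr0n expR_gt0 subr_gt0/= -[ltRHS]expR0 ltr_expR oppr_lt0.
  have : kap <= kap by []. 
  rewrite {2}/kap !le_min => /andP[k1 /andP[k2 k3]].
  have lnk : eta * ln kap + C' + eps <= 0.
    have : ln kap <= - ((`|C'| + eps) / eta) by rewrite -ler_expR lnK.
    rewrite lerNr ler_pdivrMr// => h2.
    have := ler_norm C'; lra.
  pose P S := forall l : Cplx R, 0 < normc l -> normc l <= 1 ->
    (u (q + l *: Y)%R <= (S + (1 - eta) * ln (normc l) - eps * normc l ^+ 2)%:E)%E.
  have sq1 (l : Cplx R) : normc l <= 1 -> eps * normc l ^+ 2 <= eps.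
    by move=> l1; rewrite ler_piMr ?(ltW e0)// expr_le1 ?normc_ge0.
  (* Near the pole the logarithmic bound on [u] wins, whatever [S >= 0] is. *)
  have small S (l : Cplx R) : 0 <= S -> 0 < normc l -> normc l <= kap ->
      (u (q + l *: Y)%R <= (S + (1 - eta) * ln (normc l) - eps * normc l ^+ 2)%:E)%E.
    move=> S0 lp lk; have l1 : normc l <= 1 by lra.
    apply: le_trans (near0 l lp l1) _; rewrite lee_fin.
    have : eta * ln (normc l) <= eta * ln kap by rewrite ler_pM2l// ler_ln ?posrE.
    have := sq1 l l1; lra.
  pose A := kap^-1.
  have A0 : 0 < A by rewrite invr_gt0.
  pose K := 240 * A ^+ 3 + 3 * A ^+ 2.
  have K0 : 0 < K by exact: cubic_gt0.
  (* [kap / 16] gives 16 A s <= 1 and keeps circles centred in kap < |l| < 1 - kap inside the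
     punctured disc; the other bound gives K s^3 <= (eps / 2) s^2, leaving the net gain [c]. *)
  pose s := Num.min (kap / 16) (eps / (2 * K)).
  have s0 : 0 < s by rewrite lt_min !divr_gt0 ?mulr_gt0.
  have : s <= s by [].
  rewrite {2}/s le_min => /andP[s1 s2].
  have s3 : s <= 1 by lra.
  have s4 : 16 * A * s <= 1.
    have : s * A <= 16^-1 by rewrite ler_pdivrMr// mulrC.
    lra.
  have s5 : K * s ^+ 3 <= eps / 2 * s ^+ 2.
    rewrite exprS mulrA ler_wpM2r ?sqr_ge0//.
    by rewrite -ler_pdivlMl// (le_trans s2)// le_eqVlt; apply/orP; left; apply/eqP; field; rewrite gt_eqF.
  pose c := eps / 2 * s ^+ 2.
  have c0 : 0 < c by rewrite mulr_gt0 ?divr_gt0 ?exprn_gt0.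
  have step S : 2 * eps <= S -> P S -> P (Num.max (2 * eps) (S - c)).
    move=> Se PS l lp l1.
    have mS : 0 <= Num.max (2 * eps) (S - c) by rewrite le_max mulr_ge0 ?(ltW e0).
    have [lk|lk] := leP (normc l) kap; first exact: small.
    have [lk1|lk1] := leP (1 - kap) (normc l).
      apply: le_trans (ltW (u0 _ (disc l l1))) _; rewrite lee_fin.
      have : - eps <= ln (normc l).
        rewrite -[- eps]expRK ler_ln ?posrE ?expR_gt0//; lra.
      have : ln (normc l) <= 0 by rewrite ln_le0.
      have : 2 * eps <= Num.max (2 * eps) (S - c) by rewrite le_max lexx.
      have := sq1 l l1; nra.
    have Al : A^-1 <= normc l by rewrite invrK ltW.
    have [cl ml] := cmean_ln_shift_le A0 s0 s3 s4 Al.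
    have cn : continuous (fun t => normc (l + s%:C * circ t)).
      exact: (@continuous_add_rot R (@normc R) l s%:C (@continuous_normc R)).
    have cn2 : continuous (fun t => normc (l + s%:C * circ t) ^+ 2).
      by move=> t; apply: cvgM; exact: cn.
    pose F t := S + ((1 - eta) * ln (normc (l + s%:C * circ t)) + (- eps) * normc (l + s%:C * circ t) ^+ 2).
    have cF : continuous F.
      apply: continuous_sum_fun; first exact: cst_continuous.
      by apply: continuous_sum_fun; exact: continuous_scale_fun.
    have circ_le (z : Cplx R) : normc z <= 1 -> normc (l + (s%:C * z)) <= normc l + s.
      move=> z1; apply: (le_trans (ler_normcD _ _)).
      by rewrite normcM normc_real gtr0_norm// lerD2l ler_piMr// ltW.
    have lE (z : Cplx R) : q + l *: Y + z *: (s%:C *: Y) = q + (l + s%:C * z) *: Y.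
      by rewrite scalerA scalerDl addrA [z * _]mulrC.
    have := @psh_mean_le R n D u (q + l *: Y) (s%:C *: Y) F pu u0 _ cF _.
    have s6 : normc l + s <= 1 by lra.
    move=> H; apply: le_trans (H _ _) _.
    - by move=> z z1; rewrite lE; apply: disc; apply: le_trans (circ_le z z1) _.
    - move=> t; rewrite lE.
      have := PS (l + s%:C * circ t); rewrite /F mulNr addrA; apply.
        have : normc l <= normc (l + s%:C * circ t) + s.
          rewrite -{1}(addrK (s%:C * circ t) l); apply: (le_trans (ler_normcB _ _)).
          by rewrite (normcM s%:C) circ_norm mulr1 normc_real gtr0_norm.
        by lra.
      by apply: le_trans (circ_le _ _) _ => //; rewrite circ_norm.
    rewrite lee_fin /F cmeanD; [|exact: cst_continuous|by apply: continuous_sum_fun; exact: continuous_scale_fun].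
    rewrite cmean_cst cmeanD; [|exact: continuous_scale_fun|exact: continuous_scale_fun].
    rewrite !cmeanZ// cmean_normc_sqrC.
    have : S - c <= Num.max (2 * eps) (S - c) by rewrite le_max lexx orbT.
    have : (1 - eta) * cmean (fun t => ln (normc (l + s%:C * circ t))) <=
       (1 - eta) * ln (normc l) + K * s ^+ 3.
      apply: (@le_trans _ _ ((1 - eta) * (ln (normc l) + K * s ^+ 3))).
        by rewrite ler_wpM2l// subr_ge0 ltW.
      rewrite mulrDr lerD2l ler_piMl// ?mulr_ge0 ?exprn_ge0 ?ltW//.
      by rewrite ltrBlDl ltrDr.
    rewrite /c; lra.
  (* A bound to start the descent from: for |l| > kap it follows from u < 0 and ln |l| >= ln kap. *)
  pose S0 := Num.max (2 * eps) (- ln kap + eps).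
  have P0 : P S0.
    move=> l lp l1; have [lk|lk] := leP (normc l) kap.
      by apply: small => //; rewrite le_max mulr_ge0 ?(ltW e0).
    apply: le_trans (ltW (u0 _ (disc l l1))) _; rewrite lee_fin.
    have : - ln kap + eps <= S0 by rewrite le_max lexx orbT.
    have : ln kap <= ln (normc l) by rewrite ler_ln ?posrE// ltW.
    have : ln (normc l) <= 0 by rewrite ln_le0.
    have := sq1 l l1; nra.
  have PN N : P (Num.max (2 * eps) (S0 - N%:R * c)).
    elim: N => [|N IH]; first by rewrite mul0r subr0 max_r ?le_max ?lexx.
    have := step _ _ IH; rewrite le_max lexx => /(_ isT) H l lp l1.
    apply: le_trans (H l lp l1) _; rewrite lee_fin -!addrA lerD2r.
    rewrite ge_max !le_max lexx/=.
    have [h|h] := leP (2 * eps) (S0 - N%:R * c).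
      by apply/orP; right; rewrite -natr1 mulrDl mul1r; lra.
    by apply/orP; left; lra.
  have [N NS] : exists N : nat, S0 <= N%:R * c.
    exists (Num.truncn (S0 / c)).+1; rewrite -ler_pdivrMr//.
    exact/ltW/truncnS_gt.
  have := PN N; rewrite max_l//.
  by have := ltW e0; lra.
apply/lee_addgt0Pr => d d0.
pose L := ln (normc l0).
have L0 : L <= 0 by rewrite /L ln_le0.
(* With eps = d / 4 the term 2 eps costs d / 2, and eta |L| costs at most another d / 2. *)
pose eta := Num.min 2^-1 (d / (2 * (`|L| + 1))).
have L1 : 0 < 2 * (`|L| + 1) by rewrite mulr_gt0// ltr_wpDl.
have eta0 : 0 < eta by rewrite lt_min invr_gt0 ltr0n divr_gt0.
have : eta <= eta by [].
rewrite {2}/eta le_min => /andP[eta1 eta2].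
have d4 : 0 < d / 4 by rewrite divr_gt0.
apply: le_trans (key _ _ d4 eta0 _ l0 l00 l01) _; first by lra.
rewrite -/L -EFinD lee_fin.
have : eta * `|L| <= d / 2.
  apply: (@le_trans _ _ (d / (2 * (`|L| + 1)) * `|L|)); first by rewrite ler_wpM2r.
  rewrite -mulrA ler_wpM2l ?(ltW d0)// ler_pdivrMl// .
  by have := normr_ge0 L; lra.
rewrite (ler0_norm L0) => h.
have : 0 <= d / 4 * normc l0 ^+ 2 by rewrite mulr_ge0 ?sqr_ge0// ltW.
lra.
Qed.
End GreenSchwarz.

(** * Upper bounds for the Azukawa metric from families of discs *)

Section Azukawa.
Variables (R : realType) (n : nat).
Implicit Types (z a b X Y q : Cn R n) (D : set (Cn R n)).

Lemma dnbhs0_cplxP (V : set (Cplx R)) : (0 : Cplx R)^' V <->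
  exists2 r : R, 0 < r & forall l : Cplx R, 0 < normc l -> normc l < r -> V l.
Proof.
split.
  move=> /nbhs_cplxP[r r0 H]; exists r => // l l0 lr; apply: H; first by rewrite subr0.
  by rewrite -normc_eq0 gt_eqF.
move=> [r r0 H]; apply/nbhs_cplxP; exists r => // l; rewrite subr0 => lr /= l0.
by apply: H => //; rewrite lt0r normc_ge0 andbT normc_eq0.
Qed.

(** Each point of the circle around q + l X has the same parameter modulus |l| / rho in its own disc
    through q, so the Schwarz bound is one constant there. In direction X itself only small l
    matter, and openness of D suffices. *)
Lemma azukawa_le D q X b (rho : R) : open D -> D q -> 0 < rho ->
  (forall t, 0 < enorm (X + circ t *: b)) ->
  (forall t (l : Cplx R), normc l <= rho -> D (q + l *: (X + circ t *: b))) ->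
  (azukawa D q X <= (rho^-1)%:E)%E.
Proof.
move=> oD Dq rho0 Xb disc.
have [r0 r00 rD] := open_CnP oD Dq.
have N0 : 0 < enorm X + enorm b + 1 by rewrite ltr_wpDl// addr_ge0 ?enorm_ge0.
(* The first bound is for the Schwarz lemma; the second keeps q + l (X + z b), |z| <= 1, in D, as
   the mean inequality at q + l X requires. *)
pose r := Num.min rho (r0 / (enorm X + enorm b + 1)).
have rp : 0 < r by rewrite lt_min rho0 divr_gt0.
apply: ge_ereal_inf; exists (ereal_sup ((fun l : Cplx R =>
    (expeR (green D q (q + l *: X)) * ((normc l)^-1)%:E)%E) @` [set l | 0 < normc l /\ normc l < r])).
  exists [set l : Cplx R | 0 < normc l /\ normc l < r] => //.
  by apply/dnbhs0_cplxP; exists r.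
apply: ge_ereal_sup => _ [l [l0 lr] <-].
move: lr; rewrite lt_min => /andP[lrho]; rewrite ltr_pdivlMr// => lr.
have G : (green D q (q + l *: X)%R <= (ln (normc l / rho))%:E)%E.
  apply: ge_ereal_sup => _ [u ug <-]; have [pu u0 _] := ug.
  rewrite -(cmean_cst (ln (normc l / rho))).
  apply: (@psh_mean_le R n D u (q + l *: X) (l *: b)) => //.
  - move=> z z1; apply: rD.
    have -> : q + l *: X + z *: (l *: b) - q = l *: (X + z *: b).
      by rewrite scalerDr !scalerA [z * l]mulrC addrAC [q + _]addrC addrK.
    rewrite enormZ; apply: le_lt_trans lr; rewrite ler_wpM2l ?normc_ge0//.
    apply: (le_trans (ler_enormD _ _)); rewrite -addrA lerD2l enormZ.
    have : normc z * enorm b <= enorm b by rewrite ler_piMl ?enorm_ge0.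
    lra.
  - exact: cst_continuous.
  - move=> t.
    have -> : q + l *: X + circ t *: (l *: b) = q + (rho^-1%:C * l) *: (rho%:C *: (X + circ t *: b)).
      have e : (rho^-1)%:C * rho%:C = 1 :> Cplx R by rewrite -rmorphM mulVf// gt_eqF.
      rewrite scalerA [_ * l * _]mulrAC e mul1r.
      by rewrite scalerDr [l *: (_ *: b)]scalerA [l * _]mulrC -scalerA addrA.
    have nl : normc (rho^-1%:C * l) = normc l / rho.
      by rewrite normcM normc_real gtr0_norm ?invr_gt0// mulrC.
    rewrite -nl; apply: (@green_schwarz R n D u q) => //.
    + by rewrite enormZ normc_real gtr0_norm// mulr_gt0.
    + move=> z z1; rewrite scalerA; apply: disc.
      by rewrite normcM normc_real gtr0_norm// ler_piMl// ltW.
    + by rewrite nl divr_gt0.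
    + by rewrite nl ler_pdivrMr// mul1r ltW.
have lr0 : 0 < normc l / rho by rewrite divr_gt0.
apply: (@le_trans _ _ ((normc l / rho)%:E * ((normc l)^-1)%:E)%E).
  rewrite lee_wpmul2r ?lee_fin ?invr_ge0 ?normc_ge0//.
  have := lee_expeR (green D q (q + l *: X)) (ln (normc l / rho))%:E.
  by rewrite G /= lnK ?posrE.
by rewrite -EFinM lee_fin mulrAC mulfV ?mul1r// gt_eqF.
Qed.

End Azukawa.

(** * The Sibony metric is at most the Azukawa metric *)

Section SibonyAzukawa.
Variables (R : realType) (n : nat).
Implicit Types (z a b X Y q w : Cn R n) (D U : set (Cn R n)) (v : Cn R n -> R).
Local Notation mu := (@lebesgue_measure R).

Lemma is_Ck_sub k U U' v : U' `<=` U -> is_Ck k U v -> is_Ck k U' v.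
Proof.
move=> UU; elim: k v => [|k IH] v vC.
  by split=> // w /UU Uw; exact: (is_Ck_continuous vC).
split=> [w /UU Uw|j b]; first exact: (is_Ck_continuous vC).
by have [d c] := is_CkS j b vC; split=> [w /UU|]; [exact: d|exact: IH].
Qed.

Lemma psh_half D (u : Cn R n -> \bar R) : psh D u -> (forall z, D z -> (u z < 0)%E) ->
  psh D (fun w => ((2^-1)%:E * u w)%E).
Proof.
move=> pu u0; have [_ usc sub] := pu.
have hE x (r : R) : ((2^-1)%:E * x < r%:E)%E = (x < (2 * r)%:E)%E.
  rewrite -(@lte_pmul2l _ 2%:E) ?lte_fin// muleA -EFinM mulfV// mul1e.
  by rewrite -EFinM.
split.
- move=> z Dz; apply: (@lt_trans _ _ 0%E); last exact: ltry.
  by rewrite hE mulr0; exact: u0.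
- move=> z Dz r; rewrite hE => ur.
  have /(nbhs_CnP z)[e e0 H] := usc z Dz _ ur.
  suff : nbhs z [set w | ((2^-1)%:E * u w < r%:E)%E] by [].
  by apply/nbhs_CnP; exists e => // w /H; rewrite /= hE.
move=> a b disc.
have Dc t : D (a + circ t *: b).
  by apply: disc; rewrite ler_norm_disc circ_norm.
have lg := psh_circle_lsc pu Dc.
have mg := lower_semicontinuous_measurable lg.
pose I := (\int[mu]_(t in [set` `[0%R, (2 * pi)%R]]) (- u (a + circ t *: b)%R))%E.
have I1 : (\int[mu]_(t in [set` `[0%R, (2 * pi)%R]]) u (a + (cos t +i* sin t) *: b)%R = - I)%E.
  rewrite /I -integral_ge0N; first by apply: eq_integral => t _; rewrite oppeK.
  by move=> t _; rewrite oppe_ge0 ltW// u0.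
have I2 : (\int[mu]_(t in [set` `[0%R, (2 * pi)%R]]) ((2^-1)%:E * u (a + (cos t +i* sin t) *: b)%R)
   = - ((2^-1)%:E * I))%E.
  rewrite /I -ge0_integralZl_EFin//.
  - rewrite -integral_ge0N; first by apply: eq_integral => t _; rewrite muleN oppeK.
    by move=> t _; rewrite mule_ge0// ?lee_fin ?invr_ge0// oppe_ge0 ltW// u0.
  - by move=> t _; rewrite oppe_ge0 ltW// u0.
  - exact: measurable_funTS.
rewrite I2 -muleN muleCA lee_pmul2l ?lte_fin ?invr_gt0// -I1.
exact: sub.
Qed.

(** v vanishes to second order at q, so half its logarithm has a pole of the right order; away from
    q the bound v < 1 is enough. *)
Lemma sibony_green D q v : open D -> D q -> sibony_class D q v ->
  green_class D q (fun w => ((2^-1)%:E * lne (v w)%:E)%E).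
Proof.
move=> oD Dq [v01 vq pv [U [oU Uq vC]]].
have l0 w : D w -> (lne (v w)%:E < 0)%E.
  by move=> /v01/andP[_ v1]; rewrite lne_lt0 lte_fin.
split; first exact: psh_half.
  by move=> w Dw; rewrite mule_gt0_lt0// ?lte_fin ?invr_gt0//; exact: l0.
have [r [K [r0 K0 H]]] := @C2_quadratic_bound R n (U `&` D) v q (openI oU oD)
  (is_Ck_sub (@subIsetl _ U D) vC) (conj Uq Dq) vq (fun w Hw => (andP (v01 w Hw.2)).1).
(* The first term serves the points within r of q, the second all others; adding 1 makes the
   inequality strict. *)
exists (2^-1 * `|ln (K + 1)| + `|ln r| + 1) => w Dw wq.
have e0 : 0 < enorm (w - q) by rewrite lt0r enorm_ge0 andbT enorm_eq0 subr_eq0.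
have [v0|v0] := leP (v w) 0.
  by rewrite le0_lneNy ?lee_fin// gt0_muleNy ?lte_fin ?invr_gt0// ltNyr.
rewrite lne_EFin// -EFinM lte_fin.
have [wr|wr] := ltP (enorm (w - q)) r.
  have [_ vK] := H w wr.
  have K1 : 0 < K + 1 by rewrite ltr_wpDl.
  have : ln (v w) <= ln (K + 1) + ln (enorm (w - q)) *+ 2.
    rewrite -lnXn// -lnM ?posrE ?exprn_gt0// ler_ln ?posrE ?mulr_gt0 ?exprn_gt0//.
    by apply: le_trans vK _; rewrite ler_wpM2r ?sqr_ge0// lerDl.
  have := ler_norm (ln (K + 1)); have := normr_ge0 (ln r).
  by rewrite mulr2n; lra.
have : ln (v w) <= 0 by rewrite ln_le0// ltW// (andP (v01 w Dw)).2.
have : ln r <= ln (enorm (w - q)) by rewrite ler_ln ?posrE.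
have := normr_ge0 (ln (K + 1)); have := ler_norm (- ln r); rewrite normrN.
lra.
Qed.

Lemma sqrt_le_expe_green D q w v : open D -> D q -> sibony_class D q v -> D w ->
  ((Num.sqrt (v w))%:E <= expeR (green D q w))%E.
Proof.
move=> oD Dq vS Dw; have [v01 _ _ _] := vS.
have := sibony_green oD Dq vS => G.
have : ((2^-1)%:E * lne (v w)%:E <= green D q w)%E.
  by apply: ereal_sup_ubound; exists (fun w => ((2^-1)%:E * lne (v w)%:E)%E).
rewrite -lee_expeR; apply: le_trans.
have [v0|v0] := leP (v w) 0; first by rewrite ler0_sqrtr// expeR_ge0.
rewrite lne_EFin// -EFinM /= lee_fin -(@ler_pXn2r _ 2) ?nnegrE ?sqrtr_ge0 ?expR_ge0//.
by rewrite sqr_sqrtr ?(ltW v0)// -expRM_natl mulr_natl -[X in X *+ 2]mulrC -mulr_natr -mulrA mulVf// mulr1 lnK.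
Qed.

Lemma azukawa_ge0 D q X : (0 <= azukawa D q X)%E.
Proof.
apply: limf_esup_ge0; last by move=> l; rewrite mule_ge0 ?expeR_ge0// lee_fin invr_ge0 normc_ge0.
move=> /dnbhs0_cplxP[r r0 H]; apply: (H (r / 2)%:C); rewrite normc_real gtr0_norm ?divr_gt0//.
by rewrite ltr_pdivrMr// ltr_pMr// ltr1n.
Qed.

(** For every small t one of q + t X and q + i t X has v at least (L - e) t^2, L being the Levi
    form. Hence every punctured neighbourhood of 0 contains a point where the quotient reaches sqrt
    (L - e), which bounds the limsup. *)
Lemma sibony_le_azukawa D q X : open D -> D q -> (sibony D q X <= azukawa D q X)%E.
Proof.
move=> oD Dq; apply: ge_ereal_sup => _ [v vS <-].
have [v01 vq pv [U [oU Uq vC]]] := vS.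
have [L0|L0] := leP (levi v q X) 0; first by rewrite ler0_sqrtr//; exact: azukawa_ge0.
apply: le_ereal_inf_tmp => _ [V /dnbhs0_cplxP[r r0 Vr] <-].
set S := ereal_sup _.
have S1 (e : R) : 0 < e -> e < levi v q X -> ((Num.sqrt (levi v q X - e))%:E <= S)%E.
  move=> e0 eL.
  have e2 : 0 < 2 * e by rewrite mulr_gt0.
  have [d d0 H] := @levi_limit R n (U `&` D) v q X (openI oU oD)
    (is_Ck_sub (@subIsetl _ U D) vC) (conj Uq Dq) vq (fun w Hw => (andP (v01 w Hw.2)).1) _ e2.
  have [r1 r10 rD] := open_CnP oD Dq.
  have X1 : 0 < enorm X + 1 by rewrite ltr_wpDl ?enorm_ge0.
  pose m := Num.min (Num.min d r) (r1 / (enorm X + 1)).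
  have m0 : 0 < m by rewrite !lt_min d0 r0 divr_gt0.
  pose t := m / 2.
  have t0 : 0 < t by rewrite divr_gt0.
  have : t < m by rewrite ltr_pdivrMr// ltr_pMr// ltr1n.
  rewrite !lt_min => /andP[/andP[td tr]]; rewrite ltr_pdivlMr// => tr1.
  have good (l : Cplx R) : normc l = t -> (levi v q X - e) * t ^+ 2 <= v (q + l *: X) ->
      ((Num.sqrt (levi v q X - e))%:E <= S)%E.
    move=> lt lv; apply: le_ereal_sup_tmp.
    exists (expeR (green D q (q + l *: X)) * ((normc l)^-1)%:E)%E.
      by exists l => //; apply: Vr; rewrite lt.
    have Dl : D (q + l *: X).
      apply: rD; rewrite addrAC subrr add0r enormZ lt; apply: le_lt_trans tr1.
      by rewrite ler_wpM2l ?(ltW t0)// lerDl.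
    have := sqrt_le_expe_green oD Dq vS Dl => G.
    apply: (@le_trans _ _ ((Num.sqrt (v (q + l *: X)))%:E * ((normc l)^-1)%:E)%E); last first.
      by rewrite lee_wpmul2r// lee_fin invr_ge0 normc_ge0.
    rewrite -EFinM lee_fin lt ler_pdivlMr// -(ger0_norm (ltW t0)) -sqrtr_sqr -sqrtrM ?subr_ge0 ?(ltW eL)//.
    by rewrite ler_wsqrtr.
  have := H t; rewrite gtr0_norm// => /(_ td); rewrite ler_norml => /andP[h _].
  have [h1|h1] := leP ((levi v q X - e) * t ^+ 2) (v (q + t%:C *: X)).
    by apply: (good t%:C) => //; rewrite normc_real gtr0_norm.
  apply: (good (t%:C * 'i%C)).
    by rewrite normcM normc_real gtr0_norm//= expr0n expr1n add0r sqrtr1 mulr1.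
  rewrite -scalerA; lra.
have S0 : (0 <= S)%E.
  apply: le_trans (S1 (levi v q X / 2) _ _); rewrite ?lee_fin ?sqrtr_ge0 ?divr_gt0//.
  by rewrite ltr_pdivrMr// ltr_pMr// ltr1n.
rewrite leNgt; apply/negP => SL.
have Sfin : S \is a fin_num by rewrite ge0_fin_numE// (lt_trans SL)// ltry.
have SE : S = (fine S)%:E by rewrite fineK.
have f0 : 0 <= fine S by rewrite fine_ge0.
move: SL; rewrite SE lte_fin => SL.
have S2 : fine S ^+ 2 < levi v q X.
  by rewrite -(sqr_sqrtr (ltW L0)) ltrXn2r.
(* If S^2 < L, this e would give S^2 >= L - e = (L + S^2) / 2 > S^2. *)
pose e := (levi v q X - fine S ^+ 2) / 2.
have e0 : 0 < e by rewrite divr_gt0// subr_gt0.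
have := sqr_ge0 (fine S) => s2.
have eL : e < levi v q X by rewrite /e; lra.
have := S1 e e0 eL; rewrite SE lee_fin -(ger0_norm f0) -sqrtr_sqr ler_sqrt ?sqr_ge0//.
by rewrite /e; lra.
Qed.

End SibonyAzukawa.

(** * A competitor for the Sibony metric *)

Lemma sum_lower_bounds_absurd (R : realFieldType) (l lv x y s : R) :
  x + y - 2 * lv * s <= (l - lv) * s -> l * s <= x -> l * s <= y ->
  0 < (l - lv) * s -> False.
Proof. by move=> *; lra. Qed.

Lemma normc_1D_gt0 (R : realType) (x : Cplx R) : normc x < 1 -> 0 < normc (1 + x).
Proof.
move=> x1; rewrite lt0r normc_ge0 andbT normc_eq0; apply/eqP => h.
have : normc x = 1.
  rewrite -(normc_opp x) -[RHS](@normc1 R); congr normc.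
  by apply/esym/eqP; rewrite -subr_eq0 opprK; apply/eqP.
by move=> xE; rewrite xE ltxx in x1.
Qed.

Lemma ler_ln_pos (R : realType) (x y : R) : 0 < x -> x <= y -> ln x <= ln y.
Proof. by move=> x0 xy; rewrite ler_ln ?posrE// (lt_le_trans x0). Qed.

Lemma ln_mul_le (R : realType) (x y z : R) : 0 < x -> 0 < y -> x * y <= z -> ln x + ln y <= ln z.
Proof. by move=> x0 y0 h; rewrite -lnM ?posrE//; apply: ler_ln_pos h; exact: mulr_gt0. Qed.

Lemma double_radius (R : realFieldType) (x y s b t : R) :
  x <= y + s * b -> y < t -> s * (b + 1) <= t -> 0 < s -> x < 2 * t.
Proof. by move=> h1 h2; rewrite mulrDr mulr1 => h3 h4; lra. Qed.

Lemma ln_mulV (R : realType) (x y : R) : 0 < x -> 0 < y -> ln (x / y) = ln x - ln y.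
Proof. by move=> x0 y0; rewrite lnM ?posrE ?invr_gt0// lnV ?posrE. Qed.

(** The letters are logarithms: m and n' of N at the centre and on the circle, t of tau^2, l2 of 2,
    k of M, and P of the polynomial factor in [N_minorant]; the two equations have the shape of
    [ln_v2]. *)
Lemma ler_power_branch (R : realType) (lv lw m n' k l2 t P eta : R) :
  lv = l2 + m + eta * (m - t) - k -> lw = l2 + n' + eta * (n' - t) - k ->
  0 <= eta -> m + P <= n' -> lv + (1 + eta) * P <= lw.
Proof. by move=> -> -> e0 h; have := ler_wpM2l e0 h; lra. Qed.

Lemma ler_polar_branch (R : realType) (lv lw m n' k P Q : R) :
  lv = m - k -> lw = n' - k -> m + P <= n' + Q -> lv + 1 * P - 1 * Q <= lw.
Proof. by move=> -> -> h; lra. Qed.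

(** [cmean_minorant] produces the factor 1 + eta on the branch [v2] and 1 + 1 on the branch [v1];
    the constant 2 + eta serves both. *)
Lemma ler_error_term (R : realType) (x k K s eta : R) :
  k = 1 + eta + 0 \/ k = 1 + 1 -> 0 <= eta -> 0 <= K * s ->
  x + k * K * s <= x + (2 + eta) * K * s.
Proof.
move=> kE e0 Ks; rewrite lerD2l -2!mulrA ler_wpM2r//.
by case: kE => ->; lra.
Qed.

Lemma ler_sum4 (R : realFieldType) (a b c d : R) : 0 <= a -> 0 <= b -> 0 <= c -> 0 <= d ->
  let s := a + b + c + d in 0 <= s /\ [/\ a <= s, b <= s, c <= s & d <= s].
Proof. by move=> a0 b0 c0 d0 /=; split; [|split]; lra. Qed.

Section Candidate.
Variables (R : realType) (n : nat) (D : set (Cn R n.+1)) (q : Cn R n.+1) (p : Cplx R).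
Variables (tau sig d0 c1 : R).
Hypotheses (oD : open D) (Dq : D q) (tau0 : 0 < tau) (sig0 : 0 <= sig) (c10 : 0 < c1).
Hypothesis tau_d0 : tau < d0.
Hypothesis bounded : forall z, D z -> enorm (z - q) <= d0.
Hypothesis polar_far : forall z, D z -> enorm (z - q) < 2 * tau ->
  c1 <= normc (z ord0 ord0 - p) /\
  sig * normc (z ord0 ord0 - q ord0 ord0) <= tau * normc (z ord0 ord0 - p).
Implicit Types (z w a b X : Cn R n.+1).

(* [v1] carries the Levi form, but is only available near [q]. It is continued by
   [v2], of order |z - q|^(2 + 2 eta): the exponent is chosen so that [v2] is
   [2 e N] where |z - q| = d0, hence bounded, whatever [tau] is. *)
Let N z : R := enorm (z - q) ^+ 2.
Let eta : R := (ln (d0 ^+ 2) - ln (tau ^+ 2))^-1.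
Let M : R := 2 * d0 ^+ 2 * expR 1 + 2 * d0 ^+ 2 + 1.
Let v1 z : R := sig ^+ 2 * normc (z ord0 ord0 - q ord0 ord0) ^+ 2
  / normc (z ord0 ord0 - p) ^+ 2 + N z.
Let v2 z : R := 2 * N z * expR (eta * (ln (N z) - ln (tau ^+ 2))).
Let v z : R := (if enorm (z - q) < 2 * tau then Num.max (v1 z) (v2 z) else v2 z) / M.

Let d00 : 0 < d0. Proof. exact: lt_trans tau_d0. Qed.

Let eta0 : 0 < eta.
Proof. by rewrite invr_gt0 subr_gt0 ltr_ln ?posrE ?exprn_gt0// ltrXn2r// ltW. Qed.

Let M0 : 0 < M.
Proof.
have h : 0 <= 2 * d0 ^+ 2 by rewrite mulr_ge0 ?sqr_ge0.
by rewrite ltr_wpDl// addr_ge0// mulr_ge0// expR_ge0.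
Qed.

Let N0 z : 0 <= N z. Proof. exact: sqr_ge0. Qed.

Let N2 z : 0 <= 2 * N z. Proof. by rewrite mulr_ge0//; exact: N0. Qed.

Let Np z : z != q -> 0 < N z.
Proof. by move=> zq; rewrite exprn_gt0// lt0r enorm_ge0 enorm_eq0 subr_eq0 zq. Qed.

Let N_d0 z : D z -> N z <= d0 ^+ 2.
Proof. by move=> /bounded h; rewrite lerXn2r ?nnegrE ?enorm_ge0 ?(ltW d00). Qed.

Let v1_ge z : N z <= v1 z.
Proof. by rewrite /v1 lerDr; apply: divr_ge0; [apply: mulr_ge0|]; exact: sqr_ge0. Qed.

Let v2_ge0 z : 0 <= v2 z.
Proof. by rewrite /v2; apply: mulr_ge0; [exact: N2|exact: expR_ge0]. Qed.

Let v1_le z : D z -> enorm (z - q) < 2 * tau -> v1 z <= tau ^+ 2 + N z.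
Proof.
move=> Dz zt; have [h1 h2] := polar_far Dz zt.
have n0 : 0 < normc (z ord0 ord0 - p) by exact: lt_le_trans h1.
rewrite /v1 lerD2r -!exprMn -expr_div_n.
rewrite lerXn2r ?nnegrE ?divr_ge0 ?mulr_ge0 ?normc_ge0 ?(ltW tau0)//.
by rewrite ler_pdivrMr.
Qed.

Let v2_le z : D z -> v2 z <= 2 * N z * expR 1.
Proof.
(* At q the logarithm has only a default value, which the factor N z = 0 removes. *)
move=> Dz; have [N00|N00] := eqVneq (N z) 0; first by rewrite /v2 N00 mulr0 !mul0r.
have Nz : 0 < N z by rewrite lt0r N00 N0.
rewrite /v2 ler_wpM2l ?N2// ler_expR.
rewrite -ler_pdivlMl// mulr1 invrK lerD2r.
by rewrite ler_ln ?posrE ?Nz//; [exact: N_d0|exact: exprn_gt0].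
Qed.

Let v2_ge z : tau <= enorm (z - q) -> 2 * N z <= v2 z.
Proof.
move=> tz; have tN : tau ^+ 2 <= N z by rewrite lerXn2r ?nnegrE ?enorm_ge0 ?(ltW tau0).
rewrite /v2 ler_peMr ?N2// -[leLHS]expR0 ler_expR mulr_ge0 ?(ltW eta0)// subr_ge0.
have t2 : 0 < tau ^+ 2 by exact: exprn_gt0.
by rewrite ler_ln ?posrE// (lt_le_trans _ tN).
Qed.

Let v_ge2 z : v2 z / M <= v z.
Proof.
rewrite /v ler_pM2r ?invr_gt0//; case: ifP => // _.
by rewrite le_max lexx orbT.
Qed.

(** The radius is 2 tau, not tau, because a small circle centred in the ball of radius tau may leave
    it and must still have [v1] as a minorant. *)
Let v_ge1 z : enorm (z - q) < 2 * tau -> v1 z / M <= v z.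
Proof. by rewrite /v => ->; rewrite ler_pM2r ?invr_gt0// le_max lexx. Qed.

(* Outside the ball of radius [tau] the two branches can be glued. *)
Let v_cases z : D z -> v z = v2 z / M \/ v z = v1 z / M /\ enorm (z - q) < tau.
Proof.
move=> Dz; rewrite /v; case: ifP => [zt|_]; last by left.
have [h|h] := leP (v1 z) (v2 z); first by left.
right; split=> //; rewrite ltNge; apply/negP => tz.
have := v2_ge tz; have := v1_le Dz zt.
have : tau ^+ 2 <= N z by rewrite lerXn2r ?nnegrE ?enorm_ge0 ?(ltW tau0).
lra.
Qed.

(** [M] collects 2 e d0^2 for [v2], and tau^2 + N <= 2 d0^2 for [v1]; its last term 1 makes the
    bound strict. *)
Let v01 z : D z -> 0 <= v z < 1.
Proof.
move=> Dz; apply/andP; split.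
  by apply: le_trans (v_ge2 z); rewrite divr_ge0 ?v2_ge0// ltW.
have Nd := N_d0 Dz.
have e0 : 0 < expR 1 :> R by exact: expR_gt0.
have [->|[-> zt]] := v_cases Dz; rewrite ltr_pdivrMr// mul1r /M.
  apply: le_lt_trans (v2_le Dz) _.
  have : 2 * N z * expR 1 <= 2 * d0 ^+ 2 * expR 1 by rewrite ler_pM2r// ler_pM2l.
  have := sqr_ge0 d0; lra.
apply: (@le_lt_trans _ _ (tau ^+ 2 + N z)).
  by apply: v1_le => //; have := ltW tau0; lra.
have : tau ^+ 2 <= d0 ^+ 2 by rewrite lerXn2r ?nnegrE ?(ltW tau0) ?(ltW d00) ?(ltW tau_d0).
have : 0 <= 2 * d0 ^+ 2 * expR 1 by rewrite mulr_ge0 ?mulr_ge0 ?sqr_ge0 ?ltW.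
lra.
Qed.

(** At distance at most tau 2^(-1 / eta) the factor (N / tau^2)^eta is at most 1/4, so that v2 <= N
    <= v1 and v coincides with the smooth branch. *)
Let r1 : R := Num.min tau (tau * expR (- (ln 2 / eta))).

Let r10 : 0 < r1. Proof. by rewrite lt_min tau0 mulr_gt0 ?expR_gt0. Qed.

Let v_near z : enorm (z - q) < r1 -> v z = v1 z / M.
Proof.
rewrite lt_min => /andP[zt zr]; rewrite /v ifT; last by have := ltW tau0; lra.
congr (_ / M); apply: max_l; apply: le_trans (v1_ge z).
have [N00|N00] := eqVneq (N z) 0; first by rewrite /v2 N00 mulr0 !mul0r.
have Nz : 0 < N z by rewrite lt0r N00 N0.
have ez : 0 < enorm (z - q) by rewrite lt0r enorm_ge0 andbT; apply: contra N00; rewrite sqrf_eq0.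
have lnz : ln (enorm (z - q)) <= ln tau - ln 2 / eta.
  have -> : ln tau - ln 2 / eta = ln (tau * expR (- (ln 2 / eta))).
    by rewrite lnM ?posrE ?expR_gt0// expRK.
  by rewrite ler_ln ?posrE ?mulr_gt0 ?expR_gt0// ltW.
rewrite /v2 mulrAC ger_pMl//; last first.
rewrite -[leRHS](@mulfV _ 2)// ler_pM2l// -[leRHS]lnK ?posrE ?invr_gt0// ler_expR lnV ?posrE//.
rewrite /N !lnXn// -mulrnBl.
have : eta * (ln (enorm (z - q)) - ln tau) <= - ln 2.
  rewrite -ler_pdivlMl//; lra.
have : 0 <= ln 2 :> R by rewrite ln_ge0// ler1n.
rewrite mulr2n; lra.
Qed.

Let vq : v q = 0.
Proof.
rewrite v_near; last by rewrite subrr (_ : enorm _ = 0)//; apply/eqP; rewrite enorm_eq0.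
rewrite /v1 /N !subrr normc0 (_ : enorm _ = 0) ?expr0n/= ?mulr0 ?mul0r ?addr0 ?mul0r//.
by apply/eqP; rewrite enorm_eq0.
Qed.

Let qE (z : Cn R n.+1) (a : Cplx R) : (z - q) ord0 ord0 + (q ord0 ord0 - a) = z ord0 ord0 - a.
Proof. by rewrite !mxE addrA subrK. Qed.

Let N_Ck k U : open U -> is_Ck k U N.
Proof.
move=> oU; have := @is_Ck_sum R n.+1 U oU k _ (index_enum _)
  (fun j z => normc ((z - q) ord0 j + 0) ^+ 2) (fun j => is_Ck_normc_sqr oU k j q 0).
apply: is_Ck_ext => // z _; rewrite /N enorm_sqr; apply: eq_bigr => j _.
by rewrite addr0.
Qed.

Let a_Ck k U (a : Cplx R) : open U -> is_Ck k U (fun z => normc (z ord0 ord0 - a) ^+ 2).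
Proof.
move=> oU; apply: is_Ck_ext (is_Ck_normc_sqr oU k ord0 q (q ord0 ord0 - a)) => // z _.
by rewrite qE.
Qed.

Let v1_Ck k U : open U -> (forall z, U z -> z ord0 ord0 != p) -> is_Ck k U v1.
Proof.
move=> oU Up; apply: is_Ck_add => //; last exact: N_Ck.
apply: is_Ck_mul => //.
  by apply: is_Ck_mul => //; [exact: is_Ck_cst|exact: a_Ck].
apply: is_Ck_inv => //; last exact: a_Ck.
by move=> z /Up zp; rewrite sqrf_eq0 normc_eq0 subr_eq0.
Qed.

Let cN z : {for z, continuous N}.
Proof. exact: (is_Ck_continuous (N_Ck 0 openT)). Qed.

Let cv1 z : D z -> enorm (z - q) < 2 * tau -> {for z, continuous v1}.
Proof.
move=> Dz zt; have [h _] := polar_far Dz zt.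
have n0 : normc (z ord0 ord0 - p) ^+ 2 != 0.
  by rewrite expf_neq0// gt_eqF// (lt_le_trans c10).
apply: contD_at; last exact: cN.
apply: contM_at; last first.
  by apply: contV_at => //; exact: (is_Ck_continuous (a_Ck 0 p openT)).
apply: contM_at; first exact: contC_at.
exact: (is_Ck_continuous (a_Ck 0 _ openT)).
Qed.

Let cv2 z : z != q -> {for z, continuous v2}.
Proof.
move=> /Np Nz; apply: contM_at; first by apply: contM_at; [exact: contC_at|exact: cN].
apply: (@continuous_comp (Cn R n.+1) R R (fun z => eta * (ln (N z) - ln (tau ^+ 2))) expR); last exact: continuous_expR.
apply: contM_at; first exact: contC_at.
apply: contD_at; last exact: contC_at.
by apply: (@continuous_comp (Cn R n.+1) R R N (@ln R)); [exact: cN|exact: continuous_ln].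
Qed.

Let cont_ball_ext (f g : Cn R n.+1 -> R) z (r : R) : 0 < r ->
  (forall w, enorm (w - z) < r -> f w = g w) -> {for z, continuous f} -> {for z, continuous g}.
Proof.
move=> r0 fg /continuous_CnP cf; apply/continuous_CnP => e /cf[s s0 H].
exists (Num.min r s); first by rewrite lt_min r0.
move=> w; rewrite lt_min => /andP[wr ws]; rewrite -!fg//; first exact: H.
by rewrite subrr (_ : enorm 0 = 0)//; apply/eqP; rewrite enorm_eq0.
Qed.

(** The definition of v switches at radius 2 tau, but [v2] dominates from radius tau on, so near and
    beyond the switch v is just [v2]. At q, where ln N is singular, v is [v1]. *)
Let cv z : D z -> {for z, continuous v}.
Proof.
move=> Dz; have [->|zq] := eqVneq z q.
  apply: (@cont_ball_ext (fun w => v1 w / M) v q r1) => //.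
    by move=> w /v_near.
  apply: contM_at; last exact: contC_at.
  apply: cv1 => //; rewrite subrr (_ : enorm 0 = 0) ?mulr_gt0//.
  by apply/eqP; rewrite enorm_eq0.
apply: contM_at; last exact: contC_at.
have tri w : `|enorm (w - q) - enorm (z - q)| <= enorm (w - z).
  have h1 := ler_enormD (w - z) (z - q); have h2 := ler_enormD (z - w) (w - q).
  rewrite !addrA !subrK -(enormN (z - w)) opprB in h1 h2.
  by rewrite ler_norml; apply/andP; split; lra.
have [zt|zt] := ltP (enorm (z - q)) (2 * tau).
  apply: (@cont_ball_ext (fun w => Num.max (v1 w) (v2 w)) _ z (2 * tau - enorm (z - q))); first by rewrite subr_gt0.
    move=> w wz; rewrite ifT//.
    by have := tri w; rewrite ler_norml => /andP[_]; lra.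
  by apply: continuous_max; [exact: cv1|exact: cv2].
(* Points within tau of such a z are still at distance at least tau from q. *)
have [r r0 rD] := open_CnP oD Dz.
apply: (@cont_ball_ext v2 _ z (Num.min tau r)); [by rewrite lt_min tau0| |exact: cv2].
move=> w; rewrite lt_min => /andP[wt /rD Dw]; case: ifP => // wt2.
rewrite max_r//; apply: le_trans (v1_le Dw wt2) _.
have tw : tau <= enorm (w - q).
  by have := tri w; rewrite ler_norml => /andP[h _]; lra.
apply: le_trans (v2_ge tw).
have : tau ^+ 2 <= N w by rewrite lerXn2r ?nnegrE ?enorm_ge0 ?(ltW tau0).
lra.
Qed.

Let B1 : set (Cn R n.+1) := [set z | enorm (z - q) < r1] `&` D.

Let oB1 : open B1.
Proof.
apply: openI => //; rewrite openE => z /= zr; apply/nbhs_CnP.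
exists (r1 - enorm (z - q)); first by rewrite subr_gt0.
move=> w wz; have := ler_enormD (w - z) (z - q); rewrite addrA subrK /=; lra.
Qed.

Let B1q : B1 q.
Proof.
split=> //=; rewrite subrr (_ : enorm 0 = 0)//.
by apply/eqP; rewrite enorm_eq0.
Qed.

Let v_C2 : is_Ck 2 B1 v.
Proof.
apply: (@is_Ck_ext _ _ B1 oB1 2 (fun z => v1 z * M^-1)); first by move=> z [/v_near ->].
apply: (is_Ck_mul oB1); last exact: is_Ck_cst.
apply: v1_Ck => // z [/= zr Dz].
have : enorm (z - q) < 2 * tau.
  by move: zr; rewrite lt_min => /andP[h _]; have := ltW tau0; lra.
move=> /(polar_far Dz)[h _]; rewrite -subr_eq0 -normc_eq0 gt_eqF//.
exact: lt_le_trans h.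
Qed.

(** Lower bounds for v along the real lines of directions X and iX, passed to the limit by
    contradiction. The factor 4 comes from estimating |z_1 - p| by 2 |q_1 - p| near q. *)
Let levi_v X : (sig ^+ 2 * normc (X ord0 ord0) ^+ 2 / (4 * normc (q ord0 ord0 - p) ^+ 2) + enorm X ^+ 2) / M
  <= levi v q X.
Proof.
set L := _ / M.
have qp : 0 < normc (q ord0 ord0 - p).
  have := @polar_far q Dq; rewrite subrr (_ : enorm 0 = 0) ?mulr_gt0//; last by apply/eqP; rewrite enorm_eq0.
  by move=> /(_ isT)[h _]; exact: lt_le_trans h.
have X1 : 0 < enorm X + 1 by rewrite ltr_wpDl ?enorm_ge0.
have low (Y : Cn R n.+1) (t : R) : enorm Y = enorm X -> normc (Y ord0 ord0) = normc (X ord0 ord0) ->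
    `|t| < r1 / (enorm X + 1) -> `|t| < normc (q ord0 ord0 - p) / (enorm X + 1) ->
    L * t ^+ 2 <= v (q + t%:C *: Y).
  move=> YX YX0; rewrite ltr_pdivlMr// => t1; rewrite ltr_pdivlMr// => t2.
  have tX : `|t| * enorm X <= `|t| * (enorm X + 1) by rewrite ler_wpM2l// lerDl.
  have E : q + t%:C *: Y - q = t%:C *: Y by rewrite addrAC subrr add0r.
  have nE : enorm (t%:C *: Y) = `|t| * enorm X by rewrite enormZ normc_real YX.
  rewrite v_near; last by rewrite E nE; exact: le_lt_trans t1.
  rewrite mulrAC ler_pM2r ?invr_gt0// /v1 /N E nE mulrDl exprMn real_normK ?num_real// [enorm X ^+ 2 * _]mulrC.
  rewrite lerD2r.
  have -> : (q + t%:C *: Y) ord0 ord0 - q ord0 ord0 = t%:C * Y ord0 ord0.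
    by rewrite !mxE addrAC subrr add0r.
  rewrite normcM normc_real YX0 exprMn real_normK ?num_real//.
  have tp : normc (t%:C * Y ord0 ord0) <= normc (q ord0 ord0 - p).
    rewrite normcM normc_real YX0; apply: ltW; apply: le_lt_trans t2; apply: le_trans tX.
    by rewrite ler_wpM2l//; exact: normc_le_enorm.
  have d1 : normc ((q + t%:C *: Y) ord0 ord0 - p) <= 2 * normc (q ord0 ord0 - p).
    rewrite !mxE addrAC; apply: (le_trans (ler_normcD _ _)); lra.
  have d2 : 0 < normc ((q + t%:C *: Y) ord0 ord0 - p).
    have : 0 < normc (q ord0 ord0 - p) - normc (t%:C * Y ord0 ord0).
      rewrite subr_gt0 normcM normc_real YX0; apply: le_lt_trans t2; apply: le_trans tX.
      by rewrite ler_wpM2l//; exact: normc_le_enorm.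
    move=> h; apply: lt_le_trans h _; rewrite lerBlDr.
    have := ler_normcB ((q + t%:C *: Y) ord0 ord0 - p) (t%:C * Y ord0 ord0).
    by rewrite !mxE addrAC addrK.
  have iv : (4 * normc (q ord0 ord0 - p) ^+ 2)^-1 <= (normc ((q + t%:C *: Y) ord0 ord0 - p) ^+ 2)^-1.
    rewrite lef_pV2 ?posrE ?mulr_gt0 ?exprn_gt0//.
    have -> : 4 * normc (q ord0 ord0 - p) ^+ 2 = (2 * normc (q ord0 ord0 - p)) ^+ 2 by ring.
    by rewrite lerXn2r ?nnegrE ?mulr_ge0 ?normc_ge0.
  have C0 : 0 <= sig ^+ 2 * normc (X ord0 ord0) ^+ 2 * t ^+ 2.
    by apply: mulr_ge0; [apply: mulr_ge0|]; exact: sqr_ge0.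
  have := ler_wpM2l C0 iv; congr (_ <= _); ring.
have [L1|L1] := leP L (levi v q X) => //; exfalso.
have e0 : 0 < L - levi v q X by rewrite subr_gt0.
have [d d0' H] := @levi_limit R n.+1 B1 v q X oB1 v_C2 B1q vq (fun w Hw => (andP (v01 Hw.2)).1) _ e0.
pose m := Num.min d (Num.min (r1 / (enorm X + 1)) (normc (q ord0 ord0 - p) / (enorm X + 1))).
have m0 : 0 < m by rewrite !lt_min d0' !divr_gt0.
pose t := m / 2.
have t0 : 0 < t by rewrite divr_gt0.
have : t < m by rewrite ltr_pdivrMr// ltr_pMr// ltr1n.
rewrite !lt_min -(gtr0_norm t0) => /andP[/H h /andP[ta tb]].
have h1 := low X t erefl erefl ta tb.
have iX : enorm ('i%C *: X) = enorm X by rewrite enormZ /= expr0n expr1n add0r sqrtr1 mul1r.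
have iX0 : normc (('i%C *: X) ord0 ord0) = normc (X ord0 ord0).
  by rewrite mxE normcM /= expr0n expr1n add0r sqrtr1 mul1r.
have h2 := low ('i%C *: X) t iX iX0 ta tb.
move: h; rewrite ler_norml => /andP[_ h].
have t2 : 0 < t ^+ 2 by rewrite exprn_gt0.
exact: (sum_lower_bounds_absurd h h1 h2 (mulr_gt0 e0 t2)).
Qed.

(** Cauchy-Schwarz between z - q and z + x b - q, whose product is affine in x and equals N z at x =
    0. *)
Let N_minorant z b (x : Cplx R) : 0 < N z ->
  N z * normc (1 + ((N z)^-1)%:C * hdot (z - q) b * x) ^+ 2 <= N (z + x *: b).
Proof.
move=> Nz.
have wE : z + x *: b - q = (z - q) + x *: b by rewrite addrAC.
have hE : hdot (z - q) (z + x *: b - q) = (N z)%:C * (1 + ((N z)^-1)%:C * hdot (z - q) b * x).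
  rewrite wE hdotD hdotZ hdotzz mulrDr mulr1 -/(N z); congr (_ + _).
  by rewrite !mulrA -rmorphM/= mulfV ?gt_eqF// mul1r mulrC.
have := hdot_le (z - q) (z + x *: b - q).
rewrite -(@ler_pXn2r _ 2) ?nnegrE ?mulr_ge0 ?normc_ge0 ?enorm_ge0// hE.
rewrite normcM normc_real gtr0_norm// !exprMn -/(N z) -/(N (z + x *: b)).
by rewrite expr2 -mulrA ler_pM2l.
Qed.

(** [v1] is the squared norm of the vector with entries A = sig (w_1 - q_1) / (w_1 - p) and w - q.
    Cauchy-Schwarz with the vector at z bounds it below by the modulus of a function rational in x,
    with denominator 1 + ga x; clearing this leaves the quadratic polynomial with coefficients [al]
    and [be]. *)
Let v1_minorant z b (x : Cplx R) (d := z ord0 ord0 - p)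
    (A0 := sig%:C * (z ord0 ord0 - q ord0 ord0) / d) (ga := b ord0 ord0 / d)
    (al := ((v1 z)^-1)%:C * (A0^*%C * (sig%:C * ga) + hdot (z - q) b + ga * (N z)%:C))
    (be := ((v1 z)^-1)%:C * (ga * hdot (z - q) b)) :
  d != 0 -> 0 < v1 z -> 1 + ga * x != 0 ->
  v1 z * normc (1 + al * x + be * x ^+ 2) ^+ 2 <= v1 (z + x *: b) * normc (1 + ga * x) ^+ 2.
Proof.
move=> d0' V0 gx.
have v1E w : v1 w = normc (sig%:C * (w ord0 ord0 - q ord0 ord0) / (w ord0 ord0 - p)) ^+ 2 + N w.
  by rewrite /v1 !normcM normcV normc_real (ger0_norm sig0) !exprMn exprVn.
pose w := z + x *: b.
pose A := sig%:C * (w ord0 ord0 - q ord0 ord0) / (w ord0 ord0 - p).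
have wp : w ord0 ord0 - p = d * (1 + ga * x).
  have dg : d * ga = b ord0 ord0 by rewrite /ga mulrC divfK.
  by rewrite mulrDr mulr1 mulrA dg /w /d !mxE addrAC [x * _]mulrC.
have wE : w - q = (z - q) + x *: b by rewrite /w addrAC.
have TE : (1 + ga * x) * (A0^*%C * A + hdot (z - q) (w - q)) =
   (v1 z)%:C * (1 + al * x + be * x ^+ 2).
  have gA : (1 + ga * x) * A = A0 + sig%:C * ga * x.
    have -> : A = sig%:C * (w ord0 ord0 - q ord0 ord0) / d / (1 + ga * x) by rewrite /A wp invfM mulrA.
    rewrite mulrC divfK// /A0 /ga.
    have -> : w ord0 ord0 - q ord0 ord0 = (z ord0 ord0 - q ord0 ord0) + x * b ord0 ord0.
      by rewrite /w !mxE addrAC.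
    by ring.
  have cA : A0^*%C * A0 = (normc A0 ^+ 2)%:C.
    case: (A0) => x1 y1; rewrite normc_sqr; apply/eqP; rewrite eq_complex/=.
    by apply/andP; split; apply/eqP; ring.
  have Vi : (v1 z)%:C * ((v1 z)^-1)%:C = 1 :> Cplx R by rewrite -rmorphM/= mulfV ?gt_eqF.
  have VE : (v1 z)%:C = A0^*%C * A0 + (N z)%:C by rewrite cA -rmorphD /A0 -v1E.
  set h := hdot (z - q) b.
  have hE : hdot (z - q) (w - q) = (N z)%:C + x * h by rewrite wE hdotD hdotZ hdotzz.
  rewrite hE.
  have -> : (1 + ga * x) * (A0^*%C * A + ((N z)%:C + x * h)) =
     A0^*%C * ((1 + ga * x) * A) + (1 + ga * x) * ((N z)%:C + x * h) by ring.
  rewrite gA /al /be -/h.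
  have -> : (v1 z)%:C * (1 + ((v1 z)^-1)%:C * (A0^*%C * (sig%:C * ga) + h + ga * (N z)%:C) * x
      + ((v1 z)^-1)%:C * (ga * h) * x ^+ 2) =
     (v1 z)%:C + ((v1 z)%:C * ((v1 z)^-1)%:C) * ((A0^*%C * (sig%:C * ga) + h + ga * (N z)%:C) * x
      + ga * h * x ^+ 2) by ring.
  by rewrite Vi VE; ring.
have T1 : normc (A0^*%C * A + hdot (z - q) (w - q)) ^+ 2 <= v1 z * v1 w.
  rewrite !v1E -/A -/A0.
  have h1 : normc (A0^*%C * A + hdot (z - q) (w - q)) <= normc A0 * normc A + enorm (z - q) * enorm (w - q).
    apply: (le_trans (ler_normcD _ _)); rewrite normcM normc_conj lerD2l; exact: hdot_le.
  (* Cauchy-Schwarz in dimension 2, by Lagrange's identity. *)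
  have h2 : (normc A0 * normc A + enorm (z - q) * enorm (w - q)) ^+ 2 <=
      (normc A0 ^+ 2 + N z) * (normc A ^+ 2 + N w).
    rewrite /N -subr_ge0.
    have -> : (normc A0 ^+ 2 + enorm (z - q) ^+ 2) * (normc A ^+ 2 + enorm (w - q) ^+ 2) -
       (normc A0 * normc A + enorm (z - q) * enorm (w - q)) ^+ 2 =
       (normc A0 * enorm (w - q) - enorm (z - q) * normc A) ^+ 2 by ring.
    exact: sqr_ge0.
  apply: le_trans h2; rewrite lerXn2r ?nnegrE ?normc_ge0//.
  by apply: le_trans h1; exact: normc_ge0.
have := ler_wpM2r (sqr_ge0 (normc (1 + ga * x))) T1.
rewrite -exprMn -normcM mulrC TE.
rewrite normcM normc_real gtr0_norm// exprMn expr2 -!mulrA ler_pM2l//.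
Qed.

Let ln_v2 w : 0 < N w -> ln (v2 w / M) = ln 2 + ln (N w) + eta * (ln (N w) - ln (tau ^+ 2)) - ln M.
Proof.
move=> Nw; rewrite /v2; set E := expR _.
have E0 : 0 < E by exact: expR_gt0.
have N20 : 0 < 2 * N w by exact: mulr_gt0.
have NE0 : 0 < 2 * N w * E by exact: mulr_gt0.
have iM : 0 < M^-1 by rewrite invr_gt0.
rewrite [ln (_ / M)]lnM ?posrE// lnV ?posrE//.
rewrite [ln (_ * E)]lnM ?posrE// [ln (2 * _)]lnM ?posrE//.
by rewrite /E expRK.
Qed.

Let Qc : R := 2 * expR 1 + 1 + sig ^+ 2 / c1 ^+ 2.

Let Qc0 : 0 < Qc.
Proof.
have h : 0 <= sig ^+ 2 / c1 ^+ 2 by apply: divr_ge0; exact: sqr_ge0.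
by have := expR_gt0 (1 : R); rewrite /Qc; lra.
Qed.

(** Where v exceeds the truncation level, this keeps z away from q, so that the coefficient of
    [N_minorant], which contains 1 / N, is bounded on the disc. *)
Let vN z : D z -> v z * M <= Qc * N z.
Proof.
move=> Dz; have Nz := N0 z; have e1 := expR_gt0 (1 : R).
have h : 0 <= sig ^+ 2 / c1 ^+ 2 by apply: divr_ge0; exact: sqr_ge0.
have hN : 0 <= sig ^+ 2 / c1 ^+ 2 * N z by exact: (mulr_ge0 h Nz).
have eN : 0 <= expR 1 * N z by exact: (mulr_ge0 (ltW e1) Nz).
rewrite /Qc 2!mulrDl; have [->|[-> zt]] := v_cases Dz; rewrite divfK ?gt_eqF//.
  by apply: le_trans (v2_le Dz) _; lra.
have zt2 : enorm (z - q) < 2 * tau by have := ltW tau0; lra.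
have [h1 _] := polar_far Dz zt2.
have : sig ^+ 2 * normc (z ord0 ord0 - q ord0 ord0) ^+ 2 / normc (z ord0 ord0 - p) ^+ 2
   <= sig ^+ 2 / c1 ^+ 2 * N z.
  rewrite -mulrA -mulrA ler_wpM2l ?sqr_ge0// mulrC; apply: ler_pM; rewrite ?sqr_ge0 ?invr_ge0 ?sqr_ge0//.
    rewrite lef_pV2 ?posrE ?exprn_gt0//; last exact: lt_le_trans h1.
    by rewrite lerXn2r ?nnegrE ?normc_ge0 ?(ltW c10).
  rewrite lerXn2r ?nnegrE ?normc_ge0 ?enorm_ge0//.
  by have := normc_le_enorm (z - q) ord0; rewrite !mxE.
by rewrite /v1; lra.
Qed.

(** The branch is chosen by the value of v at the centre alone; on the circle v is at least that
    same branch, whose polynomial minorant feeds [cmean_minorant]. *)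
Let v_local a b : (forall l : Cplx R, normc l <= 1 -> D (a + l *: b)) ->
  forall e : R, 0 < e -> exists M' s0 : R, 0 < s0 /\
     forall (l : Cplx R) (s : R), 0 < s -> s <= s0 -> normc l + s <= 1 ->
     lntr e (v (a + l *: b)) <=
     cmean (fun t => lntr e (v (a + (l + s%:C * circ t) *: b))) + M' * s ^+ 3.
Proof.
move=> disc e e0.
pose n0 := e * M / Qc.
have eM : 0 < e * M by rewrite mulr_gt0.
have n00 : 0 < n0 by rewrite divr_gt0.
pose nb := enorm b.
have nb0 : 0 <= nb by exact: enorm_ge0.
(* [A1] bounds [ga], [A2] the coefficient [al] of the branch [v2], [A3] and [A4] the coefficients
   [al] and [be] of the branch [v1]; the sum [A] bounds them all. *)
pose A1 := nb / c1.
pose A2 := nb / Num.sqrt n0.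
pose A3 := (tau * (sig * (nb / c1)) + d0 * nb + nb / c1 * d0 ^+ 2) / (e * M).
pose A4 := nb / c1 * (d0 * nb) / (e * M).
have A10 : 0 <= A1 by rewrite divr_ge0 ?(ltW c10).
have A20 : 0 <= A2 by rewrite divr_ge0 ?sqrtr_ge0.
have A30 : 0 <= A3.
  apply: divr_ge0; last exact: ltW.
  apply: addr_ge0; last by rewrite mulr_ge0 ?sqr_ge0.
  by apply: addr_ge0; rewrite mulr_ge0 ?(ltW tau0) ?(ltW d00)// mulr_ge0.
have A40 : 0 <= A4 by rewrite divr_ge0 ?(ltW eM)// mulr_ge0// mulr_ge0// ltW.
pose A := A1 + A2 + A3 + A4.
have [Age [A1A A2A A3A A4A]] := ler_sum4 A10 A20 A30 A40; rewrite -/A in Age A1A A2A A3A A4A.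
have K0 : 0 <= 240 * A ^+ 3 + 3 * A ^+ 2 by exact: cubic_ge0.
pose K := 240 * A ^+ 3 + 3 * A ^+ 2.
(* The bounds on s give s <= 1, 16 A s <= 1, and s |b| < tau, so that the circle around a centre
   within tau of q stays within 2 tau. *)
exists ((2 + eta) * K), (Num.min (Num.min 1 (16 * A + 1)^-1) (tau / (nb + 1))).
have A16 : 0 < 16 * A + 1 by rewrite ltr_wpDl ?mulr_ge0.
have nb1 : 0 < nb + 1 by rewrite ltr_wpDl.
split; first by rewrite !lt_min ltr01 invr_gt0 A16 divr_gt0.
move=> l s s0; rewrite !le_min => /andP[/andP[s1 sA]]; rewrite ler_pdivlMr// => snb ls.
have sA' : 16 * A * s <= 1.
  have : s * (16 * A + 1) <= 1 by rewrite -ler_pdivlMr// mul1r.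
  by lra.
have l1 : normc l <= 1 by have := ltW s0; lra.
pose z0 := a + l *: b.
have Dz0 : D z0 by exact: disc.
pose w t := z0 + (s%:C * circ t) *: b.
have wE t : a + (l + s%:C * circ t) *: b = w t by rewrite /w /z0 scalerDl addrA.
have zn t : normc (s%:C * circ t : Cplx R) = s.
  by rewrite normcM circ_norm mulr1 normc_real gtr0_norm.
have Dw t : D (w t).
  rewrite -wE; apply: disc; apply: (le_trans (ler_normcD _ _)); rewrite zn//.
pose g t := lntr e (v (w t)).
have cg : continuous g.
  move=> t; apply: (@continuous_comp R R R (fun t => v (w t)) (lntr e)); last exact: continuous_lntr.
  apply: (@continuous_comp R (Cn R n.+1) R w v); last exact/cv/Dw.
  apply: (@continuous_comp R (Cplx R) (Cn R n.+1) (fun t => s%:C * circ t) (fun x => z0 + x *: b)).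
    by apply: cvgM; [exact: cvg_cst|exact: continuous_circ].
  exact: continuous_line.
rewrite (@eq_cmean _ _ g); last by move=> t; rewrite wE.
have s3 : 0 <= s ^+ 3 by rewrite exprn_ge0// ltW.
have Ks : 0 <= K * s ^+ 3 by exact: mulr_ge0.
have MK : 0 <= (2 + eta) * K * s ^+ 3.
  by rewrite -mulrA mulr_ge0// addr_ge0// ltW.
(* Below the level, the centre already has the least value ln e of the truncated logarithm. *)
have [vz|vz] := leP (v z0) e.
  rewrite /lntr max_r//; apply: (@le_trans _ _ (cmean g)); last by rewrite lerDl.
  rewrite -(cmean_cst (ln e)); apply: le_cmean => //; first exact: cst_continuous.
  by move=> t; exact: lntr_ge.
have vz0 : 0 < v z0 by exact: lt_trans vz.
rewrite /lntr max_l ?(ltW vz)//.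
have Nz : n0 <= N z0.
  rewrite /n0 ler_pdivrMr// [N z0 * _]mulrC; apply: le_trans (vN Dz0).
  by rewrite ler_pM2r// ltW.
have Nzp : 0 < N z0 by exact: lt_le_trans Nz.
have small (al be : Cplx R) t : normc al <= A -> normc be <= A ->
    0 < normc (1 + al * (s%:C * circ t) + be * (s%:C * circ t) ^+ 2).
  move=> hal hbe; rewrite -addrA; apply: normc_1D_gt0.
  apply: (le_lt_trans (ler_normcD _ _)); rewrite (normcM al) (normcM be) normcX zn.
  have h1 : normc al * s <= A * s by rewrite ler_pM2r.
  have h2 : normc be * s ^+ 2 <= A * s.
    apply: ler_pM; rewrite ?normc_ge0 ?sqr_ge0//.
    by rewrite expr2 ler_piMr// ltW.
  by lra.
have h00 : normc (0 : Cplx R) <= A by rewrite normc0.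
have [vE|[vE zt]] := v_cases Dz0.
  pose al := ((N z0)^-1)%:C * hdot (z0 - q) b.
  have hal : normc al <= A.
    apply: le_trans A2A.
    rewrite /al normcM normc_real gtr0_norm ?invr_gt0//.
    have ez : 0 < enorm (z0 - q).
      by rewrite lt0r enorm_ge0 andbT; apply: contraTN Nzp; rewrite /N => /eqP->; rewrite expr0n ltxx.
    rewrite mulrC ler_pdivrMr//; apply: (le_trans (hdot_le _ _)).
    rewrite /A2 /N -/nb mulrC -mulrA ler_wpM2l// ler_pdivlMl ?sqrtr_gt0//.
    rewrite expr2 ler_pM2r// -(ger0_norm (ltW ez)) -sqrtr_sqr ler_wsqrtr//.
  have := @cmean_minorant R A (1 + eta) 0 s (ln (v z0)) al 0 0 g Age _ _ s0 s1 sA' hal h00 h00 cg _.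
  move=> H; apply: (le_trans (H _ _ _)) => //.
  - by rewrite addr_ge0// ltW.
  - move=> t; rewrite [0 * ln _]mul0r subr0.
    have P0 := small al 0 t hal h00.
    have := N_minorant b (s%:C * circ t) Nzp; rewrite -/(w t) -/al => Nw.
    move: P0 Nw; rewrite mul0r addr0; set P := normc _ => P0 Nw.
    have P20 : 0 < P ^+ 2 by rewrite exprn_gt0.
    have Nwp : 0 < N (w t) by apply: lt_le_trans Nw; exact: mulr_gt0.
    have vw : 0 < v2 (w t) / M.
      by apply: divr_gt0 => //; apply: mulr_gt0; [exact: mulr_gt0|exact: expR_gt0].
    apply: (@le_trans _ _ (ln (v2 (w t) / M))); last first.
      have vp : 0 < v (w t) by apply: lt_le_trans vw _; exact: v_ge2.
      apply: (@le_trans _ _ (ln (v (w t)))); last exact: lntr_ge_ln.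
      exact: (ler_ln_pos vw (v_ge2 (w t))).
    exact: (ler_power_branch (etrans (congr1 (@ln R) vE) (ln_v2 Nzp)) (ln_v2 Nwp)
      (ltW eta0) (ln_mul_le Nzp P20 Nw)).
  - exact: (ler_error_term _ (or_introl erefl) (ltW eta0) Ks).
have d1 : c1 <= normc (z0 ord0 ord0 - p) /\ sig * normc (z0 ord0 ord0 - q ord0 ord0) <= tau * normc (z0 ord0 ord0 - p).
  by apply: polar_far => //; have := ltW tau0; lra.
case: d1 => d1 d2.
pose d := z0 ord0 ord0 - p.
have dp : 0 < normc d by exact: lt_le_trans d1.
have dn : d != 0 by rewrite -normc_eq0 gt_eqF.
pose A0 := sig%:C * (z0 ord0 ord0 - q ord0 ord0) / d.
pose ga := b ord0 ord0 / d.
pose al := ((v1 z0)^-1)%:C * (A0^*%C * (sig%:C * ga) + hdot (z0 - q) b + ga * (N z0)%:C).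
pose be := ((v1 z0)^-1)%:C * (ga * hdot (z0 - q) b).
have V1 : e * M < v1 z0 by rewrite -ltr_pdivlMr// -vE.
have V1p : 0 < v1 z0 by exact: lt_trans V1.
have ga1 : normc ga <= A1.
  rewrite /ga normcM normcV; apply: ler_pM; rewrite ?normc_ge0 ?invr_ge0 ?normc_ge0//.
    exact: normc_le_enorm.
  by rewrite lef_pV2 ?posrE.
have A01 : normc A0 <= tau.
  by rewrite /A0 !normcM normcV normc_real (ger0_norm sig0) ler_pdivrMr.
have hd1 : normc (hdot (z0 - q) b) <= d0 * nb.
  apply: (le_trans (hdot_le _ _)); rewrite ler_wpM2r//; exact: bounded.
have hga : normc ga <= A by exact: le_trans A1A.
have hal : normc al <= A.
  apply: le_trans A3A.
  rewrite /al normcM normc_real gtr0_norm ?invr_gt0// mulrC.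
  apply: ler_pM; rewrite ?normc_ge0 ?invr_ge0 ?(ltW V1p)//; last first.
    by rewrite lef_pV2 ?posrE// ltW.
  apply: (le_trans (ler_normcD _ _)); apply: lerD.
    apply: (le_trans (ler_normcD _ _)); apply: lerD => //.
    rewrite normcM normc_conj [normc (sig%:C * _)]normcM normc_real (ger0_norm sig0).
    apply: ler_pM => //; [exact: normc_ge0|by apply: mulr_ge0 => //; exact: normc_ge0|].
    exact: ler_wpM2l.
  rewrite normcM normc_real ger0_norm//; apply: ler_pM; rewrite ?normc_ge0//.
  exact: N_d0.
have hbe : normc be <= A.
  apply: le_trans A4A.
  rewrite /be normcM normc_real gtr0_norm ?invr_gt0// mulrC.
  apply: ler_pM; rewrite ?normc_ge0 ?invr_ge0 ?(ltW V1p)//; last first.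
    by rewrite lef_pV2 ?posrE// ltW.
  by rewrite normcM; apply: ler_pM; rewrite ?normc_ge0.
have := @cmean_minorant R A 1 1 s (ln (v z0)) al be ga g Age ler01 ler01 s0 s1 sA' hal hbe hga cg _.
move=> H; apply: (le_trans (H _)) => //.
- move=> t.
  have P1 := small al be t hal hbe.
  have P2 := small ga 0 t hga h00; rewrite mul0r addr0 in P2.
  have gx : 1 + ga * (s%:C * circ t) != 0 by rewrite -normc_eq0 gt_eqF.
  have := v1_minorant dn V1p gx; rewrite -/A0 -/ga -/al -/be -/(w t) => vw.
  have p1 : 0 < normc (1 + al * (s%:C * circ t) + be * (s%:C * circ t) ^+ 2) ^+ 2 by rewrite exprn_gt0.
  have p2 : 0 < normc (1 + ga * (s%:C * circ t)) ^+ 2 by rewrite exprn_gt0.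
  have vwp : 0 < v1 (w t).
    by rewrite -(pmulr_lgt0 _ p2); apply: lt_le_trans vw; exact: mulr_gt0.
  have wt2 : enorm (w t - q) < 2 * tau.
    have : enorm (w t - q) <= enorm (z0 - q) + s * nb.
      by rewrite /w addrAC; apply: (le_trans (ler_enormD _ _)); rewrite enormZ zn.
    by move=> h; exact: (double_radius h zt snb s0).
  have vM : 0 < v1 (w t) / M by rewrite divr_gt0.
  have vg := v_ge1 wt2.
  apply: (@le_trans _ _ (ln (v1 (w t) / M))); last first.
    have vp : 0 < v (w t) by exact: lt_le_trans vg.
    apply: (@le_trans _ _ (ln (v (w t)))); last exact: lntr_ge_ln.
    exact: (ler_ln_pos vM vg).
  have hx : ln (v1 z0) + ln (normc (1 + al * (s%:C * circ t) + be * (s%:C * circ t) ^+ 2) ^+ 2) <=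
      ln (v1 (w t)) + ln (normc (1 + ga * (s%:C * circ t)) ^+ 2).
    apply: (le_trans (ln_mul_le V1p p1 vw)); rewrite lnM ?posrE//.
  exact: (ler_polar_branch (etrans (congr1 (@ln R) vE) (ln_mulV V1p M0)) (ln_mulV vwp M0) hx).
- exact: (ler_error_term _ (or_intror erefl) (ltW eta0) Ks).
Qed.

Lemma sibony_ge_candidate X :
  ((Num.sqrt ((sig ^+ 2 * normc (X ord0 ord0) ^+ 2 / (4 * normc (q ord0 ord0 - p) ^+ 2)
     + enorm X ^+ 2) / M))%:E <= sibony D q X)%E.
Proof.
apply: (@le_trans _ _ (Num.sqrt (levi v q X))%:E).
  by rewrite lee_fin ler_wsqrtr//; exact: levi_v.
apply: ereal_sup_ubound; exists v => //; split=> //.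
- exact: psh_of_local v01 cv v_local.
- by exists B1; split.
Qed.

End Candidate.

(** * The domain near the origin *)

Section ModelFunction.
Variables (R : realType) (f : R -> R).
Hypothesis f_cont : {within [set` `[0, +oo[], continuous f}.
Hypothesis f0 : f 0 = 0.
Hypothesis f_incr : forall s t : R, 0 < s -> s <= t -> f s / s <= f t / t.

(** The intermediate value theorem gives a solution, so [xget] returns one. If it were above t1, the
    slope f (t) / t would have decreased, as d < f t1. *)
Lemma finv_spec (t1 d : R) : 0 < t1 -> 0 < d -> d < f t1 ->
  [/\ 0 < Defs.finv f d, f (Defs.finv f d) = d & Defs.finv f d <= t1].
Proof.
move=> t10 d0 dt1.
have c1 : {within `[0, t1], continuous f}.
  by apply: continuous_subspaceW f_cont => x /=; rewrite !in_itv/= => /andP[->].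
have [t tI ft] : exists2 t, t \in `[0, t1] & f t = d.
  apply: IVT => //; first exact: ltW.
  by rewrite f0 ge_min le_max (ltW d0) (ltW dt1) orbT.
have tp : 0 < t.
  move: tI; rewrite in_itv/= => /andP[t0 _]; rewrite lt0r t0 andbT.
  by apply/eqP => t00; rewrite t00 f0 in ft; rewrite ft ltxx in d0.
have [s0 fs] : 0 < Defs.finv f d /\ f (Defs.finv f d) = d.
  by rewrite /Defs.finv; case: xgetP => [x _ //|/(_ t)[]].
split=> //; rewrite leNgt; apply/negP => ts.
have := f_incr t10 (ltW ts); rewrite fs ler_pdivrMr// mulrAC ler_pdivlMr//.
have : d * t1 < f t1 * Defs.finv f d by apply: ltr_pM => //; exact: ltW.
lra.
Qed.

(** With [f_ge_chord], the form in which the hypothesis on f enters: the graph lies below its chord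
    from the origin up to t, and above it beyond t. *)
Lemma f_le_chord s t : 0 < t -> 0 <= s -> s <= t -> f s <= s / t * f t.
Proof.
move=> t0 s0 st; have [->|sn] := eqVneq s 0; first by rewrite f0 !mul0r.
have sp : 0 < s by rewrite lt0r sn.
by have := f_incr sp st; rewrite ler_pdivrMr//; lra.
Qed.

Lemma f_ge_chord s t : 0 < t -> t <= s -> s / t * f t <= f s.
Proof.
move=> t0 ts; have sp : 0 < s by exact: lt_le_trans ts.
by have := f_incr t0 ts; rewrite ler_pdivlMr//; lra.
Qed.

End ModelFunction.

Section Tail.
Variables (R : realType) (n : nat).
Implicit Types (z w : Cn R n.+1).

Lemma enorm_tail_sqr z : enorm z ^+ 2 = normc (z ord0 ord0) ^+ 2 + enorm (tail z) ^+ 2.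
Proof.
rewrite !/(enorm _) !sqr_sqrtr ?sumr_ge0// => [|i _|i _]; rewrite ?sqr_ge0//.
by rewrite big_ord_recl; congr (_ + _); apply: eq_bigr => i _; rewrite mxE.
Qed.

Lemma enorm_tail_le z : enorm (tail z) <= enorm z.
Proof.
rewrite -(ler_pXn2r (_ : 0 < 2)%N)// ?nnegrE ?sqrtr_ge0//.
by rewrite enorm_tail_sqr lerDr sqr_ge0.
Qed.

Lemma tailD z w : tail (z + w) = tail z + tail w.
Proof. by apply/rowP => i; rewrite !mxE. Qed.

Lemma tailZ (l : Cplx R) z : tail (l *: z) = l *: tail z.
Proof. by apply/rowP => i; rewrite !mxE. Qed.

Lemma tail_q (d : R) : tail (q n d) = 0.
Proof. by apply/rowP => i; rewrite !mxE/= mulr0. Qed.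

Lemma q_ord0 (d : R) : q n d ord0 ord0 = (- d)%:C.
Proof. by rewrite !mxE eqxx mulr1. Qed.

Lemma enorm_q (d : R) : 0 <= d -> enorm (q n d) = d.
Proof.
move=> d0; apply/eqP; rewrite -(eqrXn2 (_ : 0 < 2)%N) ?sqrtr_ge0//.
rewrite enorm_tail_sqr tail_q q_ord0 normc_real normrN (ger0_norm d0).
rewrite /enorm big1 ?sqrtr0 ?expr0n ?addr0// => i _.
by rewrite mxE normc0 expr0n.
Qed.

End Tail.

Lemma bounded_enorm (R : realType) n (D : set (Cn R n.+1)) : bounded_set D ->
  exists2 E : R, 0 < E & forall z, D z -> enorm z <= E.
Proof.
move=> [M [Mr hM]].
have M1 : M < `|M| + 1 by rewrite (le_lt_trans (real_ler_norm Mr))// ltrDl.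
have /ltcR0[e e0 eE] : 0 < `|M| + 1 by rewrite ltr_wpDl.
exists (n.+2%:R * e); first by rewrite mulr_gt0.
move=> z Dz; apply: enorm_le_bound => [|j]; first exact: ltW.
have := hM _ M1 _ Dz; rewrite eE => h.
have : `|z ord0 j| <= e%:C.
  apply: le_trans h; rewrite [leRHS]mx_normE -[leLHS]nngE num_le.
  exact: (le_bigmax _ _ (ord0, j)).
by rewrite norm_normcE lecR.
Qed.

(** For y <= d the left side is at most - d / 2 < 0 <= F; for y <= F it is at most - d + F / 2 <
    F. *)
Lemma lt_of_margin (R : realFieldType) (a k d y F : R) :
  a <= - d + k -> k <= y / 2 -> 0 < d -> 0 <= F -> 0 <= y -> y <= Num.max d F -> a < F.
Proof. by rewrite le_max => h1 h2 h3 h4 h5 /orP[]; lra. Qed.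

(** * A cone inside D at q, and the pole outside D *)

Section LocalModel.
Variables (R : realType) (n : nat) (f : R -> R) (D : set (Cn R n.+1)).
Variables (C r0 t d : R) (h : Cn R n.+1 -> R).
Hypothesis f0 : f 0 = 0.
Hypothesis f_incr : forall s t : R, 0 < s -> s <= t -> f s / s <= f t / t.
Hypotheses (C0 : 0 < C) (t0 : 0 < t) (d0 : 0 < d) (ft : f t = d).
Hypothesis hC : forall z, enorm z < r0 -> `|h z| <= C * `|complex.Im (z ord0 ord0)|.
Hypothesis D_near : forall z, enorm z < r0 ->
  D z <-> complex.Re (z ord0 ord0) + h z < f (enorm (tail z)).
Hypothesis f_ge0 : forall t : R, 0 <= t -> 0 <= f t.
Implicit Types (z : Cn R n.+1).

Lemma h_le z (x : R) : enorm z < r0 -> `|h z| <= C * normc (z ord0 ord0 - x%:C).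
Proof.
move=> /hC/le_trans; apply; rewrite ler_pM2l//.
have -> : complex.Im (z ord0 ord0) = complex.Im (z ord0 ord0 - x%:C).
  by case: (z ord0 ord0) => a b /=; rewrite oppr0 addr0.
exact: Im_le_normc.
Qed.

Lemma Re_near z (x : R) : `|complex.Re (z ord0 ord0) - x| <= normc (z ord0 ord0 - x%:C).
Proof.
have -> : complex.Re (z ord0 ord0) - x = complex.Re (z ord0 ord0 - x%:C).
  by case: (z ord0 ord0).
exact: Re_le_normc.
Qed.

(** The key is r d / t <= max (d, f r) with r = |z'|: for r <= t the margin d of q is available, and
    beyond t the function f has outgrown its chord. This gives a cone with vertex q whose size does
    not depend on d. *)
Lemma mem_model z : enorm z < r0 ->
  2 * (1 + C) * t * normc (z ord0 ord0 + d%:C) <= d * enorm (tail z) -> D z.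
Proof.
move=> zr H; apply/(D_near zr).
have := Re_near z (- d); have := @h_le z (- d) zr.
rewrite raddfN opprK; set x : R := normc _ in H *; set r : R := enorm (tail z) in H *.
rewrite opprK => h1 h2.
have {}H : (1 + C) * x <= r / t * d / 2.
  rewrite ler_pdivlMr// -(ler_pM2l t0).
  have -> : t * (r / t * d) = d * r by rewrite mulrA (mulrCA t) divff ?gt_eqF// mulr1 mulrC.
  by apply: le_trans H; rewrite le_eqVlt; apply/orP; left; apply/eqP; ring.
have h3 : complex.Re (z ord0 ord0) + h z <= - d + (1 + C) * x.
  have := ler_norm (h z); have := ler_norm (complex.Re (z ord0 ord0) + d); lra.
have r0' : 0 <= r by exact: sqrtr_ge0.
have y0 : 0 <= r / t * d by rewrite mulr_ge0 ?divr_ge0// ltW.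
apply: (lt_of_margin h3 H d0 (f_ge0 r0') y0); rewrite le_max.
have [rt|tr] := leP r t; apply/orP; [left|right].
  by rewrite ger_pMl// ler_pdivrMr// mul1r.
by rewrite -ft; exact: f_ge_chord (ltW tr).
Qed.

(** For |z'| <= t / 2 the chord bound gives f <= d / 2, whereas the defining expression is at least
    d - (1 + C) |z_1 - d|. *)
Lemma far_from_pole z : D z -> enorm z < r0 -> 2 * enorm (tail z) <= t ->
  d < 2 * (1 + C) * normc (z ord0 ord0 - d%:C).
Proof.
move=> Dz zr rt; have := (D_near zr).1 Dz.
have := Re_near z d; have := @h_le z d zr.
set x : R := normc _; set r : R := enorm (tail z) in rt *.
have r0' : 0 <= r by exact: sqrtr_ge0.
have : f r <= d / 2.
  apply: le_trans (f_le_chord f0 f_incr t0 r0' _) _; first by lra.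
  by rewrite ft mulrC ler_pM2l// ler_pdivrMr//; lra.
rewrite !ler_norml => h1 /andP[h2 h2'] /andP[h3 h3'] h4; lra.
Qed.

End LocalModel.

Lemma enorm_delta (R : realType) n (j : 'I_n) : enorm (delta_mx ord0 j : Cn R n) = 1.
Proof.
rewrite /enorm (bigD1 j)//= big1 => [|i ij]; rewrite mxE ?eqxx ?(negPf ij) ?andbF/=.
  by rewrite !expr0n !(addr0, expr1n, sqrtr1).
by rewrite !expr0n !(addr0, sqrtr0) expr0n.
Qed.

Lemma tail_delta (R : realType) n (j : 'I_n) :
  tail (delta_mx ord0 (lift ord0 j) : Cn R n.+1) = delta_mx ord0 j.
Proof. by apply/rowP => i; rewrite !mxE (inj_eq lift_inj). Qed.

(** * The upper estimate *)

Section LocalEstimates.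
Variables (R : realType) (n : nat) (f : R -> R) (D : set (Cn R n.+1)).
Variables (C r0 t d : R) (h : Cn R n.+1 -> R).
Hypothesis f0 : f 0 = 0.
Hypothesis f_incr : forall s t : R, 0 < s -> s <= t -> f s / s <= f t / t.
Hypothesis f_ge0 : forall t : R, 0 <= t -> 0 <= f t.
Hypotheses (C0 : 0 < C) (t0 : 0 < t) (d0 : 0 < d) (ft : f t = d).
Hypothesis hC : forall z, enorm z < r0 -> `|h z| <= C * `|complex.Im (z ord0 ord0)|.
Hypothesis D_near : forall z, enorm z < r0 ->
  D z <-> complex.Re (z ord0 ord0) + h z < f (enorm (tail z)).
Hypotheses (oD : open D) (dr0 : d < r0 / 2).
Implicit Types (z X : Cn R n.+1).

Let mem z := mem_model f_incr C0 t0 d0 ft hC D_near f_ge0 (z := z).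

Let r00 : 0 < r0.
Proof. by have := lt_trans d0 dr0; rewrite pmulr_lgt0// invr_gt0. Qed.

Lemma D_q : D (q n d).
Proof.
apply: mem; first by rewrite enorm_q ?ltW//; move: dr0 d0; lra.
rewrite q_ord0 rmorphN addNr normc0 mulr0.
exact: mulr_ge0 (ltW d0) (enorm_ge0 _).
Qed.

(** The tangential vector b tilts every X + e^{ia} b into the cone of [mem_model]; membership there
    is homogeneous in l, so only the radius r0 limits the disc. *)
Lemma azukawa_model_le (j : 'I_n) X :
  (azukawa D (q n d) X <=
     (8 * (1 + C) / r0 * (t / d * normc (X ord0 ord0) + enorm X))%:E)%E.
Proof.
apply/lee_addgt0Pr => e e0.
pose x : R := normc (X ord0 ord0); pose k := 2 * (1 + C) * (t / d * x).
have x0 : 0 <= x by exact: normc_ge0.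
have k0 : 0 <= k by rewrite !mulr_ge0 ?addr_ge0 ?invr_ge0 ?(ltW C0) ?(ltW t0) ?(ltW d0).
have X0 := enorm_ge0 X.
(* Since |X'| <= |X|, the length s of b makes the tangential part of X + e^{ia} b exceed k, which is
   the cone condition. The surplus [ee] keeps s positive when X = 0 and costs 4 ee / r0 = e in the
   end. *)
pose ee := e * r0 / 4; have ee0 : 0 < ee by rewrite divr_gt0 ?mulr_gt0.
pose s := k + enorm X + ee.
have s0 : 0 < s by rewrite /s; lra.
pose b : Cn R n.+1 := s%:C *: delta_mx ord0 (lift ord0 j).
have eb a : enorm (circ a *: b) = s.
  by rewrite !enormZ circ_norm normc_real gtr0_norm// enorm_delta mul1r mulr1.
have etb a : enorm (tail (circ a *: b)) = s.
  by rewrite !tailZ tail_delta !enormZ circ_norm normc_real gtr0_norm// enorm_delta mul1r mulr1.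
have Y1 a : (X + circ a *: b) ord0 ord0 = X ord0 ord0.
  by rewrite !mxE/= !mulr0 addr0.
have Yt a : k < enorm (tail (X + circ a *: b)).
  have := ler_enormB (tail (X + circ a *: b)) (tail X).
  rewrite tailD [_ + _ - _]addrAC subrr add0r etb -tailD.
  have := enorm_tail_le X; rewrite /s; lra.
have Y2 a : enorm (X + circ a *: b) <= 2 * s.
  by have := ler_enormD X (circ a *: b); rewrite eb /s; lra.
(* As |X + e^{ia} b| <= 2 s, this radius moves q by at most r0 / 2, and |q| = d < r0 / 2. *)
have rho0 : 0 < r0 / (4 * s) by rewrite divr_gt0 ?mulr_gt0.
apply: (@le_trans _ _ ((r0 / (4 * s))^-1)%:E).
  apply: (azukawa_le (b := b)) => //; first exact: D_q.
    by move=> a; apply: lt_le_trans (enorm_tail_le _); exact: le_lt_trans (Yt a).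
  move=> a l lr; set Y := X + _; apply: mem.
    apply: (le_lt_trans (ler_enormD _ _)); rewrite enorm_q ?ltW// enormZ.
    have : normc l * enorm Y <= r0 / (4 * s) * (2 * s).
      by apply: ler_pM => //; [exact: normc_ge0|exact: enorm_ge0|exact: Y2].
    have -> : r0 / (4 * s) * (2 * s) = r0 / 2 by field; rewrite gt_eqF.
    move: dr0; lra.
  have -> : (q n d + l *: Y) ord0 ord0 + d%:C = l * X ord0 ord0.
    by rewrite mxE [(l *: Y) _ _]mxE q_ord0 Y1 addrAC rmorphN addNr add0r.
  rewrite tailD tail_q add0r tailZ enormZ normcM mulrCA [d * _]mulrCA ler_wpM2l ?normc_ge0//.
  rewrite -/x -ler_pdivrMl//; apply: le_trans (ltW (Yt a)).
  by rewrite /k le_eqVlt; apply/orP; left; apply/eqP; ring.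
rewrite -EFinD lee_fin -/x invf_div ler_pdivrMr// [leRHS]mulrDl.
have -> : 8 * (1 + C) / r0 * (t / d * x + enorm X) * r0 = 4 * k + 8 * (1 + C) * enorm X.
  by rewrite /k; field; rewrite !gt_eqF.
have : 0 <= C * enorm X by rewrite mulr_ge0// ltW.
rewrite /s /ee; lra.
Qed.

End LocalEstimates.

(** By (u + w)^2 <= 2 (u^2 + w^2); it turns the square root of the Levi form into the linear
    expression [B]. *)
Lemma linear_le_sqrt (R : rcfType) (k M c u w : R) : 0 < k -> k <= 1 -> 0 < M ->
  1 <= c -> 2 * M / k ^+ 2 <= c -> 0 <= u -> 0 <= w ->
  c^-1 * (u + w) <= Num.sqrt ((k ^+ 2 * u ^+ 2 + w ^+ 2) / M).
Proof.
move=> k0 k1 M0 c1 cM u0 w0.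
have c0 : 0 < c by exact: lt_le_trans c1.
have k2 : 0 < k ^+ 2 by exact: exprn_gt0.
have uw : 0 <= c^-1 * (u + w) by rewrite mulr_ge0 ?addr_ge0// invr_ge0 ltW.
rewrite -(ger0_norm uw) -sqrtr_sqr ler_wsqrtr// exprMn exprVn.
rewrite ler_pdivrMl ?exprn_gt0// mulrA ler_pdivlMr//.
have kc : 2 * M <= k ^+ 2 * c ^+ 2.
  apply: (@le_trans _ _ (k ^+ 2 * c)); first by rewrite -ler_pdivrMl// mulrC.
  by rewrite ler_pM2l// expr2 ler_peMr// ltW.
have k21 : k ^+ 2 <= 1 by rewrite expr_le1// ltW.
have h : 2 * M * (u ^+ 2 + w ^+ 2) <= c ^+ 2 * (k ^+ 2 * u ^+ 2 + w ^+ 2).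
  apply: (@le_trans _ _ (k ^+ 2 * c ^+ 2 * (u ^+ 2 + w ^+ 2))).
    by rewrite ler_wpM2r// addr_ge0 ?sqr_ge0.
  rewrite -mulrA mulrCA ler_pM2l ?exprn_gt0// mulrDr lerD2l.
  by rewrite ler_piMl ?sqr_ge0.
apply: le_trans h; rewrite mulrC [2 * M]mulrC -[leRHS]mulrA ler_pM2l//.
have := sqr_ge0 (u - w); rewrite sqrrB sqrrD; lra.
Qed.

(** * The lower estimate *)

Section LowerEstimate.
Variables (R : realType) (n : nat) (f : R -> R) (D : set (Cn R n.+1)).
Variables (C r0 t d E kap : R) (h : Cn R n.+1 -> R).
Hypothesis f0 : f 0 = 0.
Hypothesis f_incr : forall s t : R, 0 < s -> s <= t -> f s / s <= f t / t.
Hypothesis f_ge0 : forall t : R, 0 <= t -> 0 <= f t.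
Hypotheses (C0 : 0 < C) (t0 : 0 < t) (d0 : 0 < d) (ft : f t = d).
Hypothesis hC : forall z, enorm z < r0 -> `|h z| <= C * `|complex.Im (z ord0 ord0)|.
Hypothesis D_near : forall z, enorm z < r0 ->
  D z <-> complex.Re (z ord0 ord0) + h z < f (enorm (tail z)).
Hypotheses (oD : open D) (dr0 : d < r0 / 2) (d1 : d <= 1).
Hypothesis D_E : forall z, D z -> enorm z <= E.
Hypotheses (kap0 : 0 < kap) (kap8 : 8 * kap <= 1) (kapt : 8 * (kap * t) <= r0).
Implicit Types (z X : Cn R n.+1).

Lemma sibony_model_ge X (dd : R) : dd = E + 1 + r0 ->
  ((Num.sqrt (((kap / (4 * (5 + 4 * C))) ^+ 2 * (t / d * normc (X ord0 ord0)) ^+ 2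
      + enorm X ^+ 2) / (2 * dd ^+ 2 * expR 1 + 2 * dd ^+ 2 + 1)))%:E
    <= sibony D (q n d) X)%E.
Proof.
(* With x = |z_1 - d|, the bounds |z_1 - q_1| <= x + 2 d and d < 2 (1 + C) x give |z_1 - q_1| <= H
   x; dividing by H therefore keeps the rational term of the candidate below tau^2. *)
move=> ddE; pose H := 5 + 4 * C; pose tau := kap * t; pose sig := tau / H.
have H0 : 0 < H by rewrite addr_gt0// mulr_gt0.
have C1 : 0 < 2 * (1 + C) by rewrite mulr_gt0// addr_gt0.
have tau0 : 0 < tau by exact: mulr_gt0.
have sig0 : 0 <= sig by rewrite divr_ge0// ltW.
have Dq := D_q f_incr f_ge0 C0 t0 d0 ft hC D_near dr0.
have E0 : 0 <= E by apply: le_trans (enorm_ge0 _) (D_E Dq).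
have nq := enorm_q n (ltW d0).
(* In dd the terms E + 1 bound |z - q|, since d <= 1, and r0 puts it above tau. *)
have tau_d0 : tau < dd by move: tau0 E0 kapt; rewrite ddE -/tau; lra.
have bounded z : D z -> enorm (z - q n d) <= dd.
  move=> /D_E; have := ler_enormB z (q n d); rewrite nq ddE.
  by move: d1 dr0 d0; lra.
have far z : D z -> enorm (z - q n d) < 2 * tau ->
    d / (2 * (1 + C)) <= normc (z ord0 ord0 - d%:C) /\
    sig * normc (z ord0 ord0 - q n d ord0 ord0) <= tau * normc (z ord0 ord0 - d%:C).
  move=> Dz zq.
  have zr : enorm z < r0.
    have := ler_enormD (z - q n d) (q n d); rewrite subrK nq.
    by move: dr0 kapt zq; rewrite -/tau; lra.
  have zt : 2 * enorm (tail z) <= t.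
    have -> : tail z = tail (z - q n d).
      by rewrite -[in RHS]scaleN1r tailD tailZ tail_q scaler0 addr0.
    have := enorm_tail_le (z - q n d).
    have : 8 * tau <= t by rewrite /tau mulrA ger_pMl.
    by move: zq; lra.
  have dx := far_from_pole f0 f_incr C0 t0 d0 ft hC D_near Dz zr zt.
  set x : R := normc _ in dx *.
  split; first by rewrite ler_pdivrMr// mulrC ltW.
  have yx : normc (z ord0 ord0 - q n d ord0 ord0) <= x + 2 * d.
    have -> : z ord0 ord0 - q n d ord0 ord0 = (z ord0 ord0 - d%:C) + (2 * d)%:C.
      by rewrite q_ord0 rmorphN opprK -addrA mulrDl mul1r rmorphD addKr.
    by apply: (le_trans (ler_normcD _ _)); rewrite normc_real ger0_norm// mulr_ge0// ltW.
  rewrite /sig mulrAC ler_pdivrMr// -[leRHS]mulrA ler_pM2l//; apply: (le_trans yx).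
  by rewrite /H; lra.
have c10 : 0 < d / (2 * (1 + C)) by exact: divr_gt0.
have := sibony_ge_candidate oD Dq tau0 sig0 c10 tau_d0 bounded far X.
apply: le_trans; rewrite lee_fin ler_wsqrtr// ler_wpM2r//.
  have D2 : 0 <= 2 * dd ^+ 2 by apply: mulr_ge0 => //; exact: sqr_ge0.
  by rewrite invr_ge0 addr_ge0// addr_ge0// mulr_ge0// expR_ge0.
rewrite lerD2r le_eqVlt; apply/orP; left; apply/eqP.
(* The first term becomes sig^2 |X_1|^2 / (16 d^2), whence the constant kap / (4 H). *)
have -> : normc (q n d ord0 ord0 - d%:C) = 2 * d.
  rewrite q_ord0 -rmorphB normc_real ler0_norm; last by move: d0; lra.
  ring.
by rewrite /sig /tau /H; field; rewrite !gt_eqF.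
Qed.

End LowerEstimate.

(* The dimension of the ambient space C^n of the text is n.+1 here. *)
Theorem proposition6 (R : realType) (n : nat) (hn : (2 <= n.+1)%N)
  (f : R -> R)
  (f_cont : {within [set` `[0, +oo[], continuous f})
  (f_ge0 : forall t : R, 0 <= t -> 0 <= f t)
  (f_neq0 : exists t : R, 0 <= t /\ f t <> 0)
  (f0 : f 0 = 0)
  (f_incr : forall s t : R, 0 < s -> s <= t -> f s / s <= f t / t)
  (D : set (Cn R n.+1))
  (D_domain : is_domain D)
  (D_bounded : bounded_set D)
  (D_bd0 : boundary D 0)
  (D_near0 : exists (U : set (Cn R n.+1)) (C : R) (h : Cn R n.+1 -> R),
     [/\ nbhs (0 : Cn R n.+1) U,
         0 < C,
         (forall z, U z -> `|h z| <= C * `|complex.Im (z ord0 ord0)|) &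
         D `&` U =
           [set z | U z /\ complex.Re (z ord0 ord0) + h z < f (enorm (tail z))]]) :
  exists c : R, 1 < c /\
    \forall d \near (0 : R)^'+, forall X : Cn R n.+1,
      [/\ ((c^-1 * B f d X)%:E <= sibony D (q n d) X)%E,
          (sibony D (q n d) X <= azukawa D (q n d) X)%E &
          (azukawa D (q n d) X <= (c * B f d X)%:E)%E].
Proof.
have [oD _ _] := D_domain.
have [U [C [h [U0 C0 hU DU]]]] := D_near0.
have [r0 r00 r0U] := (nbhs_CnP 0 U).1 U0.
have {}r0U z : enorm z < r0 -> U z by move=> zr; apply: r0U; rewrite subr0.
have hC z : enorm z < r0 -> `|h z| <= C * `|complex.Im (z ord0 ord0)|.
  by move=> /r0U/hU.
have D_near z : enorm z < r0 ->
    D z <-> complex.Re (z ord0 ord0) + h z < f (enorm (tail z)).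
  move=> /r0U Uz; have := congr1 (fun A : set _ => A z) DU; rewrite /setI/= => E.
  split=> [Dz|zf]; first by have [] : U z /\ complex.Re (z ord0 ord0) + h z < f (enorm (tail z)) by rewrite -E.
  by have [] : D z /\ U z by rewrite E.
have [t1 [t1_ge0 ft1]] := f_neq0.
have t10 : 0 < t1 by rewrite lt0r t1_ge0 andbT; apply/eqP => t1E; apply: ft1; rewrite t1E.
have {}ft1 : 0 < f t1 by rewrite lt0r f_ge0// andbT; apply/eqP.
have [E E0 D_E] := bounded_enorm D_bounded.
(* Fixed before d: [8^-1] puts the ball of radius 2 tau around q where |z'| <= t / 2, and the other
   bound puts it, for t <= t1 and d < r0 / 2, where D is given by f. *)
pose kap := Num.min 8^-1 (r0 / (8 * t1)).
have kap0 : 0 < kap by rewrite lt_min invr_gt0 ltr0n divr_gt0// mulr_gt0.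
have kap8 : 8 * kap <= 1 by rewrite -ler_pdivlMl// mulr1 ge_min lexx.
have kapt t : t <= t1 -> 8 * (kap * t) <= r0.
  move=> tt1; apply: (@le_trans _ _ (kap * (8 * t1))).
    by rewrite mulrCA ler_pM2l// ler_pM2l.
  by rewrite -ler_pdivlMr ?mulr_gt0// ge_min lexx orbT.
(* These depend on D only through E and r0; the uniform bound on the branch [v2] is what makes the
   final c independent of d. *)
pose dd := E + 1 + r0; pose M := 2 * dd ^+ 2 * expR 1 + 2 * dd ^+ 2 + 1.
have M0 : 0 < M.
  have D2 : 0 <= 2 * dd ^+ 2 by apply: mulr_ge0 => //; exact: sqr_ge0.
  by rewrite ltr_wpDl// addr_ge0// mulr_ge0// expR_ge0.
pose k := kap / (4 * (5 + 4 * C)).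
have H0 : 0 < 4 * (5 + 4 * C) by rewrite mulr_gt0// addr_gt0// mulr_gt0.
have k0 : 0 < k by exact: divr_gt0.
have k1 : k <= 1.
  by rewrite ler_pdivrMr// mul1r; move: kap8 kap0 C0; lra.
have a0 : 0 < 2 * M / k ^+ 2 by apply: divr_gt0; [exact: mulr_gt0|exact: exprn_gt0].
have b0 : 0 < 8 * (1 + C) / r0 by rewrite divr_gt0// mulr_gt0// addr_gt0.
pose c := 2 + 2 * M / k ^+ 2 + 8 * (1 + C) / r0.
have c1 : 1 < c by rewrite /c; move: a0 b0; lra.
have ca : 2 * M / k ^+ 2 <= c by rewrite /c; move: a0 b0; lra.
have cb : 8 * (1 + C) / r0 <= c by rewrite /c; move: a0 b0; lra.
exists c; split => //; near=> d.
have d0 : 0 < d by near: d; exact: nbhs_right_gt.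
have d1 : d <= 1 by near: d; exact: nbhs_right_le.
have dr0 : d < r0 / 2 by near: d; apply: nbhs_right_lt; rewrite divr_gt0.
have df : d < f t1 by near: d; exact: nbhs_right_lt.
have [t0 ft tt1] := finv_spec f_cont f0 f_incr t10 d0 df.
move=> X; set t := Defs.finv f d in t0 ft tt1 *.
have B0 : 0 <= t / d * normc (X ord0 ord0).
  by rewrite mulr_ge0 ?normc_ge0// divr_ge0// ltW.
split.
- apply: le_trans (sibony_model_ge f0 f_incr f_ge0 C0 t0 d0 ft hC D_near oD dr0 d1 D_E kap0 kap8
    (kapt _ tt1) X erefl).
  by rewrite lee_fin; apply: linear_le_sqrt => //; [exact: ltW|exact: enorm_ge0].
- apply: sibony_le_azukawa => //.
  exact: D_q f_incr f_ge0 C0 t0 d0 ft hC D_near dr0.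
(* Dimension at least 2 provides the tangential coordinate used to tilt the discs. *)
- have j : 'I_n by exact: (Ordinal (hn : 0 < n)%N).
  apply: (le_trans (azukawa_model_le f_incr f_ge0 C0 t0 d0 ft hC D_near oD dr0 j X)).
  by rewrite lee_fin ler_wpM2r// addr_ge0// enorm_ge0.
Unshelve. all: by end_near.
Qed.
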